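(* (i) There are infinitely many primes $p$ such that there exists a $\mathrm{PSL}(2,11)$-transitive $110$-arc in $\mathrm{PG}(4,p^2)$ and there is no $\mathrm{PSL}(2,11)$-transitive $110$-arc in $\mathrm{PG}(4,p)$. (ii) Let $p$ be a prime such that $p^5 \equiv 23 \pmod{33}$. Then $\mathrm{PG}(4,p^2)$ contains a $\mathrm{PSL}(2,11)$-transitive $110$-arc (and $\mathrm{PG}(4,p)$ does not) if and only if $p > 3917$ or $p$ is one of $311,$ $317,$ $389,$ $401,$ $419,$ $443,$ $449,$ $467,$ $509,$ $521,$ $587,$ $599,$ $617,$ $641,$ $653,$ $719,$ $773,$ $839,$ $881,$ $911,$ $947,$ $977,$ $983,$ $1013,$ $1049,$ $1061,$ $1103,$ $1109,$ $1181,$ $1193,$ $1259,$ $1277,$ $1301,$ $1307,$ $1367,$ $1373,$ $1409,$ $1433,$ $1499,$ $1511,$ $1523,$ $1571,$ $1607,$ $1637,$ $1697,$ $1709,$ $1721,$ $1787,$ $1901,$ $1907,$ $1973,$ $2003,$ $2027,$ $2039,$ $2069,$ $2099,$ $2237,$ $2267,$ $2297,$ $2333,$ $2357,$ $2381,$ $2399,$ $2423,$ $2447,$ $2531,$ $2579,$ $2621,$ $2633,$ $2663,$ $2687,$ $2693,$ $2699,$ $2711,$ $2729,$ $2753,$ $2777,$ $2819,$ $2843,$ $2861,$ $2897,$ $2909,$ $2927,$ $2957,$ $2963,$ $3023,$ $3041,$ $3083,$ $3089,$ $3191,$ $3221,$ $3257,$ $3323,$ $3347,$ $3359,$ $3371,$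 $3389,$ $3413,$ $3491,$ $3557,$ $3617,$ $3623,$ $3677,$ $3701,$ $3719,$ $3767,$ $3821,$ $3833,$ $3851,$ $3881.$
   Context: For a prime power $q$, $\mathrm{PG}(4,q)$ is the projective space whose points are the $1$-dimensional subspaces of $\mathrm{GF}(q)^5$. A $k$-arc in $\mathrm{PG}(4,q)$ is a set of $k$ projective points such that no subcollection of $5$ of these points is contained in a hyperplane. A $k$-arc in $\mathrm{PG}(4,q)$ is called $\mathrm{PSL}(2,11)$-transitive if there is a subgroup $G \cong \mathrm{PSL}(2,11)$ of $\mathrm{PGL}(5,q)$, arising from a $5$-dimensional irreducible representation of $\mathrm{PSL}(2,11)$ over $\mathrm{GF}(q)$, such that the $k$-arc is $G$-invariant and $G$ acts transitively on its $k$ points. *)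

(* Defs.v *)
From HB Require Import structures.
From mathcomp Require Import all_boot all_order all_algebra.
From mathcomp Require Import all_fingroup all_solvable all_field all_character.

Set Implicit Arguments.
Unset Strict Implicit.
Unset Printing Implicit Defensive.

Import GRing.Theory.
Local Open Scope ring_scope.

Section SpecialLinear.

Variables (n : nat) (F : finFieldType).

Definition SL : {set {'GL_n[F]}} := [set g | \det (GLval g) == 1].

Fact SL_group_set : group_set SL.
Proof.
apply/group_setP; split=> [|g h]; first by rewrite inE GL_1E det1.
by rewrite !inE GL_ME det_mulmx => /eqP-> /eqP->; rewrite mul1r.
Qed.

Canonical SL_group := Group SL_group_set.

Definition PSL := (SL / 'Z(SL))%G.

Definition PGL := ('GL_n[F] / 'Z('GL_n[F]))%G.

End SpecialLinear.

(* Over a finite field, the subspaces of a finite-dimensional space form a    *)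
(* finite type, so that sets of projective points are ordinary finite sets.   *)
Section FiniteVspace.

Import VectorInternalTheory.

Variables (F : finFieldType) (vT : vectType F).

HB.instance Definition _ := [Countable of {vspace vT} by <:].
HB.instance Definition _ := [Finite of {vspace vT} by <:].

End FiniteVspace.

Section ProjectiveSpace.

Variable F : finFieldType.

Local Notation V := 'rV[F]_5.

Definition points : {set {vspace V}} := [set U | \dim U == 1%N].

Definition hyperplanes : {set {vspace V}} := [set H | \dim H == 4%N].

Definition is_arc (k : nat) (A : {set {vspace V}}) : Prop :=
  [/\ A \subset points,
      #|A| = k
    & forall S : {set {vspace V}}, S \subset A -> #|S| = 5%N ->
      ~ exists2 H, H \in hyperplanes & forall P, P \in S -> (P <= H)%VS].

Definition GL_vspace (U : {vspace V}) (g : {'GL_5[F]}) : {vspace V} :=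
  (linfun (mulmxr (GLval g)) @: U)%VS.

Fact GL_vspace_is_action : is_action [set: {'GL_5[F]}] GL_vspace.
Proof.
have mapM U (g h : {'GL_5[F]}) :
  GL_vspace U (g * h)%g = GL_vspace (GL_vspace U g) h.
  rewrite /GL_vspace -limg_comp; congr (_ @: U)%VS.
  by apply/lfunP=> v; rewrite comp_lfunE !lfunE /= mulmxA.
have map1 U : GL_vspace U 1%g = U.
  rewrite /GL_vspace -[RHS]lim1g; congr (_ @: U)%VS.
  by apply/lfunP=> v; rewrite !lfunE /= mulmx1.
split=> [g U W eqUW | U g h _ _]; last exact: mapM.
by rewrite -[U]map1 -[W]map1 -(mulgV g) !mapM eqUW.
Qed.

Canonical GL_vspace_action := Action GL_vspace_is_action.

(* The action of PGL(5, F) on subspaces induced by that of GL(5, F). By       *)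
(* definition %% keeps the subspaces moved by some element of 'Z('GL_5[F])    *)
(* fixed, but there are none: this center consists of scalar matrices.        *)
Definition PGL_vspace_action := (GL_vspace_action %% 'Z('GL_5[F]))%act.

(* The subgroup of PGL(5, F) arising from a linear representation. *)
Definition projective_image (gT : finGroupType) (L : {group gT})
    (rL : mx_representation F L 5) : {set coset_of 'Z('GL_5[F])} :=
  ((reprGLm rL @* L) / 'Z('GL_5[F]))%g.

Definition PSL211_transitive (A : {set {vspace V}}) : Prop :=
  exists G : {group coset_of 'Z('GL_5[F])},
    [/\ G \subset PGL 5 F,
        G \isog PSL 2 'F_11,
        exists2 rL : mx_representation F (PSL 2 'F_11) 5,
          mx_irreducible rL & projective_image rL = G,
        [acts G, on A | PGL_vspace_action]
      & [transitive G, on A | PGL_vspace_action]].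

Definition has_PSL211_transitive_arc (k : nat) : Prop :=
  exists2 A : {set {vspace V}}, is_arc k A & PSL211_transitive A.

End ProjectiveSpace.

Definition sporadic_primes : seq nat :=
  [:: 311; 317; 389; 401; 419; 443; 449; 467; 509; 521;
     587; 599; 617; 641; 653; 719; 773; 839; 881; 911;
     947; 977; 983; 1013; 1049; 1061; 1103; 1109; 1181; 1193;
     1259; 1277; 1301; 1307; 1367; 1373; 1409; 1433; 1499; 1511;
     1523; 1571; 1607; 1637; 1697; 1709; 1721; 1787; 1901; 1907;
     1973; 2003; 2027; 2039; 2069; 2099; 2237; 2267; 2297; 2333;
     2357; 2381; 2399; 2423; 2447; 2531; 2579; 2621; 2633; 2663;
     2687; 2693; 2699; 2711; 2729; 2753; 2777; 2819; 2843; 2861;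
     2897; 2909; 2927; 2957; 2963; 3023; 3041; 3083; 3089; 3191;
     3221; 3257; 3323; 3347; 3359; 3371; 3389; 3413; 3491; 3557;
     3617; 3623; 3677; 3701; 3719; 3767; 3821; 3833; 3851; 3881]%N.

(* Main.v *)
From HB Require Import structures.
From Stdlib Require Import ZArith.
From mathcomp Require Import all_boot all_order all_algebra.
From mathcomp Require Import all_fingroup all_solvable all_field all_character.
From mathcomp Require Import ssrZ zify ring.
Require Import Defs.

Set Implicit Arguments.
Unset Strict Implicit.
Unset Printing Implicit Defensive.

Import GRing.Theory.
Local Open Scope ring_scope.
#[local] Arguments Z.mul : simpl never.

(** Let S = SL(2, 11), generated by the unipotent u and the involution w modulo
    the centre, and let c = w u^6, an element of order 12. Both parts concern
    primes p congruent to 2 modulo 3: in the second one this follows from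
    p^5 = 23 modulo 33.

    Shape of the orbits. In an orbit of 110 lines the stabilizers in S have
    order 12, so that some line of the orbit is fixed by c^4, which generates a
    Sylow 3-subgroup. If the eigenvalue of c^4 on this line were 1, the line
    would be fixed by c and by an element that inverts c, and its stabilizer
    would be too large. So the eigenvalue is a primitive cube root of unity;
    there is none in GF(p), whence no arc in PG(4, p)
    ([no_arc_without_cube_root]). Over a larger field the stabilizer is then
    generated by c, and the line is spanned by an eigenvector of c whose
    eigenvalue is a primitive root of unity of order 3 or 6
    ([orbit110_base_point]).

    The representation. A five-dimensional representation of S that is trivial
    on the centre but not on u is conjugate, over an algebraic closure, to one
    with explicit matrices over Z[tau], where tau^2 + tau + 3 = 0
    ([model_intertwiner]). A diagonal element of S permutes five eigenvectors
    of u cyclically; in the basis that they form, the matrix of w is constant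
    along antidiagonals, hence determined by the differences of the traces of
    u^a w and u^-a w. Each of them is 0 or a Gauss sum, because up to the centre
    u^a w is conjugate to u^-a w, to u, or to the inverse of u. Hence every orbit
    of 110 lines is, up to conjugation, the image of one of two orbits with
    coordinates in Z[tau, omega], where omega^2 + omega + 1 = 0. One of them
    contains five points with determinant 0 and never gives an arc. The other
    one, the orbit of [point0], gives an arc over a field if and only if none
    of its five-by-five determinants maps to 0.

    The determinants. When p is congruent to 2 modulo 3 it stays prime in
    Z[omega], and x in Z[tau, omega] can vanish in a field of characteristic p
    only if p divides the norm of x to Z[omega], that is, the gcd
    [content_norm x] of its two coordinates. The group S and the two algebraic
    conjugations act on the 110 points; up to these symmetries there remain
    about 95000 determinants,
    and a prime p >= 311 divides one of their contents only if it is one of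
    [content_primes], all at most 3917 and none in the list of the theorem.
    For every other p >= 311, the field GF(p^2) contains omega and tau, the
    matrices of the model define an irreducible representation of S modulo its centre, and the
    110 points form an arc ([arc_in_square]). Conversely, each of the 25
    remaining primes p <= 3917 with p^5 = 23 modulo 33 comes with five
    points that are dependent modulo p, for each value of tau modulo p
    ([no_arc_bad_prime]). The first part follows since infinitely many primes
    are congruent to 2 modulo 3 ([large_prime_mod3]). *)

(** * The order Z[tau, omega] and exterior products in dimension five *)

Record oK := OK { k0 : Z; k1 : Z; k2 : Z; k3 : Z }.

Record vec5 (A : Type) := V5 { e0 : A; e1 : A; e2 : A; e3 : A; e4 : A }.

Section Computation.
Local Open Scope Z_scope.

Definition kconst (z : Z) : oK := OK z 0 0 0.

Definition kadd (x y : oK) : oK :=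
  let 'OK a b c d := x in let 'OK a' b' c' d' := y in
  OK (a + a') (b + b') (c + c') (d + d').

Definition ksub (x y : oK) : oK :=
  let 'OK a b c d := x in let 'OK a' b' c' d' := y in
  OK (a - a') (b - b') (c - c') (d - d').

Definition kmul (x y : oK) : oK :=
  let 'OK a b c d := x in let 'OK a' b' c' d' := y in
  let bb := b * b' in let dd := d * d' in let bd := b * d' + d * b' in
  let q0 := c * c' - 3 * dd in let q1 := c * d' + d * c' - dd in
  OK (a * a' - 3 * bb - q0) (a * b' + b * a' - bb - q1)
     (a * c' + c * a' - 3 * bd - q0) (a * d' + b * c' + c * b' + d * a' - bd - q1).

Definition conj_tau (x : oK) : oK :=
  let 'OK a b c d := x in OK (a - b) (- b) (c - d) (- d).

Definition conj_omega (x : oK) : oK :=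
  let 'OK a b c d := x in OK (a - c) (b - d) (- c) (- d).

(** For x = r + s tau with r, s in Z[omega], the product of x with its conjugate
    over Q(omega) is r^2 - r s + 3 s^2 = x0 + x1 omega, and this is gcd(x0, x1).
    A rational prime p that stays prime in Z[omega] divides it as soon as some
    prime above p divides x. *)
Definition content_norm (x : oK) : Z :=
  let 'OK a b c d := x in
  let cc := c * c in let dd := d * d in let cd := c * d in
  Z.gcd (a * a - cc - (a * b - cd) + 3 * (b * b - dd))
        (2 * a * c - cc - (a * d + b * c - cd) + 3 * (2 * b * d - dd)).

Definition vmap A B (f : A -> B) (v : vec5 A) : vec5 B :=
  let 'V5 a b c d e := v in V5 (f a) (f b) (f c) (f d) (f e).

Definition dot (x y : vec5 oK) : oK :=
  let 'V5 a b c d e := x in let 'V5 a' b' c' d' e' := y in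
  kadd (kmul a a') (kadd (kmul b b') (kadd (kmul c c') (kadd (kmul d d') (kmul e e')))).

Definition vmul (x : vec5 oK) (M : vec5 (vec5 oK)) : vec5 oK :=
  let col p := dot x (vmap p M) in
  V5 (col (@e0 _)) (col (@e1 _)) (col (@e2 _)) (col (@e3 _)) (col (@e4 _)).

Definition mmul (M N : vec5 (vec5 oK)) : vec5 (vec5 oK) := vmap (vmul^~ N) M.

Record bivec := Bivec { p01 : oK; p02 : oK; p03 : oK; p04 : oK; p12 : oK;
                        p13 : oK; p14 : oK; p23 : oK; p24 : oK; p34 : oK }.

Definition wedge2 (x y : vec5 oK) : bivec :=
  let 'V5 a b c d e := x in let 'V5 a' b' c' d' e' := y in
  let m x y' x' y := ksub (kmul x y') (kmul x' y) in
  Bivec (m a b' a' b) (m a c' a' c) (m a d' a' d) (m a e' a' e) (m b c' b' c)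
        (m b d' b' d) (m b e' b' e) (m c d' c' d) (m c e' c' e) (m d e' d' e).

(** Three-by-three minors, each stored under the pair of columns it omits. *)
Definition wedge3 (p : bivec) (z : vec5 oK) : bivec :=
  let 'Bivec p01 p02 p03 p04 p12 p13 p14 p23 p24 p34 := p in
  let 'V5 a b c d e := z in
  let t i pjk j pik k pij := kadd (ksub (kmul i pjk) (kmul j pik)) (kmul k pij) in
  Bivec (t c p34 d p24 e p23) (t b p34 d p14 e p13) (t b p24 c p14 e p12)
        (t b p23 c p13 d p12) (t a p34 d p04 e p03) (t a p24 c p04 e p02)
        (t a p23 c p03 d p02) (t a p14 b p04 e p01) (t a p13 b p03 d p01)
        (t a p12 b p02 c p01).

Definition wedge4 (q : bivec) (z : vec5 oK) : vec5 oK :=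
  let 'Bivec q01 q02 q03 q04 q12 q13 q14 q23 q24 q34 := q in
  let 'V5 a b c d e := z in
  let s w x y z := kadd (ksub x w) (ksub z y) in
  V5 (s (kmul b q01) (kmul c q02) (kmul d q03) (kmul e q04))
     (s (kmul c q12) (kmul a q01) (kmul e q14) (kmul d q13))
     (s (kmul a q02) (kmul b q12) (kmul d q23) (kmul e q24))
     (s (kmul b q13) (kmul a q03) (kmul e q34) (kmul c q23))
     (s (kmul a q04) (kmul b q14) (kmul c q24) (kmul d q34)).

Definition det5 (a b c d e : vec5 oK) : oK :=
  dot (wedge4 (wedge3 (wedge2 a b) c) d) e.

Definition mdet (M : vec5 (vec5 oK)) : oK :=
  let 'V5 a b c d e := M in det5 a b c d e.

End Computation.

Section IntegerImage.
Variable R : comPzRingType.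

Definition zr (z : Z) : R := (int_of_Z z)%:~R.

Lemma zr0 : zr 0 = 0. Proof. by []. Qed.
Lemma zr1 : zr 1 = 1. Proof. by []. Qed.
Lemma zrD x y : zr (Z.add x y) = zr x + zr y.
Proof. by rewrite /zr -rmorphD -(rmorphD int_of_Z). Qed.
Lemma zrN x : zr (Z.opp x) = - zr x.
Proof. by rewrite /zr -rmorphN -(rmorphN int_of_Z). Qed.
Lemma zrB x y : zr (Z.sub x y) = zr x - zr y.
Proof. by rewrite -zrN -zrD. Qed.
Lemma zrM x y : zr (Z.mul x y) = zr x * zr y.
Proof. by rewrite /zr -rmorphM -(rmorphM int_of_Z). Qed.
End IntegerImage.

Definition zrE := (zr0, zr1, zrD, zrB, zrM, zrN).

Lemma det_first_row (R : comPzRingType) n (f : nat -> nat -> R) :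
  \det (\matrix_(i < n.+1, j < n.+1) f i j) =
  \sum_(k < n.+1) (-1) ^+ k * f 0%N k *
    \det (\matrix_(i < n, j < n) f i.+1 (bump k j)).
Proof.
rewrite (expand_det_row _ ord0); apply: eq_bigr => k _.
rewrite /cofactor mxE add0n mulrCA mulrA; congr (_ * \det _).
by apply/matrixP=> i j; rewrite !mxE.
Qed.

Fixpoint laplace (R : comPzRingType) n (f : nat -> nat -> R) : R :=
  if n is n'.+1 then
    \sum_(k < n) (-1) ^+ k * f 0%N k * laplace n' (fun i j => f i.+1 (bump k j))
  else 1.

Lemma det_laplace (R : comPzRingType) n (f : nat -> nat -> R) :
  \det (\matrix_(i < n, j < n) f i j) = laplace n f.
Proof.
elim: n f => [|n IHn] f; first by rewrite det_mx00.
rewrite det_first_row; apply: eq_bigr => k _.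
by congr (_ * _); apply: (IHn (fun i j => f i.+1 (bump k j))).
Qed.

(** The minors are grouped as in the exterior products above, which share them
    between determinants with common rows. *)
Lemma det_mx55 (R : comPzRingType) (f : nat -> nat -> R) :
  \det (\matrix_(i < 5, j < 5) f i j) =
  let m2 j k := f 0%N j * f 1%N k - f 1%N j * f 0%N k in
  let m3 i j k := m2 j k * f 2 i - m2 i k * f 2 j + m2 i j * f 2 k in
  let m4 i j k l := m3 i j k * f 3 l - m3 i j l * f 3 k
                    + m3 i k l * f 3 j - m3 j k l * f 3 i in
  m4 0 1 2 3 * f 4 4 - m4 0 1 2 4 * f 4 3 + m4 0 1 3 4 * f 4 2
  - m4 0 2 3 4 * f 4 1 + m4 1 2 3 4 * f 4 0.
Proof.
have lapS n g : laplace n.+1 g = \sum_(k < n.+1) (-1) ^+ k * g 0%N k *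
    laplace n (fun i j => g i.+1 (bump k j)) by [].
have lap2 g : laplace 2 g = g 0%N 0%N * g 1%N 1%N - g 0%N 1%N * g 1%N 0%N.
  by rewrite /= !(big_ord_recl, big_ord0) /bump /=; ring.
have lap3 g : laplace 3 g = g 0%N 0%N * (g 1%N 1%N * g 2 2 - g 1%N 2 * g 2 1%N)
    - g 0%N 1%N * (g 1%N 0%N * g 2 2 - g 1%N 2 * g 2 0%N)
    + g 0%N 2 * (g 1%N 0%N * g 2 1%N - g 1%N 1%N * g 2 0%N).
  rewrite lapS !(big_ord_recl, big_ord0) !lap2 /bump /=.
  ring.
have lap4 g : laplace 4 g = g 0%N 0%N * laplace 3 (fun i j => g i.+1 (bump 0 j))
    - g 0%N 1%N * laplace 3 (fun i j => g i.+1 (bump 1 j))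
    + g 0%N 2 * laplace 3 (fun i j => g i.+1 (bump 2 j))
    - g 0%N 3 * laplace 3 (fun i j => g i.+1 (bump 3 j)).
  rewrite lapS !(big_ord_recl, big_ord0).
  by rewrite /= /bump /= expr0 expr1 !mul1r !mulN1r; ring.
rewrite det_laplace.
rewrite lapS !(big_ord_recl, big_ord0).
rewrite !lap4 !lap3 /bump /=.
ring.
Qed.

(** * Evaluation of Z[tau, omega] in a field *)

Section Evaluation.
Variables (F : fieldType) (t w : F).

Definition phi (x : oK) : F :=
  zr F (k0 x) + zr F (k1 x) * t + zr F (k2 x) * w + zr F (k3 x) * t * w.

Definition coord (A : Type) (x0 : A) (v : vec5 A) (j : nat) : A :=
  nth x0 [:: e0 v; e1 v; e2 v; e3 v; e4 v] j.

Definition phiv (v : vec5 oK) : 'rV[F]_5 := \row_j phi (coord (kconst 0) v j).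

Definition phim (M : vec5 (vec5 oK)) : 'M[F]_5 :=
  \matrix_(i, j) phi (coord (kconst 0) (coord (e0 M) M i) j).

Lemma row_phim M i : row i (phim M) = phiv (coord (e0 M) M i).
Proof. by apply/rowP=> j; rewrite !mxE. Qed.

Lemma phi_const z : phi (kconst z) = zr F z.
Proof. by rewrite /phi /= zr0; ring. Qed.

Lemma phiD x y : phi (kadd x y) = phi x + phi y.
Proof. by case: x y => a b c d [a' b' c' d']; rewrite /phi /= !zrE; ring. Qed.

Lemma phiB x y : phi (ksub x y) = phi x - phi y.
Proof. by case: x y => a b c d [a' b' c' d']; rewrite /phi /= !zrE; ring. Qed.

Hypotheses (tau_root : t ^+ 2 + t + 3%:R = 0) (omega_root : w ^+ 2 + w + 1 = 0).

Lemma phiM x y : phi (kmul x y) = phi x * phi y.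
Proof.
case: x y => a b c d [a' b' c' d']; rewrite /phi /= !zrE.
have -> : zr F (Zpos 3%positive) = 3%:R by [].
move: (zr F) => z.
(* The difference of the two sides is a combination of the two relations. *)
rewrite -[LHS]addr0 -[0](mulr0 (z b * z b' + (z b * z d' + z d * z b') * w
  + z d * z d' * w ^+ 2)) -[LHS]addr0 -[X in _ + X](mulr0 (z c * z c' - 3%:R * (z d * z d')
  + (z c * z d' + z d * z c' - z d * z d') * t)).
rewrite -{1}tau_root -{1}omega_root.
ring.
Qed.

Definition phiE := (phiD, phiB, phiM, phi_const).

Lemma phi_dot x y : phi (dot x y) = \sum_j phiv x 0 j * phiv y 0 j.
Proof.
case: x y => a b c d e [a' b' c' d' e'].
by rewrite !(big_ord_recl, big_ord0) !mxE /= !phiE addr0.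
Qed.

Lemma coord_vmap A (f : vec5 A -> A) (x0 : A) (y0 : vec5 A) (M : vec5 (vec5 A)) j :
  (j < 5)%N -> coord x0 (vmap f M) j = f (coord y0 M j).
Proof. by case: M => a b c d e; move: j => [|[|[|[|[|]]]]]. Qed.

Lemma phiv_mul x M : phiv (vmul x M) = phiv x *m phim M.
Proof.
apply/rowP=> j; rewrite !mxE.
transitivity (phi (dot x (vmap (coord (kconst 0) ^~ j) M))).
  by case: j => [] [|[|[|[|[|]]]]] // lt_j5; rewrite mxE.
rewrite phi_dot; apply: eq_bigr => k _; congr (_ * _).
by rewrite !mxE (coord_vmap _ _ (e0 M)).
Qed.

Lemma phim_mul M N : phim (mmul M N) = phim M *m phim N.
Proof.
apply/row_matrixP=> i; rewrite row_mul !row_phim -phiv_mul.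
by case: M => a b c d e; case: i => [] [|[|[|[|[|]]]]].
Qed.

Lemma det_phim a b c d e : \det (phim (V5 a b c d e)) = phi (det5 a b c d e).
Proof.
pose M := V5 a b c d e.
rewrite (det_mx55 (fun i j => phi (coord (kconst 0) (coord (e0 M) M i) j))) {}/M /=.
case: a b c d e => [a0 a1 a2 a3 a4] [b0 b1 b2 b3 b4] [c0 c1 c2 c3 c4]
  [d0 d1 d2 d3 d4] [f0 f1 f2 f3 f4]; rewrite /coord /=.
rewrite /det5 /= !phiE.
ring.
Qed.

Lemma det_mdet M : \det (phim M) = phi (mdet M).
Proof. by case: M => a b c d e; apply: det_phim. Qed.

End Evaluation.

(** * Vanishing modulo a prime that is inert in Z[omega] *)

Section Conjugation.
Variables (F : fieldType) (t w : F).

Lemma phi_conj_tau x : phi t w (conj_tau x) = phi (- 1 - t) w x.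
Proof. by case: x => a b c d; rewrite /phi /= !zrE; ring. Qed.

Lemma phi_conj_omega x : phi t w (conj_omega x) = phi t (- 1 - w) x.
Proof. by case: x => a b c d; rewrite /phi /= !zrE; ring. Qed.

End Conjugation.

Section PrimeCharacteristic.
Variables (F : fieldType) (p : nat).
Hypothesis charFp : p \in [pchar F].

Lemma zr_dvd z : zr F z = 0 -> Z.divide (Z.of_nat p) z.
Proof.
have nat_dvd n : n%:R = 0 :> F -> Z.divide (Z.of_nat p) (Z.of_nat n).
  move=> n0; have /dvdnP[k ->]: (p %| n)%N by rewrite (dvdn_pcharf charFp) n0.
  by exists (Z.of_nat k); lia.
case: z => [_|q|q]; first by exists Z0.
  by move=> /nat_dvd; rewrite positive_nat_Z.
rewrite -[Z.neg q]/(Z.opp (Zpos q)) zrN => /eqP; rewrite oppr_eq0 => /eqP q0.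
by apply/Z.divide_opp_r; move: q0 => /nat_dvd; rewrite positive_nat_Z.
Qed.

Lemma dvd_zr z : Z.divide (Z.of_nat p) z -> zr F z = 0.
Proof.
case=> k ->; rewrite zrM /zr.
have -> : int_of_Z (Z.of_nat p) = p%:Z by lia.
by rewrite -pmulrn (pcharf0 charFp) mulr0.
Qed.

Lemma zr_Frobenius z : zr F z ^+ p = zr F z.
Proof. by rewrite -(pFrobenius_autE charFp) /zr rmorph_int. Qed.

Variables t w : F.
Hypotheses (tau_root : t ^+ 2 + t + 3%:R = 0) (omega_root : w ^+ 2 + w + 1 = 0).
Hypothesis p_mod3 : (p %% 3 = 2)%N.

(** The Frobenius map exchanges the two primitive cube roots of unity, so that
    1 and omega are linearly independent over the prime field. *)
Lemma omega_free a b : zr F a + zr F b * w = 0 -> zr F a = 0 /\ zr F b = 0.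
Proof.
have w3 : w ^+ 3 = 1.
  apply/eqP; rewrite -subr_eq0 -(mulr0 (w - 1)) -omega_root; apply/eqP; ring.
have w0 : w != 0.
  by apply/eqP=> w0; move/eqP: w3; rewrite w0 expr0n eq_sym oner_eq0.
move=> ab0; have [b0|b_neq0] := eqVneq (zr F b) 0.
  by rewrite b0 mul0r addr0 in ab0.
have wE : w = - (zr F a) / zr F b.
  by apply: canRL (mulfK b_neq0) _; rewrite mulrC; apply/eqP; rewrite -addr_eq0 addrC ab0.
have wp : w ^+ p = w by rewrite wE expr_div_n zr_Frobenius -zrN zr_Frobenius.
have : w ^+ 2 = w.
  by rewrite -{2}wp (divn_eq p 3) p_mod3 exprD mulnC exprM w3 expr1n mul1r.
move/eqP; rewrite expr2 -subr_eq0 -{3}(mulr1 w) -mulrBr mulf_eq0 (negPf w0) subr_eq0.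
move/eqP=> w1; move: omega_root; rewrite w1 expr1n (_ : 1 + 1 + 1 = 3%:R); last by ring.
move/eqP.
rewrite -(dvdn_pcharf charFp) dvdn_prime2 ?(pcharf_prime charFp) // => /eqP p3.
by move: p_mod3; rewrite p3.
Qed.

(** Writing x = r + s tau, the equation phi x = 0 makes the norm r^2 - r s + 3 s^2
    vanish; [omega_free] then separates its two coordinates. *)
Lemma content_norm_dvd x : phi t w x = 0 -> Z.divide (Z.of_nat p) (content_norm x).
Proof.
case: x => a b c d; rewrite /phi /content_norm [k0 _]/= [k1 _]/= [k2 _]/= [k3 _]/=.
set X0 := (X in Z.gcd X _); set X1 := (X in Z.gcd _ X) => x0.
have [zX0 zX1] : zr F X0 = 0 /\ zr F X1 = 0; last first.
  by apply: Z.gcd_greatest; apply: zr_dvd.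
apply: omega_free.
have z2 : zr F (Zpos 2%positive) = 2%:R by [].
have z3 : zr F (Zpos 3%positive) = 3%:R by [].
pose r := zr F a + zr F c * w; pose s := zr F b + zr F d * w.
have rs0 : r + s * t = 0 by rewrite -x0 /r /s; ring.
rewrite /X0 /X1 !zrE z2 z3.
transitivity ((r + s * t) * (r - s * (1 + t)) + s ^+ 2 * (t ^+ 2 + t + 3%:R)
  - (zr F c ^+ 2 - zr F c * zr F d + 3%:R * zr F d ^+ 2) * (w ^+ 2 + w + 1)).
  by rewrite /r /s; ring.
by rewrite rs0 tau_root omega_root !(mul0r, mulr0) addr0 subr0.
Qed.

End PrimeCharacteristic.

(** * The orbit of 110 points and its symmetries *)

Section Data.
Local Open Scope Z_scope.

(** The images of the generators u = (1 1; 0 1) and w = (0 1; -1 0) of SL(2, 11)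
    in a five-dimensional representation over Z[tau], acting on row vectors. *)
Definition mat_u : vec5 (vec5 oK) :=
  V5 (V5 (OK 0 0 0 0) (OK 1 0 0 0) (OK 1 0 0 0) (OK 0 0 0 0) (OK 0 (-1) 0 0))
     (V5 (OK 0 0 0 0) (OK 0 0 0 0) (OK (-1) 0 0 0) (OK 0 0 0 0) (OK (-1) 0 0 0))
     (V5 (OK 0 0 0 0) (OK 0 0 0 0) (OK 0 0 0 0) (OK (-1) 0 0 0) (OK 0 0 0 0))
     (V5 (OK 1 0 0 0) (OK 0 0 0 0) (OK (-1) 0 0 0) (OK 0 1 0 0) (OK 0 0 0 0))
     (V5 (OK 0 0 0 0) (OK 0 0 0 0) (OK 1 0 0 0) (OK 0 0 0 0) (OK 0 0 0 0)).

Definition mat_w : vec5 (vec5 oK) :=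
  V5 (V5 (OK (-2) 0 0 0) (OK 1 1 0 0) (OK 2 0 0 0) (OK 0 (-1) 0 0) (OK 2 0 0 0))
     (V5 (OK 0 1 0 0) (OK 2 0 0 0) (OK 1 (-1) 0 0) (OK (-2) 0 0 0) (OK 1 (-1) 0 0))
     (V5 (OK 0 0 0 0) (OK 0 0 0 0) (OK 1 0 0 0) (OK 0 0 0 0) (OK 0 0 0 0))
     (V5 (OK 0 0 0 0) (OK 0 0 0 0) (OK 1 0 0 0) (OK 0 0 0 0) (OK 1 0 0 0))
     (V5 (OK 0 0 0 0) (OK 0 0 0 0) (OK (-1) 0 0 0) (OK 1 0 0 0) (OK 0 0 0 0)).

(** Combined with the conjugation of tau, respectively of omega, the next two
    matrices permute the 110 lines and fix the base point. *)
Definition mat_kappa : vec5 (vec5 oK) :=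
  V5 (V5 (OK 0 0 0 0) (OK 1 0 0 0) (OK 0 0 0 0) (OK 0 0 0 0) (OK 1 0 0 0))
     (V5 (OK (-1) (-1) 0 0) (OK (-1) 0 0 0) (OK 0 1 0 0) (OK 2 0 0 0) (OK 0 1 0 0))
     (V5 (OK 1 (-1) 0 0) (OK (-2) (-1) 0 0) (OK (-1) 0 0 0) (OK 1 1 0 0) (OK (-2) 0 0 0))
     (V5 (OK 1 0 0 0) (OK 0 (-1) 0 0) (OK 0 0 0 0) (OK 0 0 0 0) (OK (-1) (-1) 0 0))
     (V5 (OK 1 1 0 0) (OK 2 0 0 0) (OK 0 (-1) 0 0) (OK (-2) 0 0 0) (OK 0 (-1) 0 0)).

Definition mat_rho : vec5 (vec5 oK) :=
  V5 (V5 (OK 0 (-1) 0 0) (OK (-1) 0 0 0) (OK 1 1 0 0) (OK 2 0 0 0) (OK 0 0 0 0))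
     (V5 (OK (-2) 0 0 0) (OK 2 1 0 0) (OK 2 1 0 0) (OK 1 (-1) 0 0) (OK 3 0 0 0))
     (V5 (OK 1 1 0 0) (OK 2 0 0 0) (OK 1 0 0 0) (OK (-1) 0 0 0) (OK 2 (-1) 0 0))
     (V5 (OK 2 0 0 0) (OK 0 (-1) 0 0) (OK (-1) 0 0 0) (OK 1 1 0 0) (OK (-1) (-1) 0 0))
     (V5 (OK 1 0 0 0) (OK (-1) (-1) 0 0) (OK 0 (-1) 0 0) (OK (-1) 0 0 0) (OK (-3) (-1) 0 0)).

(** An eigenvector, with eigenvalue omega, of the element w u^6 of order 12. *)
Definition point0 : vec5 oK :=
  V5 (OK 2 0 (-1) (-1)) (OK 0 (-1) 0 1) (OK (-1) 0 0 1) (OK 0 1 1 0) (OK (-1) (-1) 1 1).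

(** The primes are repeated so that every content of a five-by-five determinant
    of the orbit that is at least 311 divides their product. *)
Definition content_primes : seq Z :=
  [:: 2; 2; 2; 2; 2; 2; 2; 2; 2; 2; 3; 3; 3; 3; 3; 3; 5; 5; 5; 5; 7; 7; 13; 13; 17; 19;
  19; 23; 23; 29; 31; 31; 37; 41; 47; 53; 59; 67; 71; 83; 89; 97; 101; 103; 107; 113;
  131; 137; 149; 157; 163; 167; 173; 179; 181; 191; 197; 199; 223; 229; 233; 239; 251;
  257; 263; 269; 293; 313; 331; 353; 359; 367; 379; 383; 397; 421; 431; 463; 491; 577;
  631; 643; 647; 659; 661; 683; 691; 751; 797; 823; 863; 929; 971; 991; 1031; 1093;
  1321; 1439; 1871; 3917].

End Data.

Definition parents : seq (nat * bool) :=
  [:: (0, false); (0, true); (1, false); (1, true); (2, false); (3, false); (3, true);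
  (4, false); (5, false); (5, true); (6, false); (6, true); (7, false); (8, false); (9,
  false); (9, true); (10, false); (12, false); (13, false); (13, true); (14, false);
  (14, true); (15, false); (15, true); (16, false); (17, false); (17, true); (19,
  false); (19, true); (21, false); (21, true); (23, true); (24, false); (25, false);
  (25, true); (26, false); (26, true); (28, false); (28, true); (29, false); (30,
  false); (30, true); (31, false); (32, false); (33, false); (33, true); (34, false);
  (34, true); (36, false); (36, true); (38, false); (38, true); (39, false); (40,
  false); (40, true); (41, false); (42, false); (43, false); (43, true); (44, false);
  (44, true); (45, true); (47, true); (48, false); (49, false); (51, false); (51, true);
  (53, false); (53, true); (54, false); (54, true); (56, false); (56, true); (57,
  false); (58, false); (58, true); (60, false); (60, true); (62, false); (63, false);
  (64, true); (65, false); (65, true); (66, true); (67, false); (68, false); (68, true);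
  (71, false); (72, false); (72, true); (74, false); (75, false); (75, true); (77,
  false); (77, true); (78, false); (79, false); (80, true); (82, false); (82, true);
  (84, false); (85, false); (86, true); (87, false); (88, false); (92, false); (95,
  false); (97, true); (100, false)]%N.

(** Each permutation lists the indices of the images of the 110 lines. *)
Definition perm_u : seq nat :=
  [:: 1; 3; 5; 6; 8; 9; 11; 13; 14; 15; 17; 2; 18; 19; 21; 23; 25; 26; 7; 28; 4; 30; 12;
  27; 33; 34; 36; 0; 38; 40; 41; 43; 44; 45; 47; 10; 49; 32; 51; 53; 54; 56; 57; 58; 60;
  39; 16; 37; 64; 65; 63; 66; 62; 68; 70; 20; 72; 74; 75; 22; 77; 24; 79; 80; 73; 82;
  59; 85; 86; 29; 31; 88; 89; 50; 91; 92; 84; 94; 96; 97; 87; 35; 99; 42; 101; 102; 76;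
  104; 105; 55; 81; 71; 106; 103; 46; 107; 67; 100; 48; 90; 109; 61; 52; 98; 93; 108;
  69; 83; 95; 78]%N.

Definition perm_w : seq nat :=
  [:: 2; 4; 0; 7; 1; 10; 12; 3; 11; 16; 5; 8; 6; 20; 22; 24; 9; 27; 18; 29; 13; 31; 14;
  32; 15; 35; 37; 17; 39; 19; 42; 21; 23; 46; 48; 25; 50; 26; 52; 28; 55; 49; 30; 59;
  61; 62; 33; 63; 34; 41; 36; 67; 38; 69; 71; 40; 73; 70; 76; 43; 78; 44; 45; 47; 81;
  83; 84; 51; 87; 53; 57; 54; 90; 56; 91; 93; 58; 95; 60; 94; 98; 64; 100; 65; 66; 102;
  103; 68; 89; 88; 72; 74; 92; 75; 79; 77; 101; 108; 80; 105; 82; 96; 85; 86; 106; 99;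
  104; 109; 97; 107]%N.

Definition perm_kappa : seq nat :=
  [:: 0; 8; 42; 71; 32; 20; 94; 34; 56; 11; 73; 44; 108; 14; 41; 87; 109; 89; 55; 95;
  82; 46; 17; 85; 63; 30; 21; 93; 35; 100; 65; 18; 9; 4; 15; 101; 64; 84; 67; 70; 25;
  28; 5; 91; 72; 98; 69; 45; 53; 33; 74; 75; 31; 77; 57; 51; 27; 83; 47; 102; 79; 40;
  37; 6; 103; 105; 92; 78; 36; 76; 12; 66; 68; 1; 81; 97; 61; 43; 7; 62; 80; 107; 59;
  106; 90; 16; 24; 86; 26; 2; 13; 19; 39; 99; 38; 58; 48; 50; 96; 54; 22; 60; 29; 49;
  52; 88; 10; 104; 23; 3]%N.

Definition perm_rho : seq nat :=
  [:: 0; 93; 20; 85; 68; 42; 87; 67; 27; 44; 54; 11; 92; 35; 28; 94; 109; 59; 75; 95; 2;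
  65; 102; 71; 24; 69; 105; 8; 14; 100; 46; 97; 72; 36; 38; 13; 33; 79; 34; 70; 76; 41;
  5; 47; 9; 77; 30; 43; 96; 64; 52; 55; 50; 98; 10; 51; 56; 106; 91; 17; 84; 61; 62; 86;
  49; 21; 108; 7; 4; 25; 39; 23; 32; 99; 104; 18; 40; 45; 78; 37; 80; 107; 89; 83; 60;
  3; 63; 6; 88; 82; 101; 58; 12; 1; 15; 19; 48; 31; 53; 73; 29; 90; 22; 103; 74; 26; 57;
  81; 66; 16]%N.

Definition homeward : seq nat :=
  [:: 0; 2; 1; 2; 0; 2; 0; 0; 3; 2; 0; 0; 2; 1; 1; 0; 1; 1; 2; 0; 3; 0; 2; 0; 1; 0; 1;
  0; 2; 2; 0; 3; 1; 2; 2; 0; 0; 0; 3; 2; 1; 0; 2; 1; 3; 3; 3; 0; 1; 1; 0; 3; 1; 0; 1; 0;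
  2; 3; 3; 3; 0; 0; 2; 2; 0; 0; 3; 1; 3; 3; 2; 3; 0; 1; 0; 2; 3; 0; 2; 1; 0; 0; 3; 2; 1;
  3; 2; 3; 1; 2; 1; 0; 3; 3; 3; 1; 2; 1; 0; 3; 2; 3; 3; 2; 1; 0; 2; 1; 2; 2]%N.

Definition rank0 : seq nat :=
  [:: 0; 1; 3; 0; 6; 3; 7; 7; 1; 6; 1; 6; 0; 2; 2; 7; 0; 3; 9; 4; 3; 8; 3; 0; 7; 8; 8;
  1; 2; 3; 8; 9; 6; 6; 7; 2; 6; 2; 7; 0; 8; 2; 3; 4; 6; 4; 8; 4; 4; 6; 9; 9; 9; 4; 1; 9;
  1; 1; 4; 3; 2; 8; 2; 7; 6; 8; 0; 7; 6; 8; 0; 0; 6; 1; 9; 9; 8; 4; 7; 2; 5; 9; 3; 1; 2;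
  0; 7; 7; 8; 3; 2; 4; 0; 1; 7; 4; 4; 9; 4; 1; 3; 2; 3; 6; 9; 8; 1; 9; 0; 0]%N.

(** The pairs of points fall into ten orbits under the symmetries; these levels
    are treated one after the other. Level r consists of a point b such that the
    pair 0, b represents it, of words that preserve this pair, and of orbits under
    these words. They are the candidates for the remaining points of a dependent
    five-set that contains 0 and b and has no pair of a lower level. [rank0] gives
    the level of the pair 0, y. *)
Definition levels : seq (nat * seq (seq nat) * seq (seq nat)) :=
  [::(3, [:: [::]; [:: 2; 3; 0; 0]; [:: 3; 2; 2; 2]; [:: 0; 0; 1; 3; 0; 3]],
   [:: [:: 2; 15; 78; 102]; [:: 4; 50; 55; 103]; [:: 5; 9; 36; 82]; [:: 6; 27; 63; 93];
   [:: 7; 16; 34; 66]; [:: 8; 29; 54; 89]; [:: 10; 31; 81; 106]; [:: 11; 23; 39; 68];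
   [:: 13; 51; 79; 97]; [:: 14; 44; 60; 72]; [:: 17; 62; 90; 100]; [:: 18; 42; 59; 74];
   [:: 19; 38; 45; 86]; [:: 21; 26; 56; 99]; [:: 24; 37; 84; 94]; [:: 30; 41; 61; 101];
   [:: 32; 48; 64; 77]; [:: 33; 49; 65; 76]; [:: 43; 85; 92; 96]; [:: 46; 47; 88; 95];
   [:: 52; 71; 107; 109]; [:: 69; 70; 105; 108]; [:: 73; 83; 91; 98]; [:: 1; 57]; [::
   12; 22]; [:: 25; 40]; [:: 28; 35]; [:: 58; 75]; [:: 67; 87]; [:: 80; 104]; [:: 20];
   [:: 53]]);
  (1, [:: [::]; [:: 2; 3; 0]; [:: 2; 2; 2; 0]; [:: 2; 2; 2; 2; 3]],
   [:: [:: 2; 4; 9; 89]; [:: 7; 51; 63; 104]; [:: 8; 72; 73; 103]; [:: 10; 14; 56; 90];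
   [:: 11; 15; 33; 86]; [:: 17; 42; 57; 99]; [:: 19; 28; 37; 77]; [:: 20; 52; 55; 100];
   [:: 21; 41; 61; 84]; [:: 24; 34; 46; 76]; [:: 26; 29; 40; 82]; [:: 35; 62; 81; 97];
   [:: 43; 75; 91; 107]; [:: 45; 64; 68; 98]; [:: 47; 67; 94; 96]; [:: 50; 74; 83; 93];
   [:: 5; 22]; [:: 13; 38]; [:: 30; 105]; [:: 32; 60]; [:: 36; 65]; [:: 44; 49]; [:: 48;
   58]; [:: 54; 69]; [:: 79; 101]; [:: 80; 87]]);
  (13, [:: [::]; [:: 1; 3; 1]; [:: 2; 2; 2; 2; 3]; [:: 2; 1; 2; 2; 2; 1]],
   [:: [:: 4; 9; 75; 107]; [:: 7; 59; 63; 102]; [:: 11; 17; 33; 42]; [:: 19; 29; 77;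
   82]; [:: 20; 25; 88; 100]; [:: 24; 34; 79; 101]; [:: 26; 40; 67; 94]; [:: 35; 53; 62;
   95]; [:: 41; 81; 84; 97]; [:: 46; 50; 74; 76]; [:: 47; 72; 96; 103]; [:: 48; 52; 55;
   58]; [:: 2; 89]; [:: 15; 86]; [:: 36; 38]; [:: 44; 49]; [:: 45; 98]; [:: 69; 80]; [::
   60]; [:: 65]]);
  (2, [:: [::]; [:: 1]; [:: 2; 2; 2; 3]; [:: 1; 2; 2; 2; 3]],
   [:: [:: 19; 29; 43; 59]; [:: 21; 31; 40; 55]; [:: 30; 42; 88; 89]; [:: 33; 44; 46;
   61]; [:: 34; 47; 48; 63]; [:: 36; 50; 64; 81]; [:: 38; 51; 52; 67]; [:: 53; 58; 69;
   76]; [:: 68; 86; 87; 103]; [:: 15; 24]; [:: 74; 91]; [:: 77; 95]; [:: 80; 98]; [::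
   82; 100]; [:: 18]]);
  (19, [:: [::]; [:: 2; 3]; [:: 0; 3; 2; 0; 2; 0]; [:: 1; 2; 2; 2; 1; 0]],
   [:: [:: 4; 26; 65; 72]; [:: 6; 15; 52; 97]; [:: 18; 51; 64; 103]; [:: 36; 49; 67;
   78]; [:: 40; 69; 91; 95]; [:: 61; 63; 76; 87]; [:: 25; 46]; [:: 31; 75]; [:: 48; 98]]);
  (80, [:: [::]; [:: 2]; [:: 3]; [:: 2; 2]; [:: 2; 3]; [:: 3; 2]; [:: 2; 2; 2]; [:: 2; 2; 3];
   [:: 3; 2; 2]; [:: 3; 2; 3]; [:: 2; 2; 2; 3]; [:: 3; 2; 2; 3]],
   [:: [:: 4; 9; 11; 32; 33; 36; 44; 49; 64; 68; 72; 103]]);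
  (4, [:: [::]; [:: 0; 1; 0; 3; 0]; [:: 1; 2; 2; 2; 0]; [:: 0; 2; 2; 0; 2; 3]],
   [:: [:: 9; 49; 61; 88]; [:: 24; 32; 33; 78]; [:: 25; 50; 65; 97]; [:: 11; 103]; [::
   15; 46]; [:: 63; 67]; [:: 74; 75]]);
  (6, [:: [::]; [:: 2; 3; 0; 0; 0]; [:: 3; 2; 2; 2; 2]; [:: 0; 1; 3; 0; 3; 2]],
   [:: [:: 31; 69; 88; 107]; [:: 52; 78; 87; 104]; [:: 25; 34]; [:: 61; 65]; [:: 75;
   97]]);
  (21, [:: [::]; [:: 3; 2; 2; 2; 2]; [:: 3; 2; 0; 2; 0; 0]; [:: 2; 1; 2; 0; 1; 0; 1]],
   [:: [:: 50; 51; 69; 88]; [:: 18; 81]]);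
  (18, [:: [::]; [:: 2; 2; 2; 3]],
   [:: [:: 31; 55]])]%N.

Section Checks.
Local Open Scope Z_scope.

Definition keqb (x y : oK) : bool :=
  let 'OK a b c d := x in let 'OK a' b' c' d' := y in
  [&& Z.eqb a a', Z.eqb b b', Z.eqb c c' & Z.eqb d d'].

Definition veqb (x y : vec5 oK) : bool :=
  let 'V5 a b c d e := x in let 'V5 a' b' c' d' e' := y in
  [&& keqb a a', keqb b b', keqb c c', keqb d d' & keqb e e'].

Definition omega_powers : seq oK := [:: OK 1 0 0 0; OK 0 0 1 0; OK (-1) 0 (-1) 0].

Definition content_bound : Z := foldr Z.mul 1 content_primes.

(** In a characteristic congruent to 2 modulo 3, an element with such a content
    can vanish only if the characteristic is below 311 or divides [content_bound]. *)
Definition allowed_content (g : Z) : bool :=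
  if Z.ltb 0 g then
    if Z.ltb g 311 then true else Z.eqb (Z.modulo content_bound g) 0
  else false.

Definition unit_det (N : vec5 (vec5 oK)) : bool :=
  keqb (mdet N) (kconst 1) || keqb (mdet N) (kconst (-1)).

End Checks.

(** The values along the spanning tree [parents] of the orbit: the entry q of the
    table says that the next point is the image of point q.1 under u or w. *)
Definition tree (A : Type) (step : A -> bool -> A) (a : A) : seq A :=
  foldl (fun acc q => rcons acc (step (nth a acc q.1) q.2)) [:: a] parents.

Definition generator_mat (s : bool) := if s then mat_w else mat_u.

Definition orbit_points : vec5 oK -> seq (vec5 oK) :=
  tree (fun v s => vmul v (generator_mat s)).

Lemma tree_rel (A B : Type) (R : A -> B -> Prop) f g a b :
  R a b -> (forall x y s, R x y -> R (f x s) (g y s)) ->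
  forall i, R (nth a (tree f a) i) (nth b (tree g b) i).
Proof.
move=> Rab Rstep; rewrite /tree; set la := [:: a]; set lb := [:: b].
have : size la = size lb by [].
have : forall i, R (nth a la i) (nth b lb i) by case=> [|[]].
elim: parents la lb => [|q qs IHq] la lb Rl sz //=; apply: IHq => [i|].
  by rewrite !nth_rcons sz; case: ltnP => // _; case: eqP => // _; apply: Rstep.
by rewrite !size_rcons sz.
Qed.

Definition perms : seq (seq nat) := [:: perm_u; perm_w; perm_kappa; perm_rho].

Definition act (g x : nat) : nat := nth 0%N (nth [::] perms g) x.

Definition acts (word : seq nat) (x : nat) : nat := foldl (fun y g => act g y) x word.

Definition symmetry_check (pts : seq (vec5 oK)) (conj : oK -> oK) N (perm : seq nat) : bool :=
  unit_det N &&
  all (fun i => has (fun c => veqb (vmul (vmap conj (nth point0 pts i)) N)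
                                  (vmap (kmul c) (nth point0 pts (nth 0%N perm i))))
                    omega_powers)
      (iota 0 110).

Definition symmetries_check (pts : seq (vec5 oK)) : bool :=
  [&& symmetry_check pts id mat_u perm_u, symmetry_check pts id mat_w perm_w,
      symmetry_check pts conj_tau mat_kappa perm_kappa &
      symmetry_check pts conj_omega mat_rho perm_rho].

Definition perm_check (perm : seq nat) : bool :=
  [&& size perm == 110, uniq perm & all (fun i => i < 110)%N perm].

(** A word that moves x to the base point 0; [homeward] points along a breadth
    first search tree of depth 6. *)
Fixpoint path_home (n x : nat) : seq nat :=
  if n is n'.+1 then
    if x == 0%N then [::] else let g := nth 0%N homeward x in g :: path_home n' (act g x)
  else [::].

Definition to_base : nat -> seq nat := path_home 6.

(** The level of a pair is found by moving its first point to 0. *)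
Definition rank (x y : nat) : nat := nth 0%N rank0 (acts (to_base x) y).

Definition level_point (r : nat) : nat := (nth (0%N, [::], [::]) levels r).1.1.
Definition level_words (r : nat) : seq (seq nat) := (nth (0%N, [::], [::]) levels r).1.2.
Definition level_orbits (r : nat) : seq (seq nat) := (nth (0%N, [::], [::]) levels r).2.

(** The symmetries 2 and 3, the semilinear ones, fix the base point. *)
Definition rotations : seq (seq nat) :=
  [seq nseq i 2 ++ nseq j 3 | i <- iota 0 12, j <- iota 0 2].

Definition transport_check : bool :=
  all (fun x => acts (to_base x) x == 0%N) (iota 0 110) &&
  all (fun y => (nth 0%N rank0 y < 10)%N &&
         has (fun s => (acts s 0%N == 0%N) && (acts s y == level_point (nth 0%N rank0 y)))
             rotations)
      (iota 1 109).

(** Points that form a pair of a lower level with 0 or b have been excluded. *)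
Definition cover_check (r : nat) : bool :=
  let b := level_point r in
  all (fun z => (z == b) || (nth 0%N rank0 z < r)%N || (rank b z < r)%N ||
                (z \in flatten (level_orbits r)))
      (iota 1 109).

Definition stabilizer_check (r : nat) : bool :=
  let b := level_point r in
  all (fun o => all (fun z => has (fun s =>
      (acts s z == head 0%N o) &&
      ((acts s 0%N == 0%N) && (acts s b == b) || (acts s 0%N == b) && (acts s b == 0%N)))
      (level_words r)) o)
    (level_orbits r).

Definition words_check : bool :=
  all (fun g => g < 4)%N homeward &&
  all (fun r => all (all (fun g => g < 4)%N) (level_words r)) (iota 0 10).

(** Here q holds the three-by-three minors of three fixed points. *)
Fixpoint pairs_check (q : bivec) (l : seq (vec5 oK)) : bool :=
  if l is d :: l' then
    let n := wedge4 q d in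
    all (fun e => allowed_content (content_norm (dot n e))) l' && pairs_check q l'
  else true.

(** The third point can be moved to the representative of its orbit, and the
    first orbit that meets a five-set may be chosen: the other two points are
    then taken in this orbit and in the later ones. *)
Fixpoint orbits_check (pts : seq (vec5 oK)) (p : bivec) (os : seq (seq nat)) : bool :=
  if os is o :: os' then
    if o is c :: o' then
      pairs_check (wedge3 p (nth point0 pts c)) (map (nth point0 pts) (o' ++ flatten os'))
      && orbits_check pts p os'
    else false
  else true.

Definition level_check (pts : seq (vec5 oK)) (r : nat) : bool :=
  orbits_check pts (wedge2 (nth point0 pts 0) (nth point0 pts (level_point r))) (level_orbits r).

(** This covers 95171 determinants. *)
Lemma levels_ok : all (level_check (orbit_points point0)) (iota 0 10).
Proof. by vm_compute. Qed.

Lemma perms_ok : all perm_check perms.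
Proof. by vm_compute. Qed.

Lemma symmetries_ok : symmetries_check (orbit_points point0).
Proof. by vm_compute. Qed.

Lemma transport_ok : transport_check.
Proof. by vm_compute. Qed.

Lemma covers_ok : all cover_check (iota 0 10).
Proof. by vm_compute. Qed.

Lemma stabilizers_ok : words_check && all stabilizer_check (iota 0 10).
Proof. by vm_compute. Qed.

Lemma keqbP x y : keqb x y -> x = y.
Proof.
by case: x y => a b c d [a' b' c' d'] /and4P[/Z.eqb_eq-> /Z.eqb_eq-> /Z.eqb_eq-> /Z.eqb_eq->].
Qed.

Lemma veqbP x y : veqb x y -> x = y.
Proof.
case: x y => a b c d e [a' b' c' d' e'].
by case/and5P=> /keqbP-> /keqbP-> /keqbP-> /keqbP-> /keqbP->.
Qed.

(** The predicate P selects the cube roots of unity that can occur as factors. *)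
Definition symmetry (pts : seq (vec5 oK)) conj N (perm : seq nat) : Prop :=
  unit_det N /\ forall i, (i < 110)%N -> exists P : pred oK,
    has P omega_powers /\ forall c, P c ->
    vmul (vmap conj (nth point0 pts i)) N =
    vmap (kmul c) (nth point0 pts (nth 0%N perm i)).

Lemma symmetryP pts conj N perm : symmetry_check pts conj N perm -> symmetry pts conj N perm.
Proof.
case/andP=> uN symN; split=> // i i110.
have i_in : i \in iota 0 110 by rewrite mem_iota.
move: (allP symN i i_in) => Pi; eexists; split; first exact: Pi.
by move=> c /veqbP.
Qed.

Definition symmetries (pts : seq (vec5 oK)) : Prop :=
  [/\ symmetry pts id mat_u perm_u, symmetry pts id mat_w perm_w,
      symmetry pts conj_tau mat_kappa perm_kappa &
      symmetry pts conj_omega mat_rho perm_rho].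

Section Dependence.
Variables (F : fieldType) (pts : seq (vec5 oK)).
Hypothesis symmetric : symmetries pts.

Definition roots (t w : F) : Prop := t ^+ 2 + t + 3%:R = 0 /\ w ^+ 2 + w + 1 = 0.

Definition pt (i : nat) : vec5 oK := nth point0 pts i.

(** The points with indices in s lie, for some embedding of Z[tau, omega],
    in the hyperplane with equation h. *)
Definition dependent (s : seq nat) : Prop :=
  exists t w, roots t w /\
  exists2 h : 'cV[F]_5, h != 0 & forall i, i \in s -> phiv t w (pt i) *m h = 0.

Lemma unit_det_unitmx t w N : roots t w -> unit_det N -> phim t w N \in unitmx.
Proof.
move=> [t2 w2] /orP[]/keqbP detN; rewrite unitmxE (det_mdet t2 w2) detN phi_const.
  by rewrite zr1 unitr1.
by rewrite -[Z.neg 1]/(Z.opp 1) zrN zr1 unitrN1.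
Qed.

Lemma phiv_scale t w c v : roots t w ->
  phiv t w (vmap (kmul c) v) = phi t w c *: phiv t w v.
Proof.
case=> t2 w2; apply/rowP=> j; rewrite !mxE -phiM //.
by case: v => v0 v1 v2 v3 v4; case: j => [] [|[|[|[|[|]]]]].
Qed.

Lemma has_omega_power t w (P : pred oK) : roots t w -> has P omega_powers ->
  exists2 c, P c & phi t w c != 0.
Proof.
move=> [_ w2]; rewrite /= orbF => /or3P[] Pc.
- exists (OK 1 0 0 0); rewrite // (phi_const t w 1) zr1; exact: oner_neq0.
- exists (OK 0 0 1 0); rewrite // /phi /= zr0 zr1 !(mul0r, mul1r, add0r, addr0).
  by apply/eqP=> w0; move/eqP: w2; rewrite w0 expr0n !add0r oner_eq0.
- exists (OK (-1) 0 (-1) 0); rewrite // /phi /=.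
  rewrite -[Z.neg 1]/(Z.opp 1) zrN zr0 zr1 !(mul0r, addr0) mulN1r.
  apply/eqP=> w1; move/eqP: w2.
  have -> : w = -1 by rewrite -[LHS]opprK -[- w](addKr (- 1)) w1 addr0 opprK.
  by rewrite sqrrN expr1n subrr add0r oner_eq0.
Qed.

(** The conjugation changes the embedding of Z[tau, omega], and the matrix moves
    the hyperplane. *)
Lemma dependent_symmetry (conj : oK -> oK) N perm s :
  (forall t w, roots t w ->
     exists t' w', roots t' w' /\ forall x, phi t' w' (conj x) = phi t w x) ->
  symmetry pts conj N perm ->
  all (fun i => i < 110)%N s -> dependent s -> dependent (map (nth 0%N perm) s).
Proof.
move=> conjP [uN symN] s110 [t [w [tw [h h0 hs]]]].
have [t' [w' [tw' phi_conj]]] := conjP t w tw.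
have NU := unit_det_unitmx tw' uN.
exists t', w'; split=> //; exists (invmx (phim t' w' N) *m h).
  apply: contra h0 => /eqP Nh0.
  by rewrite -(mulKVmx NU h) Nh0 mulmx0.
move=> _ /mapP[i si ->].
have [P [hasP ptE]] := symN i (allP s110 i si).
have [c /ptE{}ptE c0] := has_omega_power tw' hasP.
have conjE : phiv t' w' (vmap conj (pt i)) = phiv t w (pt i).
  apply/rowP=> j; rewrite !mxE -phi_conj; congr (phi _ _ _).
  by case: (pt i) => v0 v1 v2 v3 v4; case: j => [] [|[|[|[|[|]]]]].
have E : phi t' w' c *: phiv t' w' (pt (nth 0%N perm i)) = phiv t w (pt i) *m phim t' w' N.
  rewrite -phiv_scale // -conjE -phiv_mul; [by rewrite -ptE | exact: tw'.1 | exact: tw'.2].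
by apply: (scalerI c0); rewrite scaler0 scalemxAl E -mulmxA mulKVmx // hs.
Qed.

Lemma dependent_act g s : (g < 4)%N -> all (fun i => i < 110)%N s ->
  dependent s -> dependent (map (act g) s).
Proof.
have [sym_u sym_w sym_kappa sym_rho] := symmetric.
have idP t w : roots t w ->
    exists t' w', roots t' w' /\ forall x, phi t' w' (id x) = phi t w x.
  by move=> tw; exists t, w.
have conjroot (a c : F) : a ^+ 2 + a + c = 0 -> (- 1 - a) ^+ 2 + (- 1 - a) + c = 0.
  by move=> <-; ring.
have KN (a : F) : - 1 - (- 1 - a) = a by ring.
case: g => [|[|[|[|]]]] // _.
- exact: dependent_symmetry idP sym_u.
- exact: dependent_symmetry idP sym_w.
- apply: dependent_symmetry sym_kappa => t w [t2 w2].
  exists (- 1 - t), w; split; first by split; first exact: conjroot.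
  by move=> x; rewrite phi_conj_tau KN.
apply: dependent_symmetry sym_rho => t w [t2 w2].
exists t, (- 1 - w); split; first by split; last exact: conjroot.
by move=> x; rewrite phi_conj_omega KN.
Qed.

Lemma act_lt g x : (g < 4)%N -> (x < 110)%N -> (act g x < 110)%N.
Proof.
move=> g4 x110; have /allP/(_ (nth [::] perms g)) := perms_ok.
case/(_ (mem_nth _ _))/and3P=> // /eqP sz _ /allP; apply.
by apply: mem_nth; rewrite sz.
Qed.

Lemma act_inj g x y : (g < 4)%N -> (x < 110)%N -> (y < 110)%N ->
  act g x = act g y -> x = y.
Proof.
move=> g4 x110 y110; have /allP/(_ (nth [::] perms g)) := perms_ok.
case/(_ (mem_nth _ _))/and3P=> // /eqP sz Up _ /eqP.
by rewrite nth_uniq ?sz // => /eqP.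
Qed.

Definition in_orbit (s : seq nat) := all (fun i => i < 110)%N s.

Lemma dependent_acts word s : all (fun g => g < 4)%N word -> in_orbit s -> uniq s ->
  dependent s ->
  [/\ in_orbit (map (acts word) s), uniq (map (acts word) s) & dependent (map (acts word) s)].
Proof.
elim: word s => [|g word IHw] s /=; first by move=> _ s110 Us ds; rewrite map_id.
case/andP=> g4 w4 s110 Us ds.
have -> : map (acts (g :: word)) s = map (acts word) (map (act g) s) by rewrite -map_comp.
apply: IHw => //.
- by apply/allP=> _ /mapP[x sx ->]; apply: act_lt => //; apply: (allP s110).
- rewrite map_inj_in_uniq // => x y sx sy; apply: act_inj => //; exact: (allP s110).
exact: dependent_act.
Qed.

End Dependence.

Lemma pairs_checkP q l i j : pairs_check q l -> (i < j)%N -> (j < size l)%N ->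
  allowed_content (content_norm (dot (wedge4 q (nth point0 l i)) (nth point0 l j))).
Proof.
elim: l i j => [|d l IHl] // [|i] [|j] //=; case/andP=> dl ll ij jl.
  exact: (all_nthP point0 dl).
exact: IHl.
Qed.

Lemma orbits_checkP pts p os k : orbits_check pts p os -> (k < size os)%N ->
  exists c o, nth [::] os k = c :: o /\
    pairs_check (wedge3 p (nth point0 pts c)) (map (nth point0 pts) (o ++ flatten (drop k.+1 os))).
Proof.
elim: os k => [|[|c o] os IHos] [|k] //=; case/andP=> check_o check_os; last exact: IHos.
by exists c, o; rewrite drop0.
Qed.

Lemma to_base_lt x : all (fun g => g < 4)%N (to_base x).
Proof.
have home_lt y : (nth 0%N homeward y < 4)%N.
  have /andP[/andP[/(all_nthP 0%N) home4 _] _] := stabilizers_ok.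
  have [/home4 // | large] := ltnP y (size homeward).
  by rewrite nth_default.
rewrite /to_base; move: 6%N => n; elim: n x => //= n IHn x.
by case: eqP => //= _; rewrite home_lt IHn.
Qed.

Lemma rotations_lt s : s \in rotations -> all (fun g => g < 4)%N s.
Proof. by case/allpairsP=> [[i j] [_ _ ->]] /=; rewrite all_cat !all_nseq !orbT. Qed.

Lemma level_words_lt r s : (r < 10)%N -> s \in level_words r -> all (fun g => g < 4)%N s.
Proof.
move=> r10; have /andP[/andP[_ /allP words4] _] := stabilizers_ok.
have /words4/allP : r \in iota 0 10 by rewrite mem_iota.
by apply.
Qed.

Lemma acts_inj word x y : all (fun g => g < 4)%N word -> (x < 110)%N -> (y < 110)%N ->
  acts word x = acts word y -> x = y.
Proof.
elim: word x y => //= g word IHw x y /andP[g4 word4] x110 y110 exy.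
by apply: (act_inj g4 x110 y110); apply: IHw => //; apply: act_lt.
Qed.

Section Independence.
Variables (F : fieldType) (pts : seq (vec5 oK)).
Hypothesis symmetric : symmetries pts.
Hypothesis levels_checked : forall r, (r < 10)%N -> level_check pts r.
Hypothesis nonvanishing : forall (t w : F) x, roots t w ->
  allowed_content (content_norm x) -> phi t w x != 0.

Local Notation pt := (nth point0 pts).

Definition bad (s : seq nat) : Prop :=
  [/\ in_orbit s, uniq s, size s = 5%N & dependent F pts s].

Lemma bad_acts word s : all (fun g => g < 4)%N word -> bad s -> bad (map (acts word) s).
Proof.
move=> word4 [s110 Us sz ds]; rewrite /bad size_map sz.
by have [] := dependent_acts symmetric word4 s110 Us ds.
Qed.

Lemma dependent_det5 s a b c d e : dependent F pts s ->
  a \in s -> b \in s -> c \in s -> d \in s -> e \in s ->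
  exists t w : F, roots t w /\ phi t w (det5 (pt a) (pt b) (pt c) (pt d) (pt e)) = 0.
Proof.
move=> [t [w [tw [h h0 hs]]]] sa sb sc sd se; exists t, w; split=> //.
case: (tw) => t2 w2; rewrite -det_phim //; apply/eqP; apply: contraNT h0 => Mu.
have {}Mu : phim t w (V5 (pt a) (pt b) (pt c) (pt d) (pt e)) \in unitmx.
  by rewrite unitmxE unitfE.
rewrite -(mulKmx Mu h); apply/eqP.
rewrite [X in invmx _ *m X](_ : _ = 0) ?mulmx0 //.
apply/row_matrixP=> i; rewrite row_mul row_phim row0.
by case: i => [] [|[|[|[|[|]]]]] // ? /=; apply: hs.
Qed.

(** The induction hypothesis of the elimination: the levels below r do not occur
    in a dependent five-set. *)
Definition separated (r : nat) : Prop :=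
  forall s x y, bad s -> x \in s -> y \in s -> x != y -> (r <= rank x y)%N.

Definition through_level (r : nat) (s : seq nat) : Prop :=
  [/\ bad s, 0%N \in s & level_point r \in s].

Lemma bad_lt s x : bad s -> x \in s -> (x < 110)%N.
Proof. by case=> /allP s110 _ _ _ /s110. Qed.

Lemma rank_transport s x y : bad s -> x \in s -> y \in s -> x != y ->
  (rank x y < 10)%N /\ exists s', through_level (rank x y) s'.
Proof.
move=> bs sx sy xy; have /andP[/allP base /allP rot] := transport_ok.
have x0 : acts (to_base x) x = 0%N.
  by apply/eqP/base; rewrite mem_iota (bad_lt bs sx).
have bs' := bad_acts (to_base_lt x) bs.
set y' := acts (to_base x) y.
have sy' : y' \in map (acts (to_base x)) s by apply: map_f.
have y'0 : y' != 0%N.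
  rewrite -x0; apply: contra xy => /eqP/acts_inj-> //; first exact: to_base_lt.
    exact: bad_lt sy.
  exact: bad_lt sx.
have /rot : y' \in iota 1 109.
  by rewrite mem_iota lt0n y'0 (bad_lt bs' sy').
case/andP=> r10 /hasP[word rot_w /andP[/eqP w0 /eqP wy]]; split=> //.
exists (map (acts word) (map (acts (to_base x)) s)); split.
- exact: bad_acts (rotations_lt rot_w) bs'.
- by rewrite -w0 map_f // -x0 map_f.
by rewrite /rank -wy map_f.
Qed.

Lemma rank_base z : rank 0 z = nth 0%N rank0 z.
Proof. by []. Qed.

Lemma level_cover r s z : (r < 10)%N -> separated r -> through_level r s ->
  z \in s -> z != 0%N -> z != level_point r -> z \in flatten (level_orbits r).
Proof.
move=> r10 sep [bs s0 sb] sz z0 zb.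
have r_in : r \in iota 0 10 by rewrite mem_iota.
have z_in : z \in iota 1 109 by rewrite mem_iota lt0n z0 (bad_lt bs sz).
have /allP cover := covers_ok; have /allP/(_ z z_in) := cover r r_in.
rewrite (negPf zb) /= -rank_base [(_ < r)%N]ltnNge (sep _ _ _ bs s0 sz) 1?eq_sym //=.
by rewrite ltnNge (sep _ _ _ bs sb sz) // eq_sym.
Qed.

Lemma stabilizer_move r o z : (r < 10)%N -> o \in level_orbits r -> z \in o ->
  exists2 word, word \in level_words r & acts word z = head 0%N o /\
    ((acts word 0 = 0 /\ acts word (level_point r) = level_point r) \/
     (acts word 0 = level_point r /\ acts word (level_point r) = 0))%N.
Proof.
move=> r10 or oz; have /andP[_ /allP stab_ok] := stabilizers_ok.
have r_in : r \in iota 0 10 by rewrite mem_iota.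
have /allP/(_ o or)/allP/(_ z oz)/hasP[] := stab_ok r r_in.
move=> word word_r /andP[/eqP wz stab]; exists word => //; split=> //.
by case/orP: stab => /andP[/eqP w0 /eqP wb]; [left | right].
Qed.

(** A bad set through the pair of level r cannot meet any of the orbits of the
    stabilizer of that pair: move a point of the first orbit that it meets to the
    representative c; the other two points then lie in this or later orbits. *)
Lemma level_orbit_free r k s z : (r < 10)%N -> separated r -> through_level r s ->
  z \in s -> z != 0%N -> z != level_point r ->
  z \notin flatten (take k (level_orbits r)).
Proof.
move=> r10 sep; elim: k s z => [|k IHk] s z thr sz z0 zb; first by rewrite take0.
have [os_k | k_os] := leqP (size (level_orbits r)) k.
  by have := IHk s z thr sz z0 zb; rewrite !take_oversize // (leq_trans os_k).
rewrite (take_nth [::]) // flatten_rcons mem_cat (negPf (IHk s z thr sz z0 zb)) /=.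
apply/negP=> oz; have or := mem_nth [::] k_os.
have [word word_r [wz stab]] := stabilizer_move r10 or oz.
have [bs s0 sb] := thr; have bs' := bad_acts (level_words_lt r10 word_r) bs.
have [c [o [okE pairs]]] := orbits_checkP (levels_checked r10) k_os.
rewrite okE /= in wz.
have word_neq x : x \in s -> x != z -> acts word x != c.
  move=> sx; apply: contra => /eqP; rewrite -wz => /acts_inj->//.
  - exact: level_words_lt word_r.
  - exact: bad_lt sx.
  exact: bad_lt sz.
have [s'0 s'b c0 cb] : [/\ 0%N \in map (acts word) s, level_point r \in map (acts word) s,
    c != 0%N & c != level_point r].
  have w0 := word_neq _ s0; have wb := word_neq _ sb; rewrite eq_sym in z0; rewrite eq_sym in zb.
  case: stab => [] [w0E wbE]; rewrite w0E wbE in w0 wb; split; rewrite 1?eq_sym ?w0 ?wb //.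
  - by rewrite -w0E map_f.
  - by rewrite -{1}wbE map_f.
  - by rewrite -{1}wbE map_f.
  by rewrite -w0E map_f.
have s'c : c \in map (acts word) s by rewrite -wz map_f.
move: (map (acts word) s) bs' s'0 s'b s'c => s' bs' s'0 s'b s'c.
have [_ Us' sz' ds'] := bs'.
pose u := [seq x <- s' | x \notin [:: 0%N; level_point r; c]].
have u2 : (2 <= size u)%N.
  rewrite size_filter -(leq_add2l 3) -[(3 + 2)%N]/5%N -{1}sz'.
  rewrite -(count_predC (mem [:: 0%N; level_point r; c]) s').
  rewrite leq_add2r -size_filter.
  apply: (@uniq_leq_size _ _ [:: 0%N; level_point r; c]); first exact: filter_uniq.
  by move=> x; rewrite mem_filter => /andP[].
have u_in x : x \in u -> x \in s' /\ x \in o ++ flatten (drop k.+1 (level_orbits r)).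
  rewrite mem_filter !inE !negb_or => /andP[/and3P[x0 xb xc] s'x]; split=> //.
  have thr' : through_level r s' by [].
  have := level_cover r10 sep thr' s'x x0 xb.
  rewrite -{1}(cat_take_drop k (level_orbits r)) flatten_cat mem_cat.
  rewrite (negPf (IHk _ _ thr' s'x x0 xb)) /= (drop_nth [::] k_os) okE /=.
  by rewrite inE (negPf xc).
have Uu : uniq u by apply: filter_uniq.
case: u u2 u_in Uu => [|d [|e u]] //= _ u_in /andP[de _].
have [s'd ld] : d \in s' /\ d \in o ++ flatten (drop k.+1 (level_orbits r)).
  by apply: u_in; rewrite mem_head.
have [s'e le] : e \in s' /\ e \in o ++ flatten (drop k.+1 (level_orbits r)).
  by apply: u_in; rewrite !inE eqxx orbT.
have {de} de : d != e by move: de; rewrite inE negb_or => /andP[].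
move: (o ++ _) pairs ld le => l pairs ld le {u_in}.
(* The determinant was computed with d and e in their order of appearance. *)
wlog lt_de : d e s'd s'e ld le de / (index d l < index e l)%N.
  move=> wl; have [lt_de | lt_ed | eq_de] := ltngtP (index d l) (index e l).
  - exact: (wl d e).
  - by apply: (wl e d); rewrite // eq_sym.
  by move/eqP: de; apply; rewrite -(nth_index 0%N ld) eq_de nth_index.
have := pairs_checkP pairs lt_de; rewrite size_map index_mem => /(_ le).
rewrite !(nth_map 0%N) ?index_mem // !nth_index // => allowed.
have [t [w [tw]]] := dependent_det5 ds' s'0 s'b s'c s'd s'e.
by move/eqP; apply/negP; apply: nonvanishing tw allowed.
Qed.

Lemma all_separated r : (r <= 10)%N -> separated r.
Proof.
elim: r => [|r IHr] r10 s x y bs sx sy xy //.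
have sep := IHr (ltnW r10); rewrite ltn_neqAle (sep s) // andbT.
apply/negP=> /eqP rE; have [_ [s' thr]] := rank_transport bs sx sy xy.
rewrite -rE in thr; have [bs' s'0 s'b] := thr; have [_ Us' sz' _] := bs'.
have /hasP[z s'z] : has (predC (mem [:: 0%N; level_point r])) s'.
  rewrite -[has _ _]negbK; apply/negP=> /hasPn none.
  have : (size s' <= 2)%N; last by rewrite sz'.
  by apply: (@uniq_leq_size _ _ [:: 0%N; level_point r]) => // z /none; rewrite negbK.
rewrite /= !inE negb_or => /andP[z0 zb].
have := level_orbit_free (size (level_orbits r)) r10 sep thr s'z z0 zb.
by rewrite take_size (level_cover r10 sep thr).
Qed.

(** A dependent five-set contains a pair, whose level is below 10, whereas every
    level has been excluded by [level_orbit_free]. *)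
Theorem independent_points s : in_orbit s -> uniq s -> size s = 5%N -> ~ dependent F pts s.
Proof.
move=> s110 Us sz ds; have bs : bad s by [].
case: s => [|x [|y s]] // in s110 Us sz ds bs *.
have [sx sy] : x \in [:: x, y & s] /\ y \in [:: x, y & s].
  by rewrite !inE !eqxx orbT.
have xy : x != y by case/andP: Us; rewrite inE negb_or => /andP[].
have [r10 _] := rank_transport bs sx sy xy.
by have := all_separated (leqnn 10) bs sx sy xy; rewrite leqNgt r10.
Qed.

End Independence.

(** * Lines, hyperplanes and the projective action *)

Section ProjectiveGeometry.
Variable F : finFieldType.
Local Notation V := 'rV[F]_5.

(** A central element commutes with the elementary matrices. *)
Lemma center_GL_scalar (z : {'GL_5[F]}) :
  z \in 'Z('GL_5[F])%g -> exists2 a, a != 0 & GLval z = a%:M.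
Proof.
case/centerP=> _ cz; set M := GLval z.
have cM (i j : 'I_5) : i != j -> M *m delta_mx i j = delta_mx i j *m M.
  move=> ij; have ji : (j == i) = false by rewrite eq_sym (negPf ij).
  have Uij : (1%:M + delta_mx i j : 'M[F]_5) \in unitmx.
    suff: (1%:M + delta_mx i j) *m (1%:M - delta_mx i j) = 1%:M :> 'M[F]_5.
      by move/mulmx1_unit=> [].
    rewrite mulmxDl !mulmxBr !mul1mx !mulmx1 mul_delta_mx_0 ?(negPf ij) ?ji //.
    by rewrite subr0 subrK.
  pose g : {'GL_5[F]} := FinRing.unit _ Uij.
  have : M *m GLval g = GLval g *m M by rewrite -[LHS]GL_ME cz ?inE.
  have -> : GLval g = 1%:M + delta_mx i j by [].
  by rewrite mulmxDl mulmxDr mulmx1 mul1mx => /addrI.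
have entry (i j k : 'I_5) : i != j -> M j k = if k == j then M i i else 0.
  move=> ij; have /matrixP/(_ i k) := cM i j ij.
  rewrite !mxE (bigD1 i) //= big1 => [|l li]; last by rewrite mxE (negPf li) mulr0.
  rewrite (bigD1 j) //= big1 => [|l lj]; last by rewrite mxE (negPf lj) andbF mul0r.
  by rewrite !addr0 !mxE !eqxx /= mul1r => <-; case: (k == j); rewrite ?mulr1 ?mulr0.
have ME : M = (M ord0 ord0)%:M.
  apply/matrixP=> i j; rewrite !mxE.
  have [-> | i0] := eqVneq i ord0; last by rewrite (entry ord0) 1?eq_sym // eq_sym; case: eqP.
  have [<- | j0] := eqVneq ord0 j; first by rewrite mulr1n.
  by rewrite (entry ord_max) // eq_sym (negPf j0).
exists (M ord0 ord0) => //; apply/eqP=> M0; have : M \in unitmx := GL_unitmx z.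
by rewrite ME M0 raddf0 unitmxE det0 unitr0.
Qed.

Lemma PGL_act_line (v : V) (g : {'GL_5[F]}) :
  PGL_vspace_action F <[v]>%VS (coset 'Z('GL_5[F])%g g) = <[v *m GLval g]>%VS.
Proof.
rewrite [LHS]modactE ?in_setT //.
- by rewrite /= /GL_vspace limg_line lfunE.
- have /normal_norm/subsetP := center_normal [group of 'GL_5[F]%g]; apply.
  by rewrite inE.
apply/afixP=> z /setIP[_ /center_GL_scalar[a a0 zE]].
rewrite /= /GL_vspace limg_line lfunE /= zE mul_mx_scalar.
apply/eqP; rewrite eqEsubv -!memvE memvZ ?memv_line //=.
by rewrite -{1}[v](scalerK a0) memvZ // memv_line.
Qed.

Lemma not_arc k (A : {set {vspace V}}) (v : 'I_5 -> V) :
  injective (fun i => <[v i]>%VS) -> (forall i, <[v i]>%VS \in A) ->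
  \det (\matrix_i v i) = 0 -> ~ is_arc k A.
Proof.
move=> v_inj vA /eqP; rewrite -det_tr => /det0P[h h0 hM] [_ _ arcA].
pose f : 'Hom(V, 'rV[F]_1) := linfun (mulmxr h^T).
have fE u : f u = u *m h^T by rewrite lfunE.
apply: (arcA [set <[v i]>%VS | i : 'I_5]).
- by apply/subsetP=> _ /imsetP[i _ ->].
- by rewrite card_imset // card_ord.
exists (lker f); last first.
  move=> _ /imsetP[i _ ->]; rewrite -memvE memv_ker fE.
  have /rowP/(_ i) := hM; rewrite !mxE => hi; apply/eqP/rowP=> j.
  rewrite ord1 !mxE -[RHS]hi; apply: eq_bigr => l _; rewrite !mxE mulrC.
  by [].
rewrite inE; have := limg_ker_dim f fullv; rewrite capfv dimvf.
have -> : \dim (f @: fullv) = 1%N.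
  apply/eqP; rewrite eqn_leq; apply/andP; split.
    by have := dimvS (subvf (f @: fullv)%VS); rewrite dimvf /dim /= muln1.
  rewrite lt0n dimv_eq0; apply: contra h0 => /eqP f0.
  apply/eqP/rowP=> j; have : f (delta_mx 0 j) \in (f @: fullv)%VS by rewrite memv_img ?memvf.
  rewrite f0 memv0 fE -rowE => /eqP/rowP/(_ 0); rewrite !mxE.
  by [].
by rewrite addn1 => -[->].
Qed.

Lemma unitmx_row_neq0 n (M : 'M[F]_n) i : M \in unitmx -> row i M != 0.
Proof.
move=> Mu; rewrite rowE; apply/eqP=> /(congr1 (mulmx^~ (invmx M))).
rewrite mulmxK // mul0mx => /rowP/(_ i); rewrite !mxE !eqxx => /eqP.
by rewrite oner_eq0.
Qed.

Lemma unitmx_line_inj (M : 'M[F]_5) i j : M \in unitmx ->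
  <[row i M]>%VS = <[row j M]>%VS -> i = j.
Proof.
move=> Mu ijE; have : row i M \in <[row j M]>%VS by rewrite -ijE memv_line.
case/vlineP=> a; rewrite !rowE scalemxAl => /(can_inj (mulmxK Mu))/rowP/(_ i).
rewrite !mxE !eqxx /=; case: (i =P j) => // _ /eqP.
by rewrite mulr0 oner_eq0.
Qed.

Lemma arc_of_independent n (v : 'I_n -> V) : (5 <= n)%N ->
  (forall t : 5.-tuple 'I_n, uniq t -> \matrix_i v (tnth t i) \in unitmx) ->
  is_arc n [set <[v i]>%VS | i : 'I_n] /\ injective (fun i => <[v i]>%VS).
Proof.
move=> n5 indep.
have extend (r : seq 'I_n) : uniq r -> (size r <= 5)%N ->
    exists2 t : 5.-tuple 'I_n, uniq t & {subset r <= t}.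
  move=> Ur r5; pose q := r ++ [seq i <- enum 'I_n | i \notin r].
  have Uq : uniq q.
    rewrite cat_uniq Ur filter_uniq ?enum_uniq // andbT.
    by apply/hasPn=> i; rewrite mem_filter => /andP[].
  have q5 : (5 <= size q)%N.
    have /(uniq_leq_size (enum_uniq 'I_n)) : {subset enum 'I_n <= q}.
      by move=> i _; rewrite mem_cat mem_filter mem_enum andbT orbN.
    by rewrite size_enum_ord; apply: leq_trans.
  have sz : size (take 5 q) == 5%N by rewrite size_takel.
  exists (Tuple sz); first exact: take_uniq.
  move=> i ri; have: i \in take 5 q; last by [].
  by rewrite take_cat ltnNge r5 mem_cat ri.
have v_neq0 i : v i != 0.
  have [t Ut /(_ i)] := extend [:: i] isT isT.
  rewrite mem_head => /(_ isT)/tnthP[j ->].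
  by rewrite -[v _](rowK (fun l => v (tnth t l))) unitmx_row_neq0 ?indep.
have v_inj : injective (fun i => <[v i]>%VS).
  move=> i j ijE; apply/eqP; apply: contraT => ij.
  have [||t Ut tij] := extend [:: i; j]; rewrite //= ?inE ?ij //.
  have /tnthP[k iE] : i \in t by rewrite tij ?mem_head.
  have /tnthP[l jE] : j \in t by rewrite tij // !inE eqxx orbT.
  move: ijE; rewrite iE jE -[v _](rowK (fun l => v (tnth t l))).
  rewrite -[v (tnth t l)](rowK (fun l => v (tnth t l))).
  by move/(unitmx_line_inj (indep t Ut)) => kl; rewrite iE jE kl eqxx in ij.
split=> //; split.
- by apply/subsetP=> _ /imsetP[i _ ->]; rewrite inE dim_vline v_neq0.
- by rewrite card_imset // card_ord.
move=> S sSA S5 [H]; rewrite inE => /eqP dimH SH.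
pose T := [set i | <[v i]>%VS \in S].
have TS : [set <[v i]>%VS | i in T] = S.
  apply/setP=> P; apply/imsetP/idP => [[i] | SP]; first by rewrite inE => Si ->.
  by have /imsetP[i _ PE] := subsetP sSA P SP; exists i; rewrite // inE -PE.
have T5 : size (enum T) == 5%N by rewrite -cardE -(card_imset _ v_inj) TS S5.
pose t : 5.-tuple 'I_n := Tuple T5.
have Mu := indep t (enum_uniq _).
have : (fullv <= H)%VS.
  apply/subvP=> x _; rewrite -(mulmxKV Mu x) mulmx_sum_row; apply: memv_suml => i _.
  rewrite rowK memvZ //; rewrite memvE SH // -TS.
  by apply: (imset_f (fun j => <[v j]>%VS)); rewrite -mem_enum mem_tnth.
by move/dimvS; rewrite dimvf dimH.
Qed.

Section Orbit.
Variable rL : mx_representation F (PSL 2 'F_11) 5.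

Definition rep_SL (g : {'GL_2['F_11]}) : 'M[F]_5 := rL (coset 'Z(SL 2 'F_11)%g g).

Lemma orbit_line v :
  orbit (PGL_vspace_action F) (projective_image rL) <[v]>%VS =
  [set <[v *m rep_SL g]>%VS | g in SL 2 'F_11].
Proof.
have coset_PSL g : g \in SL 2 'F_11 -> coset 'Z(SL 2 'F_11)%g g \in PSL 2 'F_11.
  by move=> Sg; rewrite mem_quotient.
rewrite orbitE; apply/setP=> U; apply/imsetP/imsetP => [[x] | [g Sg ->]].
  case/morphimP=> y Ny /morphimP[z Lz _ ->] -> ->.
  have /morphimP[g Ng Sg zE] := Lz; exists g => //.
  by rewrite PGL_act_line /rep_SL -zE -val_reprGLm.
exists (coset 'Z('GL_5[F])%g (reprGLm rL (coset 'Z(SL 2 'F_11)%g g))).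
  by rewrite mem_quotient // mem_morphim ?coset_PSL.
by rewrite PGL_act_line /rep_SL -val_reprGLm ?coset_PSL.
Qed.

End Orbit.

End ProjectiveGeometry.

(** * The group SL(2, 11) *)

Notation SL11 := (SL 2 'F_11).

Definition mat2 : Type := (nat * nat * (nat * nat))%type.

Definition mul2 (x y : mat2) : mat2 :=
  let: (a, b, (c, d)) := x in let: (a', b', (c', d')) := y in
  ((a * a' + b * c') %% 11, (a * b' + b * d') %% 11,
   ((c * a' + d * c') %% 11, (c * b' + d * d') %% 11))%N.

Definition one2 : mat2 := (1, 0, (0, 1))%N.
Definition u2 : mat2 := (1, 1, (0, 1))%N.
Definition w2 : mat2 := (0, 1, (10, 0))%N.
Definition c2 : mat2 := (0, 1, (10, 5))%N.

Definition pow2 (x : mat2) (k : nat) : mat2 := iter k (mul2 x) one2.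

Definition det2 (x : mat2) : bool :=
  let: (a, b, (c, d)) := x in ((a * d) %% 11 == (b * c + 1) %% 11)%N.

Definition generator2 (s : bool) := if s then w2 else u2.

Definition word2 (s : seq bool) : mat2 := foldl (fun x g => mul2 x (generator2 g)) one2 s.

(** Representatives of the right cosets of the cyclic group generated by c2. *)
Fact transversal_key : unit. Proof. by []. Qed.

Definition transversal2 : seq mat2 :=
  locked_with transversal_key (tree (fun x s => mul2 x (generator2 s)) one2).

Lemma transversal2E : transversal2 = tree (fun x s => mul2 x (generator2 s)) one2.
Proof. exact: locked_withE. Qed.

Definition mx_of_mat2 (x : mat2) : 'M['F_11]_2 :=
  let: (a, b, (c, d)) := x in
  \matrix_(i, j) (nth 0%N (nth [::] [:: [:: a; b]; [:: c; d]] i) j)%:R.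

HB.lock Definition gl (x : mat2) : {'GL_2['F_11]} :=
  insubd (1%g : {'GL_2['F_11]}) (mx_of_mat2 x).
Canonical gl_unlockable := Unlockable gl.unlock.

Lemma nat_F11 m n : (m %% 11 == n %% 11)%N -> m%:R = n%:R :> 'F_11.
Proof.
by move=> /eqP mn; apply/val_inj; rewrite /= !val_Fp_nat.
Qed.

Lemma det_mat2 x : det2 x -> \det (mx_of_mat2 x) = 1.
Proof.
case: x => [[a b] [c d]] /nat_F11 det1.
rewrite (expand_det_row _ ord0) !big_ord_recl big_ord0 /cofactor !det_mx11 !mxE /=.
move: det1; rewrite natrD !natrM => det1; rewrite addr0 expr0 expr1 mul1r det1; ring.
Qed.

Definition unimodular (x : mat2) : Prop := \det (mx_of_mat2 x) = 1.

Lemma val_gl x : unimodular x -> GLval (gl x) = mx_of_mat2 x.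
Proof.
move=> det1; rewrite unlock; apply: insubdK.
by rewrite -topredE /= -[_ \in _]/(_ \in unitmx) unitmxE det1 unitr1.
Qed.

Lemma gl_SL x : unimodular x -> gl x \in SL11.
Proof. by move=> x1; rewrite inE val_gl ?x1. Qed.

Lemma mx_of_mat2M x y : mx_of_mat2 (mul2 x y) = mx_of_mat2 x *m mx_of_mat2 y.
Proof.
have mod11 n : (n %% 11)%:R = n%:R :> 'F_11 by apply: nat_F11; rewrite modn_mod.
case: x y => [[a b] [c d]] [[a' b'] [c' d']]; apply/matrixP=> i j.
rewrite !mxE !big_ord_recl big_ord0 !mxE /=.
by case: i j => [] [|[|]] // ? [] [|[|]] //= ?; rewrite mod11 natrD !natrM addr0.
Qed.

Lemma unimodularM x y : unimodular x -> unimodular y -> unimodular (mul2 x y).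
Proof. by rewrite /unimodular mx_of_mat2M det_mulmx => -> ->; rewrite mulr1. Qed.

Lemma glM x y : unimodular x -> unimodular y -> gl (mul2 x y) = (gl x * gl y)%g.
Proof.
move=> x1 y1; apply/val_inj; rewrite [LHS]val_gl ?mx_of_mat2M; last exact: unimodularM.
by rewrite -(val_gl x1) -(val_gl y1).
Qed.

Lemma unimodular1 : unimodular one2. Proof. exact: det_mat2. Qed.
Lemma unimodular_c : unimodular c2. Proof. exact: det_mat2. Qed.

Lemma gl1 : gl one2 = 1%g.
Proof.
apply/val_inj; rewrite [LHS]val_gl; last exact: unimodular1.
by apply/matrixP=> i j; rewrite !mxE; case: i j => [] [|[|]] // ? [] [|[|]].
Qed.

Lemma unimodular_pow x k : unimodular x -> unimodular (pow2 x k).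
Proof.
by move=> x1; elim: k => [|k IHk] /=; [exact: unimodular1 | exact: unimodularM].
Qed.

Lemma gl_pow x k : unimodular x -> gl (pow2 x k) = (gl x ^+ k)%g.
Proof.
move=> x1; elim: k => [|k IHk]; first by rewrite gl1.
by rewrite /= glM ?IHk ?expgS //; apply: unimodular_pow.
Qed.

Definition reduced (x : mat2) : bool :=
  let: (a, b, (c, d)) := x in [&& a < 11, b < 11, c < 11 & d < 11]%N.

(** Inequalities in SL(2, 11) can thus be tested on reduced matrices. *)
Lemma gl_inj x y : unimodular x -> unimodular y -> reduced x -> reduced y ->
  gl x = gl y -> x = y.
Proof.
move=> x1 y1; have nat_inj m n : (m < 11)%N -> (n < 11)%N -> m%:R = n%:R :> 'F_11 -> m = n.
  by move=> m11 n11 /(congr1 val); rewrite /= !val_Fp_nat //= !modn_small.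
move=> rx ry glxy; have mxE2 : mx_of_mat2 x = mx_of_mat2 y.
  by rewrite -(val_gl x1) -(val_gl y1) glxy.
case: x y rx ry mxE2 {x1 y1 glxy} => [[a b] [c d]] [[a' b'] [c' d']].
case/and4P=> a11 b11 c11 d11 /and4P[a11' b11' c11' d11'] /matrixP xy.
have := xy ord0 ord0; rewrite !mxE /= => /nat_inj->//.
have := xy ord0 ord_max; rewrite !mxE /= => /nat_inj->//.
have := xy ord_max ord0; rewrite !mxE /= => /nat_inj->//.
by have := xy ord_max ord_max; rewrite !mxE /= => /nat_inj->.
Qed.

(** Every element of GL(2, 11) is in a unique way the product of a matrix
    diag(x, 1) and an element of SL(2, 11). *)
Lemma card_SL11 : #|SL11| = 1320%N.
Proof.
have card_unit : #|[set: {unit 'F_11}]| = 10%N by rewrite card_finField_unit card_Fp.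
pose diag (x : {unit 'F_11}) : {'GL_2['F_11]} :=
  insubd (1%g : {'GL_2['F_11]}) (block_mx (val x)%:M 0 0 1%:M : 'M_(1 + 1)).
have det_diag x : \det (GLval (diag x)) = val x.
  have xU : val x \is a GRing.unit by apply: (valP x).
  have detE : \det (block_mx (val x)%:M 0 0 1%:M : 'M_(1 + 1)) = val x.
    by rewrite det_ublock det_scalar1 det1 mulr1.
  rewrite [GLval _]insubdK // -topredE /= -[_ \in _]/(_ \in unitmx).
  by rewrite unitmxE detE.
pose f (xg : {unit 'F_11} * {'GL_2['F_11]}) := (diag xg.1 * xg.2)%g.
have det_f xg : \det (GLval (f xg)) = val xg.1 * \det (GLval xg.2).
  by rewrite /f [GLval _]GL_MxE det_mulmx det_diag.
have imf : [set f xg | xg in setX [set: {unit 'F_11}] SL11] = 'GL_2['F_11]%g.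
  apply/setP=> g; rewrite inE; apply/imsetP.
  have gU : \det (GLval g) \is a GRing.unit by rewrite unitfE GL_det.
  pose x : {unit 'F_11} := FinRing.unit _ gU.
  exists (x, ((diag x)^-1 * g)%g); last by rewrite /f mulKVg.
  rewrite !inE GL_ME det_mulmx GL_VxE det_inv det_diag /=.
  by rewrite mulVf // -unitfE.
have injf : {in setX [set: {unit 'F_11}] SL11 &, injective f}.
  move=> [x g] [y h]; rewrite !inE /= => /eqP g1 /eqP h1 fE.
  have : val x * \det (GLval g) = val y * \det (GLval h).
    by rewrite -(det_f (x, g)) -(det_f (y, h)) fE.
  rewrite g1 h1 !mulr1 => /val_inj xy; move: fE; rewrite /f xy /=.
  by move/mulgI->.
have := card_in_imset injf; rewrite imf cardsX card_unit card_GL_2 card_Fp //.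
by move/esym/eqP; rewrite (_ : (11 * 11.-1 ^ 2 * 11.+1 = 10 * 1320)%N) // eqn_pmul2l // => /eqP.
Qed.

Section CyclicTransversal.
Variables (gT : finGroupType) (G : {group gT}) (c : gT) (T : nat -> gT) (m n : nat).
Hypotheses (Gc : c \in G) (GT : forall i, T i \in G).
Hypothesis T_inj : forall i j, (i < n)%N -> (j < n)%N -> (c ^ T i = c ^ T j)%g -> i = j.
Hypothesis c_inj : forall k l, (k < m)%N -> (l < m)%N -> (c ^+ k = c ^+ l)%g -> k = l.

Lemma order_of_powers : (0 < m)%N -> (c ^+ m = 1)%g -> #[c]%g = m.
Proof.
move=> m0 cm; have le_m : (#[c]%g <= m)%N by apply: dvdn_leq; rewrite // order_dvdn cm.
move: le_m; rewrite leq_eqVlt => /orP[/eqP // | lt_m].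
have c0 : (c ^+ #[c] = c ^+ 0)%g by rewrite expg_order.
by have := order_gt0 c; rewrite (c_inj lt_m m0 c0).
Qed.

(** The products of the m powers of c and the n representatives are distinct;
    when there are as many of them as elements of G, they exhaust G. *)
Lemma cyclic_decomposition g : #|G| = (m * n)%N -> g \in G ->
  exists2 k, (k < m)%N & exists2 i, (i < n)%N & g = (c ^+ k * T i)%g.
Proof.
move=> oG Gg; pose f (ki : 'I_m * 'I_n) := (c ^+ ki.1 * T ki.2)%g.
have finj : injective f.
  move=> [k i] [l j]; rewrite /f /= => fE.
  have ij : i = j.
    apply/val_inj/T_inj; rewrite ?ltn_ord //=.
    have conjE (k' : nat) x : (c ^ (c ^+ k' * x) = c ^ x)%g.
      by rewrite conjgM; congr (_ ^ x)%g; apply/conjg_fixP/commgP/commuteX.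
    by rewrite -(conjE k) fE conjE.
  by move: fE; rewrite ij => /mulIg/c_inj-/(_ (ltn_ord k) (ltn_ord l))/val_inj->.
have : g \in [set f ki | ki in [set: 'I_m * 'I_n]].
  rewrite (_ : [set _ | _ in _] = G) //; apply/eqP.
  rewrite eqEcard card_imset // cardsT card_prod !card_ord oG leqnn andbT.
  by apply/subsetP=> _ /imsetP[ki _ ->]; rewrite groupM ?groupX.
by case/imsetP=> [[k i] _ ->]; exists k => //; exists i.
Qed.

Lemma commute_representative k x y : commute (c ^+ k * x)%g (c ^+ y)%g -> commute x (c ^+ y)%g.
Proof.
rewrite /commute -mulgA => com; apply: (mulgI (c ^+ k)%g).
by rewrite com !mulgA -!expgD addnC.
Qed.

End CyclicTransversal.

Definition inv2 (x : mat2) : mat2 :=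
  let: (a, b, (c, d)) := x in (d, (11 - b) %% 11, ((11 - c) %% 11, a))%N.

Definition conjugate2 (i : nat) : mat2 :=
  let x := nth one2 transversal2 i in mul2 (inv2 x) (mul2 c2 x).

Lemma conjugate2_inj : {in gtn 110 &, injective conjugate2}.
Proof. by apply/mkseq_uniqP; rewrite /conjugate2 transversal2E; vm_compute. Qed.

Lemma conjugate2_reduced i : (i < 110)%N -> reduced (conjugate2 i).
Proof.
move=> i110; apply: (allP (_ : all (fun i => reduced (conjugate2 i)) (iota 0 110))).
  by rewrite /conjugate2 transversal2E; vm_compute.
by rewrite mem_iota.
Qed.

Lemma mul2_inv2_transversal i : (i < 110)%N ->
  let x := nth one2 transversal2 i in mul2 x (inv2 x) = one2.
Proof.
move=> i110; apply/eqP; pose P i := let x := nth one2 transversal2 i in mul2 x (inv2 x) == one2.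
apply: (allP (_ : all P (iota 0 110)) i); first by rewrite /P transversal2E; vm_compute.
by rewrite mem_iota.
Qed.

Lemma transversal_noncentralizing i : (i < 110)%N -> i != 0%N ->
  let x := nth one2 transversal2 i in
  [/\ reduced (mul2 x (pow2 c2 4)), reduced (mul2 (pow2 c2 4) x) &
      mul2 x (pow2 c2 4) <> mul2 (pow2 c2 4) x].
Proof.
move=> i110 i0; pose P i := let x := nth one2 transversal2 i in
  [&& reduced (mul2 x (pow2 c2 4)), reduced (mul2 (pow2 c2 4) x) &
      mul2 x (pow2 c2 4) != mul2 (pow2 c2 4) x].
suff /and3P[xr rx /eqP neq] : P i by [].
apply: (allP (_ : all P (iota 1 109)) i); first by rewrite /P transversal2E; vm_compute.
by rewrite mem_iota lt0n i0.
Qed.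

Lemma pow_c2_inj : {in gtn 12 &, injective (pow2 c2)}.
Proof. by apply/mkseq_uniqP; vm_compute. Qed.

Lemma pow_c2_reduced k : (k < 12)%N -> reduced (pow2 c2 k).
Proof.
move=> k12; apply: (allP (_ : all (fun k => reduced (pow2 c2 k)) (iota 0 12))).
  by vm_compute.
by rewrite mem_iota.
Qed.

Section Words.
Variables (gT : finGroupType) (u w : gT).

Definition gen (s : bool) : gT := if s then w else u.
Definition word (s : seq bool) : gT := foldl (fun x b => x * gen b)%g 1%g s.
Definition rep (i : nat) : gT := nth 1%g (tree (fun x b => x * gen b)%g 1%g) i.

Lemma word_cat s1 s2 : word (s1 ++ s2) = (word s1 * word s2)%g.
Proof.
rewrite /word foldl_cat; elim/last_ind: s2 => [|s2 b IHs]; first by rewrite mulg1.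
by rewrite !foldl_rcons IHs mulgA.
Qed.

End Words.

Definition u_word (k : nat) : seq bool := nseq k false.
Definition ww : seq bool := [:: true; true].

(** A diagonal element of order 5 modulo the centre. *)
Definition h_word : seq bool := true :: u_word 2 ++ true :: u_word 6 ++ true :: u_word 2.

(** The element of order 12 whose eigenvectors give the orbits of length 110. *)
Definition c_word : seq bool := true :: u_word 6.

(** An element that conjugates the previous one to its inverse; it separates the
    eigenvalue 1 of c from the others. *)
Definition s_word : seq bool :=
  true :: u_word 2 ++ true :: u_word 3 ++ true :: u_word 1.

(** For a = 1, 3, 4, 5, an element that conjugates u^a w to - u^-a w. *)
Definition reversing_words : seq (nat * seq bool) :=
  [:: (1, u_word 6 ++ true :: u_word 4);
      (3, true :: u_word 2 ++ [:: true; false; true]);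
      (4, u_word 4 ++ true :: u_word 2 ++ true :: u_word 4);
      (5, u_word 2 ++ true :: u_word 3 ++ true :: u_word 1)]%N.

(** The relations used below: to find the eigenvectors of u and the matrix of w,
    to locate c^6 and w^2 in the centre, and to see that c is conjugate to its
    inverse. *)
Definition relations : seq (seq bool * seq bool) :=
  [:: (u_word 11, [::]);
      (ww ++ ww, [::]);
      (ww ++ u_word 1, u_word 1 ++ ww);
      (flatten (nseq 3 [:: true; false]), [::]);
      (h_word ++ u_word 1, u_word 3 ++ h_word);
      (flatten (nseq 5 h_word), ww);
      (flatten (nseq 6 c_word), ww);
      (h_word ++ true :: h_word, [:: true]);
      (c_word ++ s_word ++ c_word, s_word);
      ([:: true; false] ++ u_word 9 ++ [:: true], u_word 1 ++ [:: true; false]);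
      ([:: true; false; true] ++ u_word 2 ++ [:: true], ww ++ u_word 10 ++ [:: true; false; true])]
  ++ [seq (q.2 ++ u_word q.1 ++ [:: true], ww ++ u_word (11 - q.1) ++ true :: q.2)
     | q <- reversing_words].

Definition generator_perm (s : bool) : seq nat := if s then perm_w else perm_u.

(** In the action on the right cosets of <[c]>, the product of the representative
    i and a generator is a power of c times another representative. *)
Definition coset_exponent (s : bool) (i : nat) : nat :=
  find (fun k => mul2 (nth one2 transversal2 i) (generator2 s) ==
                 mul2 (pow2 c2 k) (nth one2 transversal2 (nth 0%N (generator_perm s) i)))
       (iota 0 12).

(** The properties of SL(2, 11) on which the remaining arguments rest. They are
    established once, by calculations with matrices modulo 11, and then used in
    an abstract group. *)
Record presented (gT : finGroupType) (S : {group gT}) (u w : gT) : Prop := Presented {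
  pres_mem : forall s, gen u w s \in S;
  pres_card : #|S| = 1320%N;
  pres_rel : forall x y, (x, y) \in relations -> word u w x = word u w y;
  pres_power : forall k l, (k < 12)%N -> (l < 12)%N ->
    (word u w c_word ^+ k = word u w c_word ^+ l)%g -> k = l;
  pres_power12 : (word u w c_word ^+ 12 = 1)%g;
  pres_conj : forall i j, (i < 110)%N -> (j < 110)%N ->
    (word u w c_word ^ rep u w i = word u w c_word ^ rep u w j)%g -> i = j;
  pres_cent : forall i, (i < 110)%N -> i != 0%N ->
    (rep u w i * word u w c_word ^+ 4 <> word u w c_word ^+ 4 * rep u w i)%g;
  pres_step : forall s i, (i < 110)%N ->
    (rep u w i * gen u w s =
     word u w c_word ^+ coset_exponent s i * rep u w (nth 0%N (generator_perm s) i))%g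
}.

Lemma relations_ok : all (fun r => word2 r.1 == word2 r.2) relations.
Proof. by vm_compute. Qed.

Lemma c_word_ok : word2 c_word = c2 /\ pow2 c2 12 = one2.
Proof. by split; apply/eqP; vm_compute. Qed.

Lemma coset_step s i : (i < 110)%N ->
  mul2 (nth one2 transversal2 i) (generator2 s) =
  mul2 (pow2 c2 (coset_exponent s i)) (nth one2 transversal2 (nth 0%N (generator_perm s) i)).
Proof.
move=> i110; apply/eqP; pose P s i :=
  mul2 (nth one2 transversal2 i) (generator2 s) ==
  mul2 (pow2 c2 (coset_exponent s i)) (nth one2 transversal2 (nth 0%N (generator_perm s) i)).
suff all_ok : all (P s) (iota 0 110) by apply: (allP all_ok); rewrite mem_iota.
by case: s; rewrite /P /coset_exponent transversal2E; vm_compute.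
Qed.

Lemma unimodular_generator s : unimodular (generator2 s).
Proof. by case: s; apply: det_mat2. Qed.

Lemma unimodular_rep i : unimodular (nth one2 transversal2 i).
Proof.
pose R x (_ : unit) := unimodular x.
rewrite transversal2E; apply: (@tree_rel _ _ R _ (fun _ _ => tt) one2 tt) => [|x y s x1].
  exact: unimodular1.
exact: unimodularM x1 (unimodular_generator s).
Qed.

Lemma gl_gen s : gl (generator2 s) = gen (gl u2) (gl w2) s.
Proof. by case: s. Qed.

Lemma gl_rep i : gl (nth one2 transversal2 i) = rep (gl u2) (gl w2) i.
Proof.
pose R x g := unimodular x /\ gl x = g.
have [] // : R (nth one2 transversal2 i) (rep (gl u2) (gl w2) i).
rewrite transversal2E; apply: tree_rel => [|x g s [x1 xg]].
  by split; [exact: unimodular1 | exact: gl1].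
have s1 := unimodular_generator s; split; first exact: unimodularM.
by rewrite (glM x1 s1) xg gl_gen.
Qed.

Lemma gl_word x : unimodular (word2 x) /\ gl (word2 x) = word (gl u2) (gl w2) x.
Proof.
elim/last_ind: x => [|x s [x1 xE]]; first by split; [exact: unimodular1 | exact: gl1].
have s1 := unimodular_generator s.
rewrite /word2 /word !foldl_rcons; split; first exact: unimodularM.
by rewrite (glM x1 s1) -/(word _ _ _) -xE gl_gen.
Qed.

Lemma gl_inv x y : unimodular x -> mul2 x y = one2 -> unimodular y /\ gl y = (gl x)^-1%g.
Proof.
move=> x1 xy; have y1 : unimodular y.
  have := unimodular1; rewrite -xy /unimodular mx_of_mat2M det_mulmx.
  by rewrite [\det (mx_of_mat2 x)]x1 mul1r.
split; first exact: y1.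
apply: (mulgI (gl x)); rewrite mulgV -(glM x1 y1) xy; exact: gl1.
Qed.

Lemma gl_conjugate i : (i < 110)%N ->
  unimodular (conjugate2 i) /\ gl (conjugate2 i) = (gl c2 ^ gl (nth one2 transversal2 i))%g.
Proof.
move=> i110; have x1 := unimodular_rep i.
have [y1 yE] := gl_inv x1 (mul2_inv2_transversal i110).
have cx1 := unimodularM unimodular_c x1.
split; first exact: unimodularM.
by rewrite /conjugate2 (glM y1 cx1) (glM unimodular_c x1) yE.
Qed.

Theorem SL11_presented : presented (SL_group 2 'F_11) (gl u2) (gl w2).
Proof.
have [c1 c12] := c_word_ok.
have [_] := gl_word c_word; rewrite c1 => cE.
split.
- by move=> s; rewrite -gl_gen; apply: gl_SL; apply: unimodular_generator.
- exact: card_SL11.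
- move=> x y xy; have [_ <-] := gl_word x; have [_ <-] := gl_word y.
  by congr gl; apply/eqP; apply: (allP relations_ok (x, y)).
- move=> k l k12 l12; rewrite -cE -!(gl_pow _ unimodular_c).
  move/(gl_inj (unimodular_pow k unimodular_c) (unimodular_pow l unimodular_c)).
  move/(_ (pow_c2_reduced k12) (pow_c2_reduced l12)); exact: pow_c2_inj.
- by rewrite -cE -(gl_pow _ unimodular_c) c12; apply: gl1.
- move=> i j i110 j110; rewrite -cE -!gl_rep.
  have [xi <-] := gl_conjugate i110; have [xj <-] := gl_conjugate j110.
  move/(gl_inj xi xj (conjugate2_reduced i110) (conjugate2_reduced j110)).
  exact: conjugate2_inj.
- move=> i i110 i0; rewrite -cE -gl_rep -(gl_pow _ unimodular_c).
  have x1 := unimodular_rep i; have y1 := unimodular_pow 4 unimodular_c.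
  rewrite -(glM x1 y1) -(glM y1 x1).
  have [redl redr neq] := transversal_noncentralizing i110 i0; move=> E; apply: neq.
  exact: gl_inj (unimodularM x1 y1) (unimodularM y1 x1) redl redr E.
move=> s i i110; rewrite -cE -!gl_rep -gl_gen -(gl_pow _ unimodular_c).
have x1 := unimodular_rep; have s1 := unimodular_generator s.
have y1 := unimodular_pow (coset_exponent s i) unimodular_c.
by rewrite -(glM (x1 _) s1) -(glM y1 (x1 _)) coset_step.
Qed.

Section PresentedGroup.
Variables (gT : finGroupType) (S : {group gT}) (u w : gT).
Hypothesis presS : presented S u w.

Local Notation c := (word u w c_word).
Local Notation T := (rep u w).

Lemma word_mem x : word u w x \in S.
Proof.
rewrite /word; elim/last_ind: x => [|x b IHx]; first exact: group1.
by rewrite foldl_rcons groupM // (pres_mem presS).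
Qed.

Lemma rep_mem i : T i \in S.
Proof.
pose R x (_ : unit) := x \in S.
apply: (@tree_rel _ _ R _ (fun _ _ => tt) 1%g tt) => [|x y b Sx]; first exact: group1.
by rewrite /R groupM // (pres_mem presS).
Qed.

Lemma word_rel x y : (x, y) \in relations -> word u w x = word u w y.
Proof. exact: (pres_rel presS). Qed.

Lemma order_c : #[c]%g = 12%N.
Proof. exact: order_of_powers (pres_power presS) isT (pres_power12 presS). Qed.

Lemma decomposition g : g \in S ->
  exists2 k, (k < 12)%N & exists2 i, (i < 110)%N & g = (c ^+ k * T i)%g.
Proof.
move=> Sg; have S1320 : #|S| = (12 * 110)%N by rewrite (pres_card presS).
exact: (cyclic_decomposition (word_mem _) rep_mem (pres_conj presS) (pres_power presS) S1320 Sg).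
Qed.

Lemma generated_ind (P : gT -> Prop) : P 1%g ->
  (forall x s, x \in S -> P x -> P (x * gen u w s)%g) -> 
  (forall x y, x \in S -> y \in S -> P x -> P y -> P (x * y)%g) ->
  forall g, g \in S -> P g.
Proof.
move=> P1 Pgen PM g /decomposition[k _ [i _ ->]].
have Pc : P c.
  suff [] : word u w c_word \in S /\ P (word u w c_word) by [].
  rewrite /word; elim/last_ind: c_word => [|x b [Sx Px]]; first by rewrite group1.
  by rewrite foldl_rcons groupM ?(pres_mem presS) //; split=> //; apply: Pgen.
apply: (PM); rewrite ?groupX ?word_mem ?rep_mem //.
  elim: k => [|k IHk]; rewrite ?expg0 // expgS.
  by apply: (PM); rewrite ?groupX ?word_mem.
pose Q x (_ : unit) := x \in S /\ P x.
have [] // : Q (T i) (nth tt (tree (fun _ _ => tt) tt) i).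
apply: tree_rel => [|x y b [Sx Px]]; first by split; rewrite ?group1.
by split; [rewrite groupM ?(pres_mem presS) | apply: Pgen].
Qed.

Lemma rep0 : T 0 = 1%g. Proof. by []. Qed.

(** Among the coset representatives only the trivial one commutes with c^4. *)
Lemma centralizer_c4 g : g \in S -> commute g (c ^+ 4)%g -> g \in <[c]>%g.
Proof.
move=> /decomposition[k k12 [i i110 ->]] /commute_representative com.
have [i0 | i0] := eqVneq i 0%N; first by rewrite i0 rep0 mulg1 mem_cycle.
by case: (pres_cent presS i110 i0).
Qed.

Lemma word_nseq k b : word u w (nseq k b) = (gen u w b ^+ k)%g.
Proof.
elim: k => [|k IHk]; first by [].
by rewrite -addn1 nseqD word_cat IHk expgD /word /= mul1g expg1.
Qed.

(** An element of <[c]> that inverts c would give c^2 = 1. *)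
Lemma s_not_in_c : word u w s_word \notin <[c]>%g.
Proof.
apply/negP=> /cycleP[k sE].
have : word u w (c_word ++ s_word ++ c_word) = word u w s_word by apply: word_rel.
rewrite !word_cat sE -expgSr -expgS => kE.
have : (c ^+ 2 = c ^+ 0)%g.
  by apply: (mulgI (c ^+ k)%g); rewrite -expgD addn2 kE expg0 mulg1.
by move/(pres_power presS (isT : (2 < 12)%N) (isT : (0 < 12)%N)).
Qed.

End PresentedGroup.

(** * The eleventh roots of unity *)

Section PolynomialLists.
Local Open Scope Z_scope.

Fixpoint padd (l m : seq Z) : seq Z :=
  match l, m with
  | [::], _ => m
  | _, [::] => l
  | a :: l', b :: m' => (a + b) :: padd l' m'
  end.

Definition pscale (a : Z) : seq Z -> seq Z := map (Z.mul a).

Fixpoint pmul (l m : seq Z) : seq Z :=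
  if l is a :: l' then padd (pscale a m) (0 :: pmul l' m) else [::].

Definition psum (s : seq (seq Z)) : seq Z := foldr padd [::] s.

Definition monom (n : nat) : seq Z := rcons (nseq n 0) 1.

(** The substitution of x^a for x, modulo x^11 - 1. *)
Definition psubst (a : nat) (l : seq Z) : seq Z :=
  psum [seq pscale (nth 0 l i) (monom ((i * a) %% 11)%N) | i <- iota 0 (size l)].

Fixpoint fold11 (n : nat) (l : seq Z) : seq Z :=
  if n is n'.+1 then
    if (size l <= 11)%N then l else fold11 n' (padd (take 11 l) (drop 11 l))
  else l.

Definition cyclotomic_zero (l : seq Z) : bool :=
  let r := fold11 10 l in
  (size r <= 11)%N && all (fun i => Z.eqb (nth 0 r i) (nth 0 r 0)) (iota 0 11).

End PolynomialLists.

Section CyclotomicEvaluation.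
Variables (K : fieldType) (z : K).

Definition zev (l : seq Z) : K := foldr (fun a x => zr K a + z * x) 0 l.

Lemma zev_padd l m : zev (padd l m) = zev l + zev m.
Proof.
elim: l m => [|a l IHl] [|b m] //=; rewrite ?add0r ?addr0 // zrD IHl; ring.
Qed.

Lemma zev_pscale a l : zev (pscale a l) = zr K a * zev l.
Proof. by elim: l => [|b l IHl] /=; rewrite ?mulr0 // zrM IHl; ring. Qed.

Lemma zev_pmul l m : zev (pmul l m) = zev l * zev m.
Proof.
elim: l => [|a l IHl] /=; first by rewrite mul0r.
by rewrite zev_padd zev_pscale /= zr0 IHl; ring.
Qed.

Lemma zev_psum s : zev (psum s) = \sum_(l <- s) zev l.
Proof. by elim: s => [|l s IHs]; rewrite ?big_nil ?big_cons //= zev_padd IHs. Qed.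

Lemma zev_monom n : zev (monom n) = z ^+ n.
Proof.
elim: n => [|n IHn] /=; first by rewrite zr1 mulr0 addr0.
by rewrite zr0 add0r exprS -IHn.
Qed.

Lemma zev_sum l : zev l = \sum_(0 <= i < size l) zr K (nth Z0 l i) * z ^+ i.
Proof.
elim: l => [|a l IHl]; first by rewrite big_geq.
rewrite /= big_nat_recl // expr0 mulr1 IHl mulr_sumr; congr (_ + _).
by apply: eq_bigr => i _; rewrite /= exprS; ring.
Qed.

Hypothesis z11 : z ^+ 11 = 1.

Lemma zev_fold11 n l : zev (fold11 n l) = zev l.
Proof.
elim: n l => //= n IHn l; case: ifP => // _; rewrite IHn zev_padd.
have zev_cat l1 l2 : zev (l1 ++ l2) = zev l1 + z ^+ size l1 * zev l2.
  by elim: l1 => [|a l1 IH] /=; rewrite ?add0r ?expr0 ?mul1r // IH exprS; ring.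
have [short | long] := ltnP 11 (size l).
  by rewrite -{3}(cat_take_drop 11 l) zev_cat size_take short z11 mul1r.
by rewrite drop_oversize // take_oversize // addr0.
Qed.

Hypothesis z1 : z != 1.

Lemma sum_powers : \sum_(0 <= i < 11) z ^+ i = 0.
Proof.
apply: (mulfI (_ : z - 1 != 0)); first by rewrite subr_eq0.
by rewrite mulr0 big_mkord -subrX1 z11 subrr.
Qed.

(** After reduction modulo X^11 - 1 it is enough that all coefficients are equal,
    since the powers of z add up to 0. *)
Lemma cyclotomic_zeroP l : cyclotomic_zero l -> zev l = 0.
Proof.
case/andP; rewrite -(zev_fold11 10 l); move: (fold11 10 l) => r r11 /allP const.
rewrite zev_sum; transitivity (zr K (nth Z0 r 0) * 0); last by rewrite mulr0.
rewrite -[X in _ = _ * X]sum_powers mulr_sumr.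
rewrite [RHS](@big_cat_nat _ _ _ (size r)) //= [X in _ = _ + X]big_nat_cond.
rewrite [X in _ = _ + X]big1 ?addr0 => [|i /andP[/andP[ri i11] _]]; last first.
  have /Z.eqb_eq <- : Z.eqb (nth Z0 r i) (nth Z0 r 0) by apply: const; rewrite mem_iota.
  by rewrite nth_default // zr0 mul0r.
rewrite !big_nat; apply: eq_bigr => i /andP[_ ir].
have /Z.eqb_eq -> // : Z.eqb (nth Z0 r i) (nth Z0 r 0).
by apply: const; rewrite mem_iota (leq_trans ir).
Qed.

End CyclotomicEvaluation.

(** * Recognizing the model from the relations *)

Section MatrixWords.
Variables (K : fieldType) (U W : 'M[K]_5).

Definition mgen (b : bool) : 'M[K]_5 := if b then W else U.
Definition mword (s : seq bool) : 'M[K]_5 := foldl (fun x b => x *m mgen b) 1%:M s.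

Lemma mword_cat s1 s2 : mword (s1 ++ s2) = mword s1 *m mword s2.
Proof.
rewrite /mword foldl_cat; elim/last_ind: s2 => [|s2 b IHs]; first by rewrite mulmx1.
by rewrite !foldl_rcons IHs mulmxA.
Qed.

Lemma mword_seq1 b : mword [:: b] = mgen b.
Proof. by rewrite /mword /= mul1mx. Qed.

Lemma mword_cons b s : mword (b :: s) = mgen b *m mword s.
Proof. by rewrite -cat1s mword_cat mword_seq1. Qed.

Lemma mword_u_word k : mword (u_word k) = U ^+ k.
Proof.
elim: k => [|k IHk]; first by [].
by rewrite /u_word -[nseq k.+1 _]/(false :: nseq k false) mword_cons IHk exprS.
Qed.

End MatrixWords.

Section Identification.
Variables (K : closedFieldType) (U W : 'M[K]_5).
Local Notation mword := (mword U W).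
Local Notation mgen := (mgen U W).
Hypothesis char11 : 11%:R != 0 :> K.
Hypothesis mword_rel : forall x y, (x, y) \in relations -> mword x = mword y.
Hypotheses (mword_ww : mword ww = 1%:M) (U_neq1 : U != 1%:M).

Lemma U11 : U ^+ 11 = 1.
Proof. by rewrite -(mword_u_word U W) (mword_rel (y := [::])). Qed.

Lemma mgen_unit b : mgen b \in unitmx.
Proof.
case: b => /=; last first.
  by apply: (mulmx1_unit (_ : U *m U ^+ 10 = 1%:M)).1; rewrite -[LHS]exprS U11.
apply: (mulmx1_unit (_ : W *m W = 1%:M)).1.
by rewrite -mword_ww /ww mword_cons mword_seq1.
Qed.

Lemma mword_unit s : mword s \in unitmx.
Proof.
elim: s => [|b s IHs]; first exact: unitmx1.
by rewrite mword_cons unitmx_mul mgen_unit.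
Qed.

Lemma primitive_root11 : exists z : K, 11.-primitive_root z.
Proof.
have [z z_root] : exists z : K, root (\poly_(i < 11) 1 : {poly K}) z.
  by apply/closed_rootP; rewrite size_poly_eq ?oner_neq0.
have z11 : z ^+ 11 = 1.
  apply/eqP; rewrite -subr_eq0 subrX1; move: z_root; rewrite rootE horner_poly.
  by under eq_bigr do rewrite mul1r; move=> /eqP ->; rewrite mulr0.
have [m mz] := prim_order_exists (isT : (0 < 11)%N) z11.
rewrite dvdn_divisors // !inE => /orP[] /eqP mE; rewrite mE in mz; last by exists z.
move/eqP: (prim_expr_order mz); rewrite expr1 => /eqP z1.
move: z_root; rewrite z1 rootE horner_poly.
under eq_bigr do rewrite expr1n mulr1.
by rewrite sumr_const card_ord (negPf char11).
Qed.

(** Since U^11 = 1, the product of the factors U - z^i is 0. As U - 1 is not 0,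
    one of the other factors is singular. *)
Lemma nontrivial_eigenvector : exists2 z : K, 11.-primitive_root z &
  exists2 e : 'rV[K]_5, e != 0 & e *m U = z *: e.
Proof.
have [z zP] := primitive_root11.
have prod0 : \prod_(0 <= i < 11) (U - (z ^+ i)%:M) = 0.
  transitivity (horner_mx U (\prod_(0 <= i < 11) ('X - (z ^+ i)%:P))).
    by rewrite rmorph_prod; apply: eq_bigr => i _; rewrite rmorphB /= horner_mx_X horner_mx_C.
  by rewrite (factor_Xn_sub_1 zP) rmorphB /= rmorphXn /= horner_mx_X rmorph1 U11 subrr.
have [units | /forallPn[i]] := boolP [forall i : 'I_10, U - (z ^+ i.+1)%:M \in unitmx].
  have PU : \prod_(0 <= i < 10) (U - (z ^+ i.+1)%:M) \in unitmx.
    rewrite big_mkord; apply: (big_ind (fun M : 'M[K]_5 => M \in unitmx)).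
    - exact: unitmx1.
    - by move=> A B AU BU; rewrite -[A * B]/(A *m B) unitmx_mul AU.
    by move=> i _; apply: (forallP units).
  move: prod0; rewrite big_nat_recl //= expr0 => prod0.
  case/eqP: U_neq1; apply/eqP; rewrite -subr_eq0; apply/eqP.
  by rewrite -[LHS](mulmxK PU) [_ *m \prod_(_ <= i < _) _]prod0 mul0mx.
rewrite unitmxE unitfE negbK => /det0P[e e0 eU].
exists (z ^+ i.+1).
  rewrite prim_root_exp_coprime // coprime_sym prime_coprime //.
  by apply/negP=> /(dvdn_leq (ltn0Sn i)); rewrite ltnS leqNgt ltn_ord.
exists e => //; apply/eqP; rewrite -subr_eq0; apply/eqP.
by rewrite -[RHS]eU mulmxBr mul_mx_scalar.
Qed.

End Identification.

(** The powers of 3 modulo 11. *)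
Definition power3 (n : nat) : nat := nth 0%N [:: 1; 3; 9; 5; 4]%N (n %% 5).

Section EigenvectorBasis.
Variables (K : closedFieldType) (U W : 'M[K]_5).
Local Notation mword := (mword U W).
Hypothesis char11 : 11%:R != 0 :> K.
Hypothesis mword_rel : forall x y, (x, y) \in relations -> mword x = mword y.
Hypothesis mword_ww : mword ww = 1%:M.
Variables (z : K) (e : 'rV[K]_5).
Hypotheses (zP : 11.-primitive_root z) (e0 : e != 0) (eU : e *m U = z *: e).

Local Notation H := (mword h_word).

(** The eigenvalues of u on the five eigenvectors below. *)
Definition conj_root (n : nat) : K := z ^+ power3 n.

Lemma conj_rootS n : conj_root n.+1 = conj_root n ^+ 3.
Proof.
have z11 := prim_expr_order zP.
rewrite /conj_root -exprM -[LHS](expr_mod _ z11) -[RHS](expr_mod _ z11); congr (_ ^+ _).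
rewrite /power3 (_ : n.+1 %% 5 = (n %% 5).+1 %% 5)%N; last by rewrite -[in LHS]addn1 -modnDml addn1.
have := ltn_pmod n (isT : (0 < 5)%N).
by case: (n %% 5)%N => [|[|[|[|[|]]]]].
Qed.

Lemma conj_root11 n : conj_root n ^+ 11 = 1.
Proof. by rewrite /conj_root -exprM mulnC exprM (prim_expr_order zP) expr1n. Qed.

Lemma conj_root_inj : {in gtn 5 &, injective conj_root}.
Proof.
move=> i j i5 j5 /eqP; rewrite /conj_root (eq_prim_root_expr zP).
by case: i j i5 j5 => [|[|[|[|[|]]]]] // [|[|[|[|[|]]]]].
Qed.

(** The relation h u = u^3 h makes h map eigenvectors of u to eigenvectors. *)
Definition eigenrow (n : nat) : 'rV[K]_5 := iter n (mulmx^~ H) e.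

Lemma eigenrowU n : eigenrow n *m U = conj_root n *: eigenrow n.
Proof.
elim: n => [|n IHn]; first exact: eU.
have hu : H *m U = mword (u_word 3) *m H.
  by rewrite -[X in _ *m X](mword_seq1 U W false) -!mword_cat; apply: mword_rel.
have u3 k : eigenrow n *m U ^+ k = conj_root n ^+ k *: eigenrow n.
  elim: k => [|k IHk]; first by rewrite mulmx1 scale1r.
  by rewrite exprSr [_ *m (_ * _)]mulmxA IHk -scalemxAl IHn scalerA -exprSr.
by rewrite /= -mulmxA hu mulmxA mword_u_word u3 -scalemxAl conj_rootS.
Qed.

Lemma eigenrow5 n : eigenrow (n + 5) = eigenrow n.
Proof.
have h5 : H *m H *m H *m H *m H = 1%:M by rewrite -mword_ww -!mword_cat; apply: mword_rel.
rewrite addnC /eigenrow iterD -/(eigenrow n); move: (eigenrow n) (mword h_word) h5 => v h h5.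
by rewrite -[RHS]mulmx1 -h5 !mulmxA.
Qed.

Lemma eigenrow_neq0 n : eigenrow n != 0.
Proof.
elim: n => //= n; apply: contra => /eqP En.
by rewrite -(mulmxK (mword_unit mword_rel mword_ww h_word) (eigenrow n)) En mul0mx.
Qed.

Definition eigenbasis : 'M[K]_5 := \matrix_(i < 5) eigenrow i.

(** The eigenvalues are distinct. *)
Lemma eigenbasis_unit : eigenbasis \in unitmx.
Proof.
rewrite -row_free_unit; apply/inj_row_free => v vE.
have vU k : v *m (\matrix_(i < 5) (conj_root i ^+ k *: eigenrow i)) = 0.
  suff -> : \matrix_(i < 5) (conj_root i ^+ k *: eigenrow i) = eigenbasis *m U ^+ k.
    by rewrite mulmxA vE mul0mx.
  elim: k => [|k IHk]; apply/row_matrixP=> i; rewrite rowK.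
    by rewrite mulmx1 rowK scale1r.
  rewrite [U ^+ _]exprSr [_ *m (_ * _)]mulmxA -IHk row_mul rowK.
  by rewrite -scalemxAl eigenrowU scalerA -exprSr.
apply/rowP=> i; rewrite mxE; apply/eqP; apply: contraT => vi.
(* The averaging operator that projects to the eigenspace of eigenrow i. *)
have : \sum_(0 <= k < 11) (conj_root i ^- k) *:
    (v *m (\matrix_(j < 5) (conj_root j ^+ k *: eigenrow j))) = 0.
  by rewrite big1 // => k _; rewrite vU scaler0.
have ri0 : conj_root i != 0.
  by apply/eqP=> ri0; have := conj_root11 i; rewrite ri0 expr0n => /eqP; rewrite eq_sym oner_eq0.
have -> : \sum_(0 <= k < 11) (conj_root i ^- k) *:
    (v *m (\matrix_(j < 5) (conj_root j ^+ k *: eigenrow j))) = (11%:R * v 0 i) *: eigenrow i.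
  transitivity (\sum_(j < 5)
      (v 0 j * \sum_(0 <= k < 11) (conj_root j / conj_root i) ^+ k) *: eigenrow j).
    under eq_bigr do rewrite mulmx_sum_row scaler_sumr.
    rewrite exchange_big; apply: eq_bigr => j _; rewrite mulr_sumr scaler_suml.
    apply: eq_bigr => k _; rewrite rowK !scalerA; congr (_ *: _).
    by rewrite expr_div_n; ring.
  rewrite (bigD1 i) //= [X in _ + X = _]big1 ?addr0 => [|j ji].
    rewrite divff //; under eq_bigr do rewrite expr1n.
    by rewrite sumr_const_nat mulrC.
  have y11 : (conj_root j / conj_root i) ^+ 11 = 1.
    by rewrite expr_div_n !conj_root11 divr1.
  rewrite (sum_powers y11) ?mulr0 ?scale0r //.
  apply: contra ji => /eqP yE; apply/eqP/val_inj/conj_root_inj; rewrite ?inE //=.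
  by rewrite -[LHS](divfK ri0) yE mul1r.
move/eqP; rewrite scaler_eq0 mulf_eq0 (negPf char11) (negPf vi) /=.
by rewrite (negPf (eigenrow_neq0 i)).
Qed.

Lemma eigenbasisU : eigenbasis *m U = diag_mx (\row_i conj_root i) *m eigenbasis.
Proof.
apply/row_matrixP=> i; rewrite row_mul rowK eigenrowU row_mul row_diag_mx.
by rewrite -scalemxAl -rowE rowK mxE.
Qed.

Definition wmat : 'M[K]_5 := eigenbasis *m W *m invmx eigenbasis.

Lemma eigenbasisW : eigenbasis *m W = wmat *m eigenbasis.
Proof. by rewrite /wmat mulmxKV ?eigenbasis_unit. Qed.

(** The relation h w h = w makes the matrix of w constant along antidiagonals. *)
Lemma wmat_antidiagonal (j l : 'I_5) : wmat j l = wmat 0 (j + l).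
Proof.
pose P : 'M[K]_5 := \matrix_(i, k) (k == i + 1)%:R.
have PM (M : 'M[K]_5) i k : (P *m M) i k = M (i + 1) k.
  rewrite mxE (bigD1 (i + 1)) //= mxE eqxx mul1r big1 ?addr0 // => l' /negPf li.
  by rewrite mxE li mul0r.
have MP (M : 'M[K]_5) i k : (M *m P) i (k + 1) = M i k.
  rewrite mxE (bigD1 k) //= mxE eqxx mulr1 big1 ?addr0 // => l' lk.
  by rewrite mxE (inj_eq (addIr _)) eq_sym (negPf lk) mulr0.
have EH : eigenbasis *m H = P *m eigenbasis.
  apply/row_matrixP=> i; rewrite row_mul rowK -[_ *m H]/(eigenrow i.+1).
  transitivity (row (i + 1) eigenbasis); last by apply/rowP=> k; rewrite [LHS]mxE [RHS]mxE PM.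
  rewrite rowK; case: (ltnP i.+1 5) => i4.
    by rewrite [nat_of_ord (_ + _)]modn_small ?addn1.
  have i5 : i.+1 = (0 + 5)%N by apply/eqP; rewrite eqn_leq i4 ltn_ord.
  by rewrite [nat_of_ord (_ + _)](_ : _ = 0%N) ?i5 ?eigenrow5 // -[LHS]/((i + 1) %% 5)%N addn1 i5.
have PWP : P *m wmat *m P = wmat.
  have hwh : H *m W *m H = W.
    rewrite -[X in _ *m X *m _](mword_seq1 U W true) -!mword_cat -[RHS](mword_seq1 U W true).
    exact: mword_rel.
  move: (mword h_word) EH hwh eigenbasisW => h EH hwh EW.
  apply: (can_inj (mulmxK eigenbasis_unit)).
  transitivity (P *m (wmat *m (P *m eigenbasis))); first by rewrite !mulmxA.
  by rewrite -EH [wmat *m _]mulmxA -EW !mulmxA -EH -!mulmxA [h *m _]mulmxA hwh EW.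
have shift i k : wmat (i + 1) k = wmat i (k + 1).
  by rewrite -[in RHS]PWP MP PM.
have all n k : wmat n%:R k = wmat 0 (n%:R + k).
  elim: n k => [|n IHn] k; first by rewrite add0r.
  by rewrite -natr1 shift IHn addrA addrAC.
by rewrite -[j]natr_Zp all.
Qed.

End EigenvectorBasis.

Section ModelLists.
Local Open Scope Z_scope.

(** The coordinates, as polynomials in an eleventh root of unity, of the
    eigenvectors of the first generator of the model, and of the dual basis. *)
Definition basis_lists : seq (seq Z) :=
  [:: [:: 1; 0; -1; 0; -1; 1; 0; 0; -1; 1; 0];
      [:: 0; 0; -1; 0; -1; -1; 1; 1; 0; 1; 0];
      [:: -1; 1; -1; 1; 0; 0; 1; 0; -1; 0; 0];
      [:: 0; 1; -1; 1; -1; 0; 0; -1; 0; 1; 0];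
      [:: 1; -1; 1; 0; 0; 1; 0; -1; 0; 0; -1]].

Definition dual_lists : seq (seq Z) :=
  [:: [:: -1; 1; 1; -1; 0; 0; 1; -1; -1; 1; 0];
      [:: 1; 1; -1; 0; 0; 1; -1; -1; 1; 0; -1];
      [:: 1; 0; -2; 0; 0; 1; 0; 0; 1; -1; 0];
      [:: 0; -1; 1; 1; -1; 0; 0; 1; -1; -1; 1];
      [:: 2; 0; -1; 0; -1; 1; -1; 1; 1; -1; -1]].

Definition sum5 (f : nat -> seq Z) : seq Z := psum (map f (iota 0 5)).

(** The polynomial of z^a - z^-a, for a a power of 3 modulo 11. *)
Definition diff_list (n : nat) : seq Z :=
  padd (monom (power3 n)) (pscale (-1) (monom ((power3 n * 10) %% 11)%N)).

(** The sum of the z^a, for a a nonzero square modulo 11, is a root of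
    tau^2 + tau + 3. *)
Definition tau_list : seq Z := sum5 (fun n => monom (power3 n)).

(** The Gauss sum 2 tau + 1, a square root of -11. *)
Definition disc_list : seq Z := padd [:: 1] (pscale 2 tau_list).

Definition basis_list (j i : nat) : seq Z := psubst (power3 i) (nth [::] basis_lists j).
Definition dual_list (j i : nat) : seq Z := psubst (power3 i) (nth [::] dual_lists j).

Definition entry (M : vec5 (vec5 oK)) (i j : nat) : oK :=
  coord (kconst 0) (coord (e0 M) M i) j.

Definition entry_list (M : vec5 (vec5 oK)) (i j : nat) : seq Z :=
  padd [:: k0 (entry M i j)] (pscale (k1 (entry M i j)) tau_list).

Definition pairs5 : seq (nat * nat) := [seq (i, j) | i <- iota 0 5, j <- iota 0 5].

Definition delta_list (i j : nat) : seq Z := if (i == j)%N then [:: 11] else [::].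

Definition diff_orthogonal_list (q : nat * nat) : seq Z :=
  padd (sum5 (fun k => pmul (diff_list (q.1 + k)) (diff_list (q.2 + k)))) (delta_list q.1 q.2).

Definition dual_basis_list (q : nat * nat) : seq Z :=
  padd (sum5 (fun i => pmul (basis_list q.1 i) (dual_list q.2 i)))
    (pscale (-1) (delta_list q.1 q.2)).

Definition model_row_list (M : vec5 (vec5 oK)) (j i : nat) : seq Z :=
  sum5 (fun k => pmul (entry_list M j k) (basis_list k i)).

Definition model_u_list (q : nat * nat) : seq Z :=
  padd (model_row_list mat_u q.1 q.2)
    (pscale (-1) (pmul (basis_list q.1 q.2) (monom (power3 q.2)))).

(** The matrix of w in the eigenbasis is predicted by [wmat_entry]; the list
    compares its product with the basis matrix to the model. *)
Definition model_w_list (q : nat * nat) : seq Z :=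
  padd (pscale 11 (model_row_list mat_w q.1 q.2))
    (pmul disc_list
       (sum5 (fun l => pmul (basis_list q.1 l) (diff_list (3 * (l + q.2) + 2))))).

Lemma tau_ok : cyclotomic_zero (padd (pmul tau_list tau_list) (padd tau_list [:: 3])).
Proof. by vm_compute. Qed.

Lemma disc_ok : cyclotomic_zero (padd (sum5 diff_list) (pscale (-1) disc_list)).
Proof. by vm_compute. Qed.

Lemma diff_orthogonal_ok : all (fun q => cyclotomic_zero (diff_orthogonal_list q)) pairs5.
Proof. by vm_compute. Qed.

Lemma dual_basis_ok : all (fun q => cyclotomic_zero (dual_basis_list q)) pairs5.
Proof. by vm_compute. Qed.

Lemma model_u_ok : all (fun q => cyclotomic_zero (model_u_list q)) pairs5.
Proof. by vm_compute. Qed.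

Lemma model_w_ok : all (fun q => cyclotomic_zero (model_w_list q)) pairs5.
Proof. by vm_compute. Qed.

Lemma generators_rational : all (fun q =>
  let r x := Z.eqb (k2 x) 0 && Z.eqb (k3 x) 0 in
  r (entry mat_u q.1 q.2) && r (entry mat_w q.1 q.2)) pairs5.
Proof. by vm_compute. Qed.

End ModelLists.

Section ModelEvaluation.
Variables (K : closedFieldType) (U W : 'M[K]_5).
Local Notation mword := (mword U W).
Hypothesis char11 : 11%:R != 0 :> K.
Hypothesis mword_rel : forall x y, (x, y) \in relations -> mword x = mword y.
Hypothesis mword_ww : mword ww = 1%:M.
Variables (z : K) (e : 'rV[K]_5).
Hypotheses (zP : 11.-primitive_root z) (e0 : e != 0) (eU : e *m U = z *: e).

Let z11 : z ^+ 11 = 1. Proof. exact: prim_expr_order zP. Qed.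
Let z1 : z != 1.
Proof. by apply/eqP=> z1; have := eq_prim_root_expr zP 0 1; rewrite expr0 expr1 z1 eqxx. Qed.

Local Notation E := (eigenbasis U W e).
Local Notation V := (wmat U W e).
Local Notation r := (conj_root z).
Local Notation ev := (zev z).

Definition diff_root (n : nat) : K := r n - r n ^+ 10.

Definition tau_value : K := \sum_(i < 5) r i.

Lemma zev_sum5 f : ev (sum5 f) = \sum_(i < 5) ev (f i).
Proof. by rewrite /sum5 zev_psum big_map -(big_mkord xpredT (fun i => ev (f i))) /index_iota. Qed.

Lemma zev_root n : ev (monom (power3 n)) = r n.
Proof. exact: zev_monom. Qed.

Lemma zev_opp l : ev (pscale (Zneg 1%positive) l) = - ev l.
Proof. by rewrite zev_pscale -[Zneg _]/(Z.opp 1) zrN zr1 mulN1r. Qed.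

Lemma zev_diff n : ev (diff_list n) = diff_root n.
Proof.
by rewrite zev_padd zev_opp zev_root zev_monom expr_mod // exprM.
Qed.

Lemma zev_tau : ev tau_list = tau_value.
Proof. by rewrite zev_sum5; apply: eq_bigr => i _; rewrite zev_root. Qed.

Lemma zev_disc : ev disc_list = 2%:R * tau_value + 1.
Proof. by rewrite zev_padd zev_pscale zev_tau /= mulr0 addr0 zr1 addrC. Qed.

Lemma zev_delta i j : ev (delta_list i j) = 11%:R *+ (i == j)%N.
Proof. by rewrite /delta_list; case: ifP => // _; rewrite /= mulr0 addr0. Qed.

Lemma zev_const a : ev [:: a] = zr K a. Proof. by rewrite /= mulr0 addr0. Qed.

Lemma in_pairs5 (i j : 'I_5) : (val i, val j) \in pairs5.
Proof. by apply: allpairs_f; rewrite mem_iota /=. Qed.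

Lemma tau_value_root : tau_value ^+ 2 + tau_value + 3%:R = 0.
Proof.
have := cyclotomic_zeroP z11 z1 tau_ok.
by rewrite zev_padd zev_pmul (zev_padd z tau_list) zev_const zev_tau expr2 addrA.
Qed.

Lemma sum_diff_root : \sum_(i < 5) diff_root i = 2%:R * tau_value + 1.
Proof.
have /eqP := cyclotomic_zeroP z11 z1 disc_ok.
rewrite zev_padd zev_opp zev_disc zev_sum5 subr_eq0 => /eqP <-.
by apply: eq_bigr => i _; rewrite zev_diff.
Qed.

Lemma diff_root_orthogonal (i j : 'I_5) :
  \sum_(k < 5) diff_root (i + k) * diff_root (j + k) = - (11%:R *+ (i == j)).
Proof.
have := cyclotomic_zeroP z11 z1 (allP diff_orthogonal_ok _ (in_pairs5 i j)).
rewrite zev_padd zev_delta zev_sum5 => /eqP; rewrite addr_eq0 => /eqP <-.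
by apply: eq_bigr => k _; rewrite zev_pmul !zev_diff.
Qed.

Definition model_basis : 'M[K]_5 := \matrix_(j, i) ev (basis_list j i).

Lemma model_basis_unit : model_basis \in unitmx.
Proof.
pose D : 'M[K]_5 := \matrix_(i, k) (ev (dual_list k i) / 11%:R).
apply: (mulmx1_unit (_ : model_basis *m D = 1%:M)).1.
apply/matrixP=> j k; rewrite !mxE.
have := cyclotomic_zeroP z11 z1 (allP dual_basis_ok _ (in_pairs5 j k)).
rewrite zev_padd zev_opp zev_delta zev_sum5 => /eqP; rewrite subr_eq0 => /eqP sumE.
transitivity ((11%:R *+ (j == k)) / 11%:R : K); last first.
  by case: (j == k); rewrite ?mulr1n ?divff ?mulr0n ?mul0r.
rewrite -sumE mulr_suml; apply: eq_bigr => i _.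
by rewrite zev_pmul !mxE mulrA.
Qed.

Lemma phim_entry om s (j k : 'I_5) :
  phim tau_value om (generator_mat s) j k = ev (entry_list (generator_mat s) j k).
Proof.
rewrite mxE -/(entry _ j k) zev_padd zev_const zev_pscale zev_tau /phi.
have /andP[ru rw] := allP generators_rational _ (in_pairs5 j k).
have /andP[/Z.eqb_eq -> /Z.eqb_eq ->] :
    Z.eqb (k2 (entry (generator_mat s) j k)) Z0 && Z.eqb (k3 (entry (generator_mat s) j k)) Z0.
  by case: s.
by rewrite zr0 !mul0r !addr0.
Qed.

Lemma zev_model_row om s (j i : 'I_5) :
  ev (model_row_list (generator_mat s) j i) =
  (phim tau_value om (generator_mat s) *m model_basis) j i.
Proof.
by rewrite mxE zev_sum5; apply: eq_bigr => k _; rewrite zev_pmul phim_entry mxE.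
Qed.

Lemma model_basisU om :
  phim tau_value om mat_u *m model_basis = model_basis *m diag_mx (\row_i r i).
Proof.
apply/matrixP=> j i; rewrite -(zev_model_row om false) mul_mx_diag !mxE.
have := cyclotomic_zeroP z11 z1 (allP model_u_ok _ (in_pairs5 j i)).
by rewrite zev_padd zev_opp zev_pmul zev_root => /eqP; rewrite subr_eq0 => /eqP.
Qed.

Lemma eigenbasisUn a : E *m U ^+ a = diag_mx (\row_i r i ^+ a) *m E.
Proof.
apply/row_matrixP=> i; rewrite row_mul rowK row_mul row_diag_mx.
rewrite -scalemxAl -rowE rowK mxE.
elim: a => [|a IHa]; first by rewrite mulmx1 scale1r.
rewrite [U ^+ _]exprSr [_ *m (_ * _)]mulmxA IHa -scalemxAl.
by rewrite (eigenrowU mword_rel zP eU) scalerA -exprSr.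
Qed.

Lemma trace_uw a : \tr (U ^+ a *m W) = \sum_(i < 5) r i ^+ a * V i i.
Proof.
have EU := eigenbasis_unit char11 mword_rel mword_ww zP e0 eU.
transitivity (\tr (diag_mx (\row_i r i ^+ a) *m V)).
  by rewrite /wmat !mulmxA -eigenbasisUn [RHS]mxtrace_mulC !mulmxA mulVmx // mul1mx.
by apply: eq_bigr => i _; rewrite mul_diag_mx !mxE.
Qed.

Lemma trace_u a : \tr (U ^+ a) = \sum_(i < 5) r i ^+ a.
Proof.
have EU := eigenbasis_unit char11 mword_rel mword_ww zP e0 eU.
rewrite -[U ^+ a](mulKmx EU) mxtrace_mulC eigenbasisUn mulmxK //.
by rewrite mxtrace_diag; apply: eq_bigr => i _; rewrite mxE.
Qed.

Lemma trace_rel x y q : (q ++ x, y ++ q) \in relations -> \tr (mword x) = \tr (mword y).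
Proof.
move/mword_rel; rewrite !mword_cat => xy.
have QU := mword_unit mword_rel mword_ww q.
by rewrite -(mulKmx QU (mword x)) xy mulmxA mxtrace_mulC mulmxA mulmxV // mul1mx.
Qed.

Lemma mword_uw a : mword (u_word a ++ [:: true]) = U ^+ a *m W.
Proof. by rewrite mword_cat mword_u_word mword_seq1. Qed.

(** The trace is a class function: in the group, u^a w is conjugate to its
    counterpart u^-a w when a is 1, 3, 4 or 5, u^9 w to u, and u^2 w to u^10. *)
Lemma trace_difference (k : 'I_5) :
  \sum_(i < 5) diff_root (i + k) * V i i = (2%:R * tau_value + 1) *+ (k == 2 :> nat).
Proof.
have T_inv a q : (a, q) \in reversing_words -> \tr (U ^+ a *m W) = \tr (U ^+ (11 - a) *m W).
  move=> aq; rewrite -mword_uw (@trace_rel _ (ww ++ u_word (11 - a) ++ [:: true]) q).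
    by rewrite mword_cat mword_ww mul1mx mword_uw.
  rewrite /relations mem_cat; apply/orP; right.
  by apply/mapP; exists (a, q); rewrite //= -!catA.
have T9 : \tr (U ^+ 9 *m W) = \tr (U ^+ 1).
  rewrite -mword_uw -(mword_u_word U W 1).
  exact: (@trace_rel _ _ [:: true; false]).
have T2 : \tr (U ^+ 2 *m W) = \tr (U ^+ 10).
  rewrite -mword_uw (@trace_rel _ (ww ++ u_word 10) [:: true; false; true]) //.
  by rewrite mword_cat mword_ww mul1mx mword_u_word.
have rk (i : 'I_5) : r (i + k) = r i ^+ power3 k.
  rewrite /conj_root -exprM -[LHS](expr_mod _ z11) -[RHS](expr_mod _ z11).
  congr (_ ^+ _); case: i k => [] [|[|[|[|[|]]]]] // ? [] [|[|[|[|[|]]]]] //.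
have sumE : \sum_(i < 5) diff_root (i + k) * V i i =
    \tr (U ^+ power3 k *m W) - \tr (U ^+ (power3 k * 10 %% 11) *m W).
  rewrite !trace_uw -sumrB; apply: eq_bigr => i _; rewrite -mulrBl; congr (_ * _).
  by rewrite /diff_root rk -exprM expr_mod // (conj_root11 zP).
rewrite sumE; have := ltn_ord k; case: (nat_of_ord k) => [|[|[|[|[|]]]]] // _.
- by rewrite (T_inv 1%N _ (mem_head _ _)) subrr.
- by rewrite (T_inv 3%N (true :: u_word 2 ++ [:: true; false; true])) // subrr.
- rewrite T9 T2 !trace_u -sumrB mulr1n -sum_diff_root.
  by apply: eq_bigr => i _; rewrite expr1.
- by rewrite (T_inv 5%N (u_word 2 ++ true :: u_word 3 ++ true :: u_word 1)) // subrr.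
by rewrite (T_inv 4%N (u_word 4 ++ true :: u_word 2 ++ true :: u_word 4)) // subrr.
Qed.

(** The orthogonality of the differences z^a - z^-a inverts the linear system
    given by the traces. *)
Lemma wmat_diagonal (i : 'I_5) : 11%:R * V i i = - ((2%:R * tau_value + 1) * diff_root (i + 2)).
Proof.
have : \sum_(k < 5) diff_root (i + k) * (\sum_(j < 5) diff_root (j + k) * V j j) =
    (2%:R * tau_value + 1) * diff_root (i + 2).
  pose two : 'I_5 := Ordinal (isT : (2 < 5)%N).
  rewrite (bigD1 two) //= [X in _ + X]big1 ?addr0 => [|k k2].
    by rewrite (trace_difference two) mulr1n mulrC.
  by rewrite trace_difference (negPf (_ : val k != 2%N)) ?mulr0n ?mulr0.
move <-; under eq_bigr do rewrite mulr_sumr.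
rewrite exchange_big (bigD1 i) //= [X in _ + X]big1 ?addr0 => [|j ji].
  under eq_bigr do rewrite mulrA.
  by rewrite -mulr_suml diff_root_orthogonal eqxx mulr1n mulNr opprK.
under eq_bigr do rewrite mulrA.
by rewrite -mulr_suml diff_root_orthogonal eq_sym (negPf ji) oppr0 mul0r.
Qed.

(** Along antidiagonals the matrix is constant, and l + i is twice 3 (l + i)
    modulo 5, so that its diagonal determines it. *)
Lemma wmat_entry (l i : 'I_5) :
  11%:R * V l i = - ((2%:R * tau_value + 1) * diff_root (3 * (l + i) + 2)).
Proof.
pose m : 'I_5 := (l + i) + (l + i) + (l + i).
have anti := wmat_antidiagonal char11 mword_rel mword_ww zP e0 eU.
have mm : m + m = l + i.
  by apply/val_inj; case: l i @m => [] [|[|[|[|[|]]]]] // ? [] [|[|[|[|[|]]]]].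
rewrite anti -mm -anti wmat_diagonal; congr (- (_ * _)).
rewrite /diff_root (_ : r (m + 2) = r (3 * (l + i) + 2)) //.
rewrite /conj_root; congr (_ ^+ _).
by clear mm; rewrite {}/m; case: l i => [] [|[|[|[|[|]]]]] // ? [] [|[|[|[|[|]]]]].
Qed.

Lemma model_basisW om : phim tau_value om mat_w *m model_basis = model_basis *m V.
Proof.
apply/matrixP=> j i; apply: (mulfI char11).
have := cyclotomic_zeroP z11 z1 (allP model_w_ok _ (in_pairs5 j i)).
rewrite zev_padd zev_pscale (zev_model_row om true) zev_pmul zev_disc zev_sum5.
have -> : zr K (Zpos 11%positive) = 11%:R by [].
move/eqP; rewrite addr_eq0 => /eqP ->.
move: (2%:R * tau_value + 1) wmat_entry => d wmat_entry.
rewrite [in RHS]mxE !mulr_sumr -sumrN; apply: eq_bigr => l _.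
by rewrite mulrCA wmat_entry zev_pmul zev_diff mulrN mulrCA mxE.
Qed.

End ModelEvaluation.

(** Up to a choice of the root of tau^2 + tau + 3, the relations have a single
    nontrivial solution in five-by-five matrices that sends the central element
    to 1: conjugation by eigenvectors of u turns it into the model. *)
Theorem model_intertwiner (K : closedFieldType) (U W : 'M[K]_5) :
  11%:R != 0 :> K ->
  (forall x y, (x, y) \in relations -> mword U W x = mword U W y) ->
  mword U W ww = 1%:M -> U != 1%:M ->
  exists t, t ^+ 2 + t + 3%:R = 0 /\ exists2 X : 'M[K]_5, X \in unitmx &
    forall om s, phim t om (generator_mat s) *m X = X *m mgen U W s.
Proof.
move=> char11 rel ww1 U1.
have [z zP [e e0 eU]] := nontrivial_eigenvector char11 rel U1.
exists (tau_value z); split; first exact: tau_value_root.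
have EU := eigenbasis_unit char11 rel ww1 zP e0 eU.
exists (model_basis z *m eigenbasis U W e).
  by rewrite unitmx_mul model_basis_unit.
move=> om [] /=.
  by rewrite mulmxA (model_basisW char11 rel ww1 zP e0 eU) -mulmxA -mulmxA
    (eigenbasisW char11 rel ww1 zP e0 eU).
by rewrite mulmxA (model_basisU zP) -mulmxA -mulmxA (eigenbasisU rel zP eU).
Qed.

(** * Stabilizers of order twelve *)

Section Stabilizer.
Variables (gT : finGroupType) (S : {group gT}) (u w : gT).
Hypothesis presS : presented S u w.

Local Notation c := (word u w c_word).

Lemma c6 : (c ^+ 6)%g = word u w ww.
Proof.
have <- : word u w (flatten (nseq 6 c_word)) = word u w ww by apply: (word_rel presS).
have flattenE n : word u w (flatten (nseq n c_word)) = (c ^+ n)%g.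
  elim: n => [|n IHn]; first by [].
  by rewrite -[flatten _]/(c_word ++ flatten (nseq n c_word)) word_cat IHn expgS.
by rewrite flattenE.
Qed.

Lemma order_c4 : #[(c ^+ 4)%g]%g = 3%N.
Proof. by rewrite orderXdiv (order_c presS). Qed.

Variable St : {group gT}.
Hypotheses (sSt : St \subset S) (oSt : #|St| = 12%N).

(** The subgroups of order 3 are the Sylow subgroups of a group of order 1320. *)
Lemma stabilizer_conjugate : exists2 y, y \in S & (c ^+ 4)%g \in (St :^ y)%g.
Proof.
have [|x Sx ox] := @Cauchy gT 3 St isT; first by rewrite oSt.
have syl (y : gT) : y \in S -> #[y]%g = 3%N -> (3.-Sylow(S) <[y]>)%g.
  move=> Sy oy; rewrite pHallE cycle_subG Sy /= -orderE oy (pres_card presS).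
  by rewrite p_part.
have Sc4 : (c ^+ 4)%g \in S by rewrite groupX ?(word_mem presS).
have [y Sy yE] := Sylow_trans (syl x (subsetP sSt x Sx) ox) (syl _ Sc4 order_c4).
exists y => //; have := cycle_id (c ^+ 4)%g; rewrite yE.
by apply/subsetP; rewrite conjSg cycle_subG.
Qed.

(** The subgroup of order 6 generated by c^2 has index 2, hence is normal, so
    that conjugation sends c^4 to one of its powers. If c^4 is always fixed, the
    stabilizer lies in the centralizer of c^4, which is <[c]>. *)
Lemma stabilizer_cyclic : (c ^+ 4)%g \in St -> word u w ww \in St ->
  (forall g k, g \in St -> ((c ^+ 4) ^ g = (c ^+ 4) ^+ k)%g -> ((c ^+ 4) ^ g = c ^+ 4)%g) ->
  St :=: <[c]>%g.
Proof.
move=> Stc4 Stww fixed.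
have Stc2 : (c ^+ 2)%g \in St.
  have -> : (c ^+ 2 = c ^+ 6 * (c ^+ 4) ^+ 2)%g.
    by rewrite -expgM -expgD (expgD c 2 12) (pres_power12 presS) mulg1.
  by apply: groupM; [rewrite c6 | exact: groupX].
have sHSt : (<[c ^+ 2]> \subset St)%g by rewrite cycle_subG.
have nH : (<[c ^+ 2]> <| St)%g.
  apply: index2_normal => //; rewrite -divgS // -orderE orderXdiv (order_c presS) //.
  by rewrite oSt.
apply/eqP; rewrite eqEcard oSt -orderE (order_c presS) leqnn andbT.
apply/subsetP=> g Stg; apply: (centralizer_c4 presS (subsetP sSt g Stg)).
apply/commute_sym/commgP/conjg_fixP.
have : (c ^+ 2 ^ g \in <[c ^+ 2]>)%g.
  by rewrite memJ_norm ?cycle_id // (subsetP (normal_norm nH)).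
case/cycleP=> k kE; apply: (fixed g k Stg).
rewrite -[4%N]/(2 * 2)%N expgM conjXg kE -!expgM.
by congr (_ ^+ _)%g; rewrite -mulnA (mulnC k).
Qed.

End Stabilizer.

(** * The eigenvectors of the element of order twelve *)

Section EigenData.
Local Open Scope Z_scope.

(** It spans the eigenspace of c for the eigenvalue 1; it is also fixed by the
    element that inverts c. *)
Definition fixed_row : vec5 oK :=
  V5 (OK (-1) 0 0 0) (OK 0 0 0 0) (OK 1 0 0 0) (OK (-1) (-1) 0 0) (OK 0 0 0 0).

(** The base point of the second candidate, with eigenvalue -omega^2. *)
Definition point1 : vec5 oK :=
  V5 (OK 0 1 0 0) (OK 1 0 (-1) 0) (OK 1 0 (-1) 1) (OK (-1) (-1) 1 0) (OK 0 (-1) 0 1).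

(** Six times the inverse of the matrix of eigenvectors below. *)
Definition eigen_dual : vec5 (vec5 oK) :=
  V5 (V5 (OK 0 2 0 0) (OK 0 0 0 (-1)) (OK 0 1 0 1) (OK 0 0 1 1) (OK (-1) (-1) (-1) (-1)))
     (V5 (OK 0 2 0 0) (OK 0 1 0 1) (OK 0 0 0 (-1)) (OK (-1) (-1) 0 0) (OK (-1) (-1) 0 0))
     (V5 (OK (-2) 0 0 0) (OK 0 0 2 1) (OK (-2) (-1) (-2) (-1)) (OK 0 0 1 1)
       (OK (-1) (-1) (-1) (-1)))
     (V5 (OK (-2) 2 0 0) (OK 0 0 2 0) (OK (-2) 0 (-2) 0) (OK 0 0 0 0) (OK 0 0 0 0))
     (V5 (OK 2 0 0 0) (OK 1 0 0 (-1)) (OK 1 1 0 1) (OK 0 1 1 0) (OK (-1) 1 (-1) 0)).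

(** For a prime p, the two roots of tau^2 + tau + 3 modulo p, each with five
    points whose determinant vanishes modulo p at this root. *)
Definition singular_sets : seq (Z * (Z * seq nat) * (Z * seq nat)) :=
  [:: (5, (1, [:: 0; 3; 2; 15; 4]%N), (3, [:: 0; 3; 2; 15; 55]%N));
      (23, (4, [:: 0; 3; 2; 79; 61]%N), (18, [:: 0; 3; 2; 7; 8]%N));
      (47, (20, [:: 0; 3; 2; 84; 108]%N), (26, [:: 0; 3; 2; 13; 64]%N));
      (53, (12, [:: 0; 3; 2; 97; 42]%N), (40, [:: 0; 3; 2; 8; 77]%N));
      (59, (7, [:: 0; 3; 2; 94; 92]%N), (51, [:: 0; 3; 4; 60; 94]%N));
      (71, (14, [:: 0; 3; 4; 6; 85]%N), (56, [:: 0; 3; 2; 8; 95]%N));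
      (89, (36, [:: 0; 3; 7; 85; 67]%N), (52, [:: 0; 3; 2; 13; 51]%N));
      (113, (10, [:: 0; 3; 11; 59; 73]%N), (102, [:: 0; 3; 8; 72; 58]%N));
      (137, (58, [:: 0; 3; 7; 54; 14]%N), (78, [:: 0; 3; 5; 47; 12]%N));
      (179, (69, [:: 0; 19; 18; 36; 40]%N), (109, [:: 0; 1; 19; 35; 79]%N));
      (191, (53, [:: 0; 3; 18; 45; 95]%N), (137, [:: 0; 3; 6; 60; 52]%N));
      (251, (47, [:: 0; 19; 40; 91; 25]%N), (203, [:: 0; 3; 46; 108; 40]%N));
      (257, (97, [:: 0; 71; 41; 43; 4]%N), (159, [:: 0; 3; 14; 77; 33]%N));
      (269, (63, [:: 0; 19; 18; 95; 25]%N), (205, [:: 0; 1; 43; 83; 48]%N));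
      (353, (32, [:: 0; 3; 24; 105; 35]%N), (320, [:: 0; 13; 24; 79; 60]%N));
      (383, (19, [:: 0; 3; 13; 92; 28]%N), (363, [:: 0; 3; 13; 37; 85]%N));
      (647, (98, [:: 0; 95; 94; 76; 18]%N), (548, [:: 0; 19; 6; 69; 31]%N));
      (683, (145, [:: 0; 3; 32; 33; 92]%N), (537, [:: 0; 13; 7; 62; 45]%N));
      (797, (234, [:: 0; 71; 4; 96; 101]%N), (562, [:: 0; 3; 33; 98; 35]%N));
      (863, (309, [:: 0; 3; 14; 77; 96]%N), (553, [:: 0; 13; 35; 53; 49]%N));
      (929, (405, [:: 0; 13; 26; 40; 38]%N), (523, [:: 0; 13; 15; 45; 65]%N));
      (971, (300, [:: 0; 14; 32; 37; 98]%N), (670, [:: 0; 13; 4; 62; 45]%N));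
      (1439, (310, [:: 0; 13; 48; 52; 45]%N), (1128, [:: 0; 13; 41; 48; 45]%N));
      (1871, (722, [:: 0; 13; 24; 26; 74]%N), (1148, [:: 0; 13; 24; 79; 65]%N));
      (3917, (1687, [:: 0; 13; 26; 53; 98]%N), (2229, [:: 0; 14; 21; 77; 96]%N))].

Definition eigenvectors : vec5 (vec5 oK) :=
  V5 fixed_row point0 (vmap conj_omega point0) point1 (vmap conj_omega point1).

(** The exponents of -omega in the eigenvalues 1, omega, omega^2, -omega^2, -omega. *)
Definition eigen_exponents : seq nat := [:: 0; 4; 2; 5; 1]%N.

Definition eigenrows : seq (vec5 oK) :=
  let 'V5 a b c d e := eigenvectors in [:: a; b; c; d; e].

Definition scalar_mat (a : Z) : vec5 (vec5 oK) :=
  let x := kconst a in let o := kconst 0 in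
  V5 (V5 x o o o o) (V5 o x o o o) (V5 o o x o o) (V5 o o o x o) (V5 o o o o x).

Definition mat_word (s : seq bool) : vec5 (vec5 oK) :=
  foldl (fun M b => mmul M (generator_mat b)) (scalar_mat 1) s.

Definition mateqb (M N : vec5 (vec5 oK)) : bool :=
  let 'V5 a b c d e := M in let 'V5 a' b' c' d' e' := N in
  [&& veqb a a', veqb b b', veqb c c', veqb d d' & veqb e e'].

Definition kpow (x : oK) (n : nat) : oK := iter n (kmul x) (kconst 1).

Definition divides (p : Z) (x : Z) : bool := Z.eqb (Z.modulo x p) 0.

Definition singular_set (v : vec5 oK) (test : oK -> bool) (s : seq nat) : bool :=
  let pt i := nth v (orbit_points v) (nth 0%N s i) in
  [&& size s == 5%N, all (fun i => i < 110)%N s, uniq s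
    & test (det5 (pt 0%N) (pt 1%N) (pt 2%N) (pt 3%N) (pt 4%N))].

Definition vanishes_at (p r : Z) (x : oK) : bool :=
  let 'OK a b c d := x in divides p (a + b * r) && divides p (c + d * r).

Lemma eigenrows_ok :
  all (fun i => let v := nth point0 eigenrows i in
         veqb (vmul v (mat_word c_word))
              (vmap (kmul (kpow (OK 0 0 (-1) 0) (nth 0%N eigen_exponents i))) v)) (iota 0 5).
Proof. by vm_compute. Qed.

Lemma fixed_row_ok : veqb (vmul fixed_row (mat_word s_word)) fixed_row.
Proof. by vm_compute. Qed.

Lemma eigen_dual_ok : mateqb (mmul eigenvectors eigen_dual) (scalar_mat 6).
Proof. by vm_compute. Qed.

Lemma point1_singular : singular_set point1 (keqb (kconst 0)) [:: 0; 18; 73; 8; 13]%N.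
Proof. by vm_compute. Qed.

Lemma singular_sets_ok : all (fun q => let: (p, (r1, s1), (r2, s2)) := q in
  [&& divides p (r1 + r2 + 1), divides p (r1 * r2 - 3),
      singular_set point0 (vanishes_at p r1) s1 & singular_set point0 (vanishes_at p r2) s2])
  singular_sets.
Proof. by vm_compute. Qed.

End EigenData.

Section EigenEvaluation.
Variables (K : fieldType) (t w : K).
Hypothesis tw : roots t w.
Hypotheses (char2 : 2%:R != 0 :> K) (char3 : 3%:R != 0 :> K).

Let t2 : t ^+ 2 + t + 3%:R = 0. Proof. by case: tw. Qed.
Let w2 : w ^+ 2 + w + 1 = 0. Proof. by case: tw. Qed.

Lemma cube_omega : w ^+ 3 = 1.
Proof.
by apply/eqP; rewrite -subr_eq0 -(mulr0 (w - 1)) -w2; apply/eqP; ring.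
Qed.

Lemma omega_neq0 : w != 0.
Proof. by apply/eqP=> w0; move/eqP: cube_omega; rewrite w0 expr0n eq_sym oner_eq0. Qed.

Lemma primitive_root6 : 6.-primitive_root (- w).
Proof.
have w6 : (- w) ^+ 6 = 1.
  by rewrite exprNn -signr_odd mul1r -[6%N]/(3 * 2)%N exprM cube_omega expr1n.
have [m mP] := prim_order_exists (isT : (0 < 6)%N) w6.
rewrite dvdn_divisors // !inE => /or4P[] /eqP mE; rewrite mE in mP => //.
- move: (prim_expr_order mP); rewrite expr1 => wE.
  have : w ^+ 2 + w + 1 = 1 by rewrite -(opprK w) wE sqrrN expr1n subrr add0r.
  by rewrite w2 => /eqP; rewrite eq_sym oner_eq0.
- move: (prim_expr_order mP); rewrite sqrrN => wE.
  have w_2 : w = - 2%:R by apply/eqP; rewrite -addr_eq0; apply/eqP; rewrite -w2 wE; ring.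
  by case/eqP: char3; transitivity ((- 2%:R) ^+ 2 - 1 : K); [ring | rewrite -w_2 wE subrr].
move: (prim_expr_order mP); rewrite exprNn cube_omega mulr1 -signr_odd expr1 => E.
by case/eqP: char2; rewrite -[2%:R]/(1 + 1 : K) -{1}E addNr.
Qed.

Local Notation C := (phim t w (mat_word c_word)).

Definition eigenvalue_c (i : nat) : K := (- w) ^+ nth 0%N eigen_exponents i.
Definition eigenvector_c (i : nat) : 'rV[K]_5 := phiv t w (nth point0 eigenrows i).

Lemma eigenvalue_c_inj : {in gtn 5 &, injective eigenvalue_c}.
Proof.
move=> i j i5 j5 /eqP; rewrite /eigenvalue_c (eq_prim_root_expr primitive_root6).
by case: i j i5 j5 => [|[|[|[|[|]]]]] // [|[|[|[|[|]]]]].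
Qed.

Lemma eigenvalue_c4 i : (i < 5)%N -> eigenvalue_c i ^+ 4 = 1 -> i = 0%N.
Proof.
move=> i5 /eqP; rewrite -exprM -[1](expr0 (- w)) (eq_prim_root_expr primitive_root6).
by case: i i5 => [|[|[|[|[|]]]]].
Qed.

Lemma phi_kpow x n : phi t w (kpow x n) = phi t w x ^+ n.
Proof.
elim: n => [|n IHn]; first by rewrite (phi_const t w 1) zr1.
by rewrite /= phiM // IHn exprS.
Qed.

Lemma phim_scalar a : phim t w (scalar_mat a) = (zr K a)%:M.
Proof.
have p0 : phi t w (kconst Z0) = 0 by rewrite phi_const zr0.
apply/matrixP=> i j; rewrite !mxE.
case: i j => [] [|[|[|[|[|]]]]] // ? [] [|[|[|[|[|]]]]] //= ?;
  by rewrite /coord /= ?p0 ?phi_const ?mulr1n ?mulr0n.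
Qed.

Lemma phim_word s : phim t w (mat_word s) = mword (phim t w mat_u) (phim t w mat_w) s.
Proof.
rewrite /mat_word /mword -[1%:M]/((zr K 1)%:M) -phim_scalar.
elim/last_ind: s => // s b IHs; rewrite !foldl_rcons phim_mul // IHs.
by case: b.
Qed.

Lemma eigenvector_cE (i : 'I_5) : eigenvector_c i *m C = eigenvalue_c i *: eigenvector_c i.
Proof.
have i_in : val i \in iota 0 5 by rewrite mem_iota /=.
have vE := veqbP (allP eigenrows_ok _ i_in).
rewrite /eigenvector_c -phiv_mul // vE phiv_scale // phi_kpow; congr (_ ^+ _ *: _).
by rewrite /phi /= -[Z.neg 1]/(Z.opp 1) zrN zr0 zr1; ring.
Qed.

Lemma eigenvector_cXE (i : 'I_5) k :
  eigenvector_c i *m C ^+ k = eigenvalue_c i ^+ k *: eigenvector_c i.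
Proof.
elim: k => [|k IHk]; first by rewrite mulmx1 scale1r.
by rewrite exprSr [_ *m (_ * _)]mulmxA IHk -scalemxAl eigenvector_cE scalerA -exprSr.
Qed.

Lemma row_eigenvectors i : row i (phim t w eigenvectors) = eigenvector_c i.
Proof. by rewrite row_phim; case: i => [] [|[|[|[|[|]]]]]. Qed.

Lemma mateqbP M N : mateqb M N -> M = N.
Proof.
case: M N => a b c d e [a' b' c' d' e'].
by case/and5P=> /veqbP-> /veqbP-> /veqbP-> /veqbP-> /veqbP->.
Qed.

Lemma eigenvectors_unit : phim t w eigenvectors \in unitmx.
Proof.
have six : zr K (Zpos 6%positive) != 0.
  by rewrite (_ : zr K _ = 2%:R * 3%:R) ?mulf_neq0 // -natrM.
have := congr1 (phim t w) (mateqbP eigen_dual_ok).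
rewrite [X in X = _](phim_mul t2 w2) phim_scalar => TD.
apply: (mulmx1_unit (_ : _ *m ((zr K (Zpos 6%positive))^-1 *: phim t w eigen_dual) = 1%:M)).1.
by rewrite -scalemxAr TD scale_scalar_mx mulVf.
Qed.

(** The coordinates in the eigenbasis of c of an eigenvector of c^k vanish at
    the other eigenvalues. *)
Lemma eigen_support b k mu : b *m C ^+ k = mu *: b ->
  exists2 v : 'rV[K]_5, b = \sum_(i < 5) v 0 i *: eigenvector_c i &
    forall i : 'I_5, v 0 i != 0 -> eigenvalue_c i ^+ k = mu.
Proof.
have TU := eigenvectors_unit; pose v := b *m invmx (phim t w eigenvectors).
have bE : b = \sum_(i < 5) v 0 i *: eigenvector_c i.
  rewrite -{1}[b](mulmxKV TU) mulmx_sum_row.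
  by apply: eq_bigr => i _; rewrite row_eigenvectors.
move=> bC; exists v => // i vi; apply/eqP; rewrite -subr_eq0.
pose x : 'rV[K]_5 := \row_j (v 0 j * (eigenvalue_c j ^+ k - mu)).
have x0 : x *m phim t w eigenvectors = 0.
  transitivity (b *m C ^+ k - mu *: b); last by rewrite bC subrr.
  rewrite {1 2}bE mulmx_suml scaler_sumr -sumrB mulmx_sum_row; apply: eq_bigr => j _.
  by rewrite row_eigenvectors mxE -scalemxAl eigenvector_cXE !scalerA -scalerBl mulrBr (mulrC mu).
have : x = 0 by rewrite -(mulmxK TU x) x0 mul0mx.
move/rowP/(_ i); rewrite [LHS]mxE [RHS]mxE => /eqP; rewrite mulf_eq0 (negPf vi).
by [].
Qed.

Lemma eigenvector_of_c b mu : b != 0 -> b *m C = mu *: b ->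
  exists i : 'I_5, mu = eigenvalue_c i /\ exists2 a, a != 0 & b = a *: eigenvector_c i.
Proof.
move=> b0 bC; have [|v bE supp] := @eigen_support b 1 mu; first by rewrite expr1.
have [i vi] : exists i, v 0 i != 0.
  apply/existsP; apply: contraT; rewrite negb_exists => /forallP v0; case/eqP: b0.
  by rewrite bE big1 // => i _; move: (v0 i); rewrite negbK => /eqP ->; rewrite scale0r.
have muE := supp i vi; exists i; split; first by rewrite -muE expr1.
exists (v 0 i) => //; rewrite bE (bigD1 i) //= big1 ?addr0 // => j ji.
have [-> | vj] := eqVneq (v 0 j) 0; first by rewrite scale0r.
case/eqP: ji; apply/val_inj/eigenvalue_c_inj; rewrite ?inE //=.
by have := supp j vj; rewrite -muE !expr1.
Qed.

Lemma fixed_by_c4 b : b *m C ^+ 4 = b -> exists a, b = a *: phiv t w fixed_row.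
Proof.
move=> bC; have [|v bE supp] := @eigen_support b 4 1; first by rewrite scale1r.
exists (v 0 0); rewrite bE (bigD1 0) //= big1 ?addr0 // => j j0.
have [-> | vj] := eqVneq (v 0 j) 0; first by rewrite scale0r.
by case/eqP: j0; apply/val_inj/(eigenvalue_c4 (ltn_ord j)); apply: supp.
Qed.

Lemma fixed_row_c : phiv t w fixed_row *m C = phiv t w fixed_row.
Proof. by rewrite [LHS](eigenvector_cE ord0) /eigenvalue_c expr0 scale1r. Qed.

Lemma fixed_row_s : phiv t w fixed_row *m phim t w (mat_word s_word) = phiv t w fixed_row.
Proof. by rewrite -phiv_mul // (veqbP fixed_row_ok). Qed.

End EigenEvaluation.

(** * Orbits of length 110 *)

Section LineOrbit.
Variables (gT : finGroupType) (S : {group gT}) (u w : gT).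
Hypothesis presS : presented S u w.
Variables (F : finFieldType) (R : gT -> 'M[F]_5).
Hypotheses (R1 : R 1%g = 1%:M) (RM : {in S &, forall x y, R (x * y)%g = R x *m R y}).

Local Notation c := (word u w c_word).

Definition line_orbit (a : 'rV[F]_5) : {set {vspace 'rV[F]_5}} := [set <[a *m R g]>%VS | g in S].

Definition line_stab (a : 'rV[F]_5) : {set gT} := [set g in S | a *m R g \in <[a]>%VS].

Lemma R_unit g : g \in S -> R g \in unitmx.
Proof.
move=> Sg; apply: (mulmx1_unit (_ : R g *m R g^-1%g = 1%:M)).1.
by rewrite -RM ?groupV // mulgV.
Qed.

Lemma RX g k : g \in S -> R (g ^+ k)%g = R g ^+ k.
Proof.
by move=> Sg; elim: k => [|k IHk]; rewrite ?expg0 // expgS exprS RM ?groupX // IHk.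
Qed.

Lemma R_word x : R (word u w x) = mword (R u) (R w) x.
Proof.
elim/last_ind: x => // x b IHx.
rewrite /word /mword !foldl_rcons RM ?(pres_mem presS) ?(word_mem presS) //.
by rewrite -/(word u w x) IHx; case: b.
Qed.

Lemma mulmx_row_neq0 (a : 'rV[F]_5) g : a != 0 -> g \in S -> a *m R g != 0.
Proof.
move=> a0 Sg; apply: contra a0 => /eqP ag.
by rewrite -(mulmxK (R_unit Sg) a) ag mul0mx.
Qed.

Lemma line_stabP a g : g \in line_stab a -> g \in S /\ exists l, a *m R g = l *: a.
Proof. by rewrite inE => /andP[Sg /vlineP[l al]]; split; last by exists l. Qed.

Lemma line_stabI a g l : g \in S -> a *m R g = l *: a -> g \in line_stab a.
Proof. by move=> Sg al; rewrite inE Sg al memvZ ?memv_line. Qed.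

Lemma line_stab_group_set a : group_set (line_stab a).
Proof.
apply/group_setP; split=> [|g h /line_stabP[Sg [l al]] /line_stabP[Sh [m am]]].
  by apply: (line_stabI (l := 1)); rewrite // R1 mulmx1 scale1r.
apply: (line_stabI (l := l * m)); first exact: groupM.
by rewrite RM // mulmxA al -scalemxAl am scalerA.
Qed.

Canonical line_stab_group a := Group (line_stab_group_set a).

Lemma line_stab_sub a : line_stab a \subset S.
Proof. by apply/subsetP=> g /line_stabP[]. Qed.

Lemma line_scale (v : 'rV[F]_5) l : l != 0 -> <[l *: v]>%VS = <[v]>%VS.
Proof.
move=> l0; apply/eqP; rewrite eqEsubv -!memvE memvZ ?memv_line //=.
by rewrite -{1}[v](scalerK l0) memvZ // memv_line.
Qed.

Lemma line_orbit_stab a x g : a != 0 -> x \in line_stab a -> g \in S ->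
  <[a *m R (x * g)%g]>%VS = <[a *m R g]>%VS.
Proof.
move=> a0 /line_stabP[Sx [l al]] Sg; rewrite RM // mulmxA al -scalemxAl line_scale //.
by apply/eqP=> l0; have := mulmx_row_neq0 a0 Sx; rewrite al l0 scale0r eqxx.
Qed.

Lemma line_orbit_eq a g h : g \in S -> h \in S ->
  <[a *m R g]>%VS = <[a *m R h]>%VS -> (g * h^-1)%g \in line_stab a.
Proof.
move=> Sg Sh eq_gh; have /vlineP[l lE] : a *m R g \in <[a *m R h]>%VS.
  by rewrite -eq_gh memv_line.
apply: (line_stabI (l := l)); first by rewrite groupM ?groupV.
by rewrite RM ?groupV // mulmxA lE -scalemxAl -mulmxA -RM ?groupV // mulgV R1 mulmx1.
Qed.

(** The lines of the orbit correspond to the right cosets of the stabilizer. *)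
Lemma card_line_orbit a : a != 0 -> (#|line_stab a| * #|line_orbit a| = #|S|)%N.
Proof.
move=> a0; rewrite -(Lagrange (line_stab_sub a)); congr (_ * _)%N.
pose f (C : {set gT}) := <[a *m R (repr C)]>%VS.
have fE g : g \in S -> f (line_stab a :* g)%g = <[a *m R g]>%VS.
  by move=> Sg; rewrite /f; case: repr_rcosetP => x xa; apply: line_orbit_stab.
have <- : f @: rcosets (line_stab a) S = line_orbit a.
  apply/setP=> U; apply/imsetP/imsetP => [[C /rcosetsP[g Sg ->] ->] | [g Sg ->]].
    by exists g; rewrite // fE.
  by exists (line_stab a :* g)%g; rewrite ?fE // mem_rcosets mulSGid // line_stab_sub.
rewrite card_in_imset // => C D /rcosetsP[g Sg ->] /rcosetsP[h Sh ->].
rewrite !fE // => /(line_orbit_eq Sg Sh) gh.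
by apply/rcoset_eqP; rewrite mem_rcoset.
Qed.

Lemma line_orbit_move a y : y \in S -> line_orbit (a *m R y) = line_orbit a.
Proof.
move=> Sy; apply/setP=> U; apply/imsetP/imsetP => [] [g Sg ->].
  by exists (y * g)%g; rewrite ?groupM // RM // mulmxA.
exists (y^-1 * g)%g; first by rewrite groupM ?groupV.
by rewrite -mulmxA -RM ?groupM ?groupV // mulKVg.
Qed.

Lemma line_stab12 a : a != 0 -> #|line_orbit a| = 110%N -> #|line_stab a| = 12%N.
Proof.
move=> a0 o110; have := card_line_orbit a0; rewrite o110 (pres_card presS).
by rewrite -[1320%N]/(12 * 110)%N => /eqP; rewrite eqn_pmul2r // => /eqP.
Qed.

Hypothesis Rww : R (word u w ww) = 1%:M.

(** The stabilizers have order 12, and the elements of order 3 are conjugate to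
    powers of c^4. *)
Lemma orbit110_eigenvector a : a != 0 -> #|line_orbit a| = 110%N ->
  exists a' l, [/\ a' != 0, line_orbit a' = line_orbit a & a' *m R (c ^+ 4)%g = l *: a'].
Proof.
move=> a0 o110; have o12 := line_stab12 a0 o110.
have [y Sy] := stabilizer_conjugate presS (line_stab_sub a) o12.
have Sc4 : (c ^+ 4)%g \in S by rewrite groupX ?(word_mem presS).
rewrite mem_conjg => /line_stabP[_ [l al]].
exists (a *m R y), l; split; [exact: mulmx_row_neq0 | exact: line_orbit_move |].
rewrite scalemxAl -al -!mulmxA; congr (a *m _).
have Sc4y : (c ^+ 4 ^ y^-1)%g \in S by rewrite groupJ ?groupV.
by rewrite -(RM Sy Sc4) -(RM Sc4y Sy) conjgE invgK !mulgA mulgKV.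
Qed.

Section Eigenvector.
Variables (a : 'rV[F]_5) (l : F).
Hypotheses (a0 : a != 0) (o110 : #|line_orbit a| = 110%N) (al : a *m R (c ^+ 4)%g = l *: a).

Lemma scale_row_inj x y : x *: a = y *: a -> x = y.
Proof. by move/eqP; rewrite -subr_eq0 -scalerBl scaler_eq0 (negPf a0) orbF subr_eq0 => /eqP. Qed.

Lemma eigenvalueX k : a *m R ((c ^+ 4) ^+ k)%g = l ^+ k *: a.
Proof.
have Sc4 : (c ^+ 4)%g \in S by rewrite groupX ?(word_mem presS).
rewrite RX //; elim: k => [|k IHk]; first by rewrite mulmx1 scale1r.
by rewrite exprSr [_ *m (_ * _)]mulmxA IHk -scalemxAl al scalerA -exprSr.
Qed.

Lemma eigenvalue3 : l ^+ 3 = 1.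
Proof.
apply: scale_row_inj; rewrite -eigenvalueX -expgM.
by rewrite (pres_power12 presS) R1 mulmx1 scale1r.
Qed.

(** The stabilizer has order 12, like <[c]>, which does not contain the element
    that inverts c. *)
Lemma fixed_row_contradiction :
  a *m R c = a -> a *m R (word u w s_word) = a -> False.
Proof.
move=> ac as_; have stab x : x \in S -> a *m R x = a -> x \in line_stab a.
  by move=> Sx ax; apply: (line_stabI (l := 1)); rewrite // ax scale1r.
have stabE : <[c]>%g = line_stab a.
  apply/eqP; rewrite eqEcard cycle_subG stab ?(word_mem presS) //.
  by rewrite (line_stab12 a0 o110) -orderE (order_c presS).
by have := s_not_in_c presS; rewrite stabE stab ?(word_mem presS).
Qed.

(** The eigenvalue is a character of the stabilizer, so that a conjugate of c^4
    that is a power of c^4 has the same eigenvalue. As this eigenvalue has order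
    3, the conjugate is c^4 itself. *)
Lemma line_stab_c : l != 1 -> c \in line_stab a.
Proof.
move=> l1; have Sc4 : (c ^+ 4)%g \in S by rewrite groupX ?(word_mem presS).
have l0 : l != 0 by apply/eqP=> l0; have /eqP := eigenvalue3; rewrite l0 expr0n eq_sym oner_eq0.
have -> : line_stab a = <[c]>%g; last exact: cycle_id.
apply: (stabilizer_cyclic presS (line_stab_sub a) (line_stab12 a0 o110)).
- exact: line_stabI al.
- by apply: (line_stabI (l := 1)); rewrite ?(word_mem presS) // Rww mulmx1 scale1r.
move=> g k /line_stabP[Sg [m am]] gk.
have m0 : m != 0 by apply/eqP=> m0; have := mulmx_row_neq0 a0 Sg; rewrite am m0 scale0r eqxx.
have lk : l ^+ k = l.
  apply: scale_row_inj; apply: (scalerI m0); rewrite -eigenvalueX -gk.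
  rewrite scalemxAl -am -mulmxA -RM ?groupJ // -conjgC RM // mulmxA al.
  by rewrite -scalemxAl am !scalerA mulrC.
rewrite gk -(expg_mod_order (c ^+ 4)%g k) (order_c4 presS).
have : l ^+ (k %% 3) = l by rewrite -[RHS]lk; apply: expr_mod eigenvalue3.
have := ltn_pmod k (isT : (0 < 3)%N); case: (k %% 3)%N => [|[|[|]]] // _.
  by rewrite expr0 => l1'; rewrite -l1' eqxx in l1.
rewrite expr2 -{3}(mulr1 l) => /(mulfI l0) l1'.
by rewrite l1' eqxx in l1.
Qed.

End Eigenvector.
End LineOrbit.

Section LineOrbitModel.
Variables (gT : finGroupType) (S : {group gT}) (u w : gT).
Hypothesis presS : presented S u w.
Variables (F : finFieldType) (R : gT -> 'M[F]_5).
Hypotheses (R1 : R 1%g = 1%:M) (RM : {in S &, forall x y, R (x * y)%g = R x *m R y}).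
Hypothesis Rww : R (word u w ww) = 1%:M.

Local Notation c := (word u w c_word).

Variables (K : closedFieldType) (f : {rmorphism F -> K}) (t : K) (X : 'M[K]_5).
Hypotheses (t2 : t ^+ 2 + t + 3%:R = 0) (XU : X \in unitmx).
Hypothesis XE : forall om s,
  phim t om (generator_mat s) *m X = X *m map_mx f (R (gen u w s)).
Hypotheses (char2 : 2%:R != 0 :> K) (char3 : 3%:R != 0 :> K).

Lemma omega_exists : exists om : K, om ^+ 2 + om + 1 = 0.
Proof.
have [om om_root] : exists om : K, root (\poly_(i < 3) 1 : {poly K}) om.
  by apply/closed_rootP; rewrite size_poly_eq ?oner_neq0.
exists om; move: om_root; rewrite rootE horner_poly !big_ord_recr big_ord0 /= => /eqP <-.
by ring.
Qed.

Definition to_model (v : 'rV[F]_5) : 'rV[K]_5 := map_mx f v *m invmx X.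

Lemma to_model_inj : injective to_model.
Proof.
move=> v v' /(can_inj (mulmxKV XU)) vv'; apply/rowP=> i.
by move/rowP/(_ i): vv'; rewrite !mxE => /fmorph_inj.
Qed.

Lemma to_modelZ l v : to_model (l *: v) = f l *: to_model v.
Proof. by rewrite /to_model map_mxZ scalemxAl. Qed.

Lemma to_model_gen om v s :
  to_model (v *m R (gen u w s)) = to_model v *m phim t om (generator_mat s).
Proof.
rewrite /to_model map_mxM -!mulmxA; congr (_ *m _).
by apply: (can_inj (mulKmx XU)); rewrite !mulmxA mulmxV // mul1mx -(XE om) mulmxK.
Qed.

Lemma to_model_word om x v : roots t om ->
  to_model (v *m R (word u w x)) = to_model v *m phim t om (mat_word x).
Proof.
case=> _ om2; rewrite phim_word //; elim/last_ind: x v => [|x b IHx] v.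
  by rewrite [word _ _ _]/= R1 !mulmx1.
rewrite /word /mword !foldl_rcons -/(word u w x) -/(mword _ _ x).
rewrite RM ?(pres_mem presS) ?(word_mem presS) // mulmxA (to_model_gen om) IHx -mulmxA.
by case: b.
Qed.

Lemma to_model_cX om k v : roots t om ->
  to_model (v *m R (c ^+ k)%g) = to_model v *m phim t om (mat_word c_word) ^+ k.
Proof.
move=> tom; elim: k v => [|k IHk] v; first by rewrite expg0 R1 !mulmx1.
rewrite expgSr RM ?groupX ?(word_mem presS) // mulmxA (to_model_word _ _ tom) IHk.
by rewrite exprSr [in RHS]mulmxA.
Qed.

Variables (a : 'rV[F]_5) (l : F).
Hypotheses (a0 : a != 0) (o110 : #|line_orbit S R a| = 110%N) (al : a *m R (c ^+ 4)%g = l *: a).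

Lemma to_model_neq0 : to_model a != 0.
Proof.
apply: contra a0 => /eqP am0; apply/eqP/to_model_inj; rewrite am0.
by rewrite /to_model map_mx0 mul0mx.
Qed.

(** A vector fixed by c^4 is proportional to [fixed_row], whose line is too
    symmetric. *)
Lemma eigenvalue_neq1 : l != 1.
Proof.
have [om om2] := omega_exists; have tom : roots t om by [].
apply/eqP=> l1.
have [|b bE] := @fixed_by_c4 _ t om tom char2 char3 (to_model a).
  by rewrite -to_model_cX // al l1 scale1r.
apply: (fixed_row_contradiction presS R1 RM a0 o110); apply: to_model_inj.
  by rewrite (to_model_word _ _ tom) bE -scalemxAl fixed_row_c.
by rewrite (to_model_word _ _ tom) bE -scalemxAl fixed_row_s.
Qed.

(** The line is fixed by c, hence spanned by one of its five eigenvectors, and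
    not by [fixed_row]. Exchanging the two roots omega identifies the others in
    pairs. *)
Lemma orbit110_base_point : exists om v b, [/\ roots t om, v = point0 \/ v = point1,
  b != 0 & to_model a = b *: phiv t om v].
Proof.
have [om om2] := omega_exists; have tom : roots t om by [].
have [Sc [m am]] := line_stabP (line_stab_c presS R1 RM Rww a0 o110 al eigenvalue_neq1).
have aC : to_model a *m phim t om (mat_word c_word) = f m *: to_model a.
  by rewrite -to_model_word // am to_modelZ.
have [i [mE [b b0 bE]]] := eigenvector_of_c tom char2 char3 to_model_neq0 aC.
have om'2 : roots t (- 1 - om).
  by split=> //; rewrite -om2; ring.
have conjE v : phiv t om (vmap conj_omega v) = phiv t (- 1 - om) v.
  apply/rowP=> j; rewrite !mxE -phi_conj_omega; congr (phi _ _ _).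
  by case: v => v0 v1 v2 v3 v4; case: j => [] [|[|[|[|[|]]]]].
case: i mE bE => [] [|[|[|[|[|]]]]] // i5 mE bE.
- case/eqP: eigenvalue_neq1; apply: (scale_row_inj a0); rewrite -al scale1r.
  apply: to_model_inj; rewrite (to_model_cX _ _ tom) bE -scalemxAl.
  by rewrite (eigenvector_cXE tom (Ordinal i5)) /eigenvalue_c expr0 expr1n scale1r.
- by exists om, point0, b; split=> //; left.
- by exists (- 1 - om), point0, b; split; rewrite // -?conjE //; left.
- by exists om, point1, b; split=> //; right.
by exists (- 1 - om), point1, b; split; rewrite // -?conjE //; right.
Qed.

Lemma line_orbit_rep (i : nat) : <[a *m R (rep u w i)]>%VS \in line_orbit S R a.
Proof. by apply: imset_f; apply: rep_mem presS _. Qed.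

Lemma line_orbitE : line_orbit S R a = [set <[a *m R (rep u w i)]>%VS | i : 'I_110].
Proof.
have Sc k : (c ^+ k)%g \in S by rewrite groupX ?(word_mem presS).
apply/setP=> U; apply/imsetP/imsetP => [[g Sg ->] | [i _ ->]]; last first.
  by exists (rep u w i); rewrite ?(rep_mem presS).
have [k k12 [i i110 gE]] := decomposition presS Sg; exists (Ordinal i110) => //.
rewrite gE (line_orbit_stab R1 RM a0) ?(rep_mem presS) //.
apply: (@groupX _ (line_stab_group R1 RM a)).
exact: (line_stab_c presS R1 RM Rww a0 o110 al eigenvalue_neq1).
Qed.

Lemma line_rep_inj : injective (fun i : 'I_110 => <[a *m R (rep u w i)]>%VS).
Proof.
have /imset_injP : #|[set <[a *m R (rep u w i)]>%VS | i : 'I_110]| == #|'I_110|.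
  by rewrite -line_orbitE o110 card_ord.
by move=> inj i j; apply: inj.
Qed.

Lemma to_model_rep om v b i : roots t om -> to_model a = b *: phiv t om v ->
  to_model (a *m R (rep u w i)) = b *: phiv t om (nth v (orbit_points v) i).
Proof.
move=> tom aE; pose P x g := g \in S /\ to_model (a *m R g) = b *: phiv t om x.
have [] // : P (nth v (orbit_points v) i) (rep u w i).
apply: tree_rel => [|x g s [Sg gE]]; first by split; rewrite ?group1 // R1 mulmx1.
have Ss := pres_mem presS s; split; first exact: groupM.
by rewrite RM // mulmxA (to_model_gen om) gE -scalemxAl -phiv_mul //; case: tom.
Qed.

(** The determinant of the five points differs from that of the model by a
    nonzero factor. *)
Lemma singular_not_arc om v b test s k : roots t om -> b != 0 ->
  to_model a = b *: phiv t om v -> singular_set v test s ->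
  (forall x, test x -> phi t om x = 0) -> ~ is_arc k (line_orbit S R a).
Proof.
move=> tom b0 aE /and4P[/eqP s5 /allP s110 Us sing] test0.
have nth110 (i : 'I_5) : (nth 0%N s i < 110)%N by apply/s110/mem_nth; rewrite s5.
pose q (i : 'I_5) : 'I_110 := Ordinal (nth110 i).
have q_inj : injective q.
  move=> i j /(congr1 val)/= /eqP; rewrite nth_uniq ?s5 ?ltn_ord // => /eqP.
  exact: val_inj.
pose x i := a *m R (rep u w (q i)).
apply: (@not_arc _ _ _ x) => [i j ||].
- by move/(@line_rep_inj (q i) (q j))/q_inj.
- by move=> i; apply: line_orbit_rep.
pose P (i : 'I_5) := nth v (orbit_points v) (nth 0%N s i).
have xE : map_mx f (\matrix_i x i) *m invmx X =
    b *: phim t om (V5 (P 0) (P 1) (P (inord 2)) (P (inord 3)) (P (inord 4))).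
  apply/row_matrixP=> i; rewrite row_mul -map_row rowK -/(to_model _).
  rewrite (to_model_rep _ tom aE) [RHS]linearZ /= row_phim; congr (_ *: phiv _ _ _).
  by case: i => [] [|[|[|[|[|]]]]] // ? /=; rewrite /P ?inordK.
have P0 : phi t om (det5 (P 0) (P 1) (P (inord 2)) (P (inord 3)) (P (inord 4))) = 0.
  by apply: test0; move: sing; rewrite /P !inordK.
have [_ om2] := tom; have := congr1 determinant xE.
rewrite det_mulmx detZ (det_phim t2 om2) P0.
rewrite mulr0 det_map_mx => /eqP; rewrite mulf_eq0 fmorph_eq0 => /orP[/eqP //|].
by move: XU; rewrite -unitmx_inv unitmxE unitfE => /negPf ->.
Qed.

End LineOrbitModel.

Section QuotientRepresentation.
Variables (gT : finGroupType) (S : {group gT}) (u w : gT).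
Hypothesis presS : presented S u w.

Lemma commute_generators x : (forall s, commute x (gen u w s)) ->
  forall g, g \in S -> commute x g.
Proof.
move=> xs; apply: (generated_ind presS) => [|y s _ xy|y z _ _]; first exact: commute1.
  exact: commuteM.
exact: commuteM.
Qed.

Lemma ww_center : word u w ww \in 'Z(S)%g.
Proof.
apply/centerP; split; first exact: word_mem presS _.
apply: commute_generators => -[] /=.
  by rewrite /commute /word /= mul1g mulgA.
have : word u w (ww ++ u_word 1) = word u w (u_word 1 ++ ww) by apply: (word_rel presS).
by rewrite !word_cat (word_nseq _ _ 1) expg1.
Qed.

Variables (F : finFieldType) (rL : mx_representation F (S / 'Z(S))%G 5).

Definition lift_repr (g : gT) : 'M[F]_5 := rL (coset 'Z(S)%g g).
Local Notation R := lift_repr.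

Let S_norm g : g \in S -> g \in 'N('Z(S))%g.
Proof. by move=> Sg; apply: (subsetP (normal_norm (center_normal S))). Qed.

Let S_coset g : g \in S -> coset 'Z(S)%g g \in (S / 'Z(S))%G.
Proof. by move=> Sg; apply: mem_quotient. Qed.

Lemma lift_repr1 : R 1%g = 1%:M.
Proof. by rewrite /R morph1 repr_mx1. Qed.

Lemma lift_reprM : {in S &, forall x y, R (x * y)%g = R x *m R y}.
Proof.
by move=> x y Sx Sy; rewrite /R morphM ?S_norm // repr_mxM ?S_coset.
Qed.

Lemma lift_repr_center g : g \in 'Z(S)%g -> R g = 1%:M.
Proof. by move=> Zg; rewrite /R coset_id // repr_mx1. Qed.

Hypothesis irr : mx_irreducible rL.

(** If u acted trivially, then the images of (w u)^3 and w^2 would make w, and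
    thus the group, act trivially. *)
Lemma lift_repr_u : R u != 1%:M.
Proof.
have Ss s : gen u w s \in S := pres_mem presS s.
have Su : u \in S := Ss false; have Sw : w \in S := Ss true.
apply/eqP=> Ru1; have Rw2 : R w *m R w = 1%:M.
  by rewrite -lift_reprM // -(lift_repr_center ww_center) /word /= mul1g.
have Rw1 : R w = 1%:M.
  have wu3 : word u w (flatten (nseq 3 [:: true; false])) = 1%g.
    by apply: (word_rel presS (y := [::])).
  move: (congr1 R wu3); rewrite lift_repr1 /word /= mul1g !lift_reprM ?groupM //.
  by rewrite Ru1 !mulmx1 Rw2 mul1mx.
have Rs s : R (gen u w s) = 1%:M by case: s.
have triv g : g \in S -> R g = 1%:M.
  move: g; apply: (generated_ind presS) => [|x s Sx Rx|x y Sx Sy Rx Ry].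
  - exact: lift_repr1.
  - by rewrite lift_reprM // Rx Rs mulmx1.
  by rewrite lift_reprM // Rx Ry mulmx1.
have /mx_irrP[_ full] := irr; suff : row_full (delta_mx 0 0 : 'M[F]_5).
  by rewrite -col_leq_rank mxrank_delta.
apply: full.
  by apply/mxmoduleP=> x /morphimP[g Ng Sg ->]; rewrite -/(R g) triv // mulmx1.
by apply/eqP=> /matrixP/(_ 0 0); rewrite !mxE !eqxx => /eqP; rewrite oner_eq0.
Qed.

Variable a : 'rV[F]_5.
Hypotheses (char2 : 2%:R != 0 :> F) (char3 : 3%:R != 0 :> F) (char11 : 11%:R != 0 :> F).
Hypotheses (a0 : a != 0) (o110 : #|line_orbit S R a| = 110%N).

(** The representation becomes the model over an algebraic closure. *)
Theorem orbit110_classified :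
  (exists2 l : F, l ^+ 3 = 1 & l != 1) /\
  exists (K : closedFieldType) (f : {rmorphism F -> K}) (t om : K) v,
    [/\ roots t om, v = point0 \/ v = point1 &
      forall test s k, singular_set v test s -> (forall x, test x -> phi t om x = 0) ->
        ~ is_arc k (line_orbit S R a)].
Proof.
have Rww := lift_repr_center ww_center.
have [a' [l [a'0 a'o al]]] := orbit110_eigenvector presS lift_repr1 lift_reprM a0 o110.
have o110' : #|line_orbit S R a'| = 110%N by rewrite a'o.
have [K [f _]] := countable_algebraic_closure F.
have charK n : n%:R != 0 :> F -> n%:R != 0 :> K by rewrite -(rmorph_nat f) fmorph_eq0.
pose U := map_mx f (R u); pose W := map_mx f (R w).
have mwordE x : mword U W x = map_mx f (R (word u w x)).
  rewrite (R_word presS lift_repr1 lift_reprM) /mword.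
  elim/last_ind: x => [|x b IHx]; first by rewrite /= map_mx1.
  by rewrite !foldl_rcons IHx map_mxM; case: b.
have rel x y : (x, y) \in relations -> mword U W x = mword U W y.
  by move=> /(word_rel presS) xy; rewrite !mwordE xy.
have ww1 : mword U W ww = 1%:M by rewrite mwordE Rww map_mx1.
have U1 : U != 1%:M.
  by apply: contra lift_repr_u => /eqP U1; apply/eqP/(@map_mx_inj _ _ f); rewrite map_mx1.
have [t [t2 [X XU XE]]] := model_intertwiner (charK _ char11) rel ww1 U1.
have XE' om s : phim t om (generator_mat s) *m X = X *m map_mx f (R (gen u w s)).
  by rewrite XE; case: s.
have c2 := charK _ char2; have c3 := charK _ char3.
split.
  exists l; first exact: (eigenvalue3 presS lift_repr1 lift_reprM a'0 al).
  exact: (eigenvalue_neq1 presS lift_repr1 lift_reprM t2 XU XE' c2 c3 a'0 o110' al).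
have [om [v [b [tom vE b0 a'E]]]] :=
  orbit110_base_point presS lift_repr1 lift_reprM Rww t2 XU XE' c2 c3 a'0 o110' al.
exists K, f, t, om, v; split=> // test s k.
rewrite -a'o; move: tom b0 a'E.
exact: (singular_not_arc presS lift_repr1 lift_reprM Rww t2 XU XE' c2 c3 a'0 o110' al).
Qed.

End QuotientRepresentation.

(** * Fields without arcs *)

Section NoArc.
Variable F : finFieldType.
Hypotheses (char2 : 2%:R != 0 :> F) (char3 : 3%:R != 0 :> F) (char11 : 11%:R != 0 :> F).

Lemma transitive_arc_classified : has_PSL211_transitive_arc F 110 ->
  (exists2 l : F, l ^+ 3 = 1 & l != 1) /\
  exists (K : closedFieldType) (f : {rmorphism F -> K}) (t om : K) v,
    [/\ roots t om, v = point0 \/ v = point1 &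
      forall test s, singular_set v test s -> ~ forall x, test x -> phi t om x = 0].
Proof.
case=> A arcA [G [_ _ [rL irr imE] _ trans]]; have [sAP A110 _] := arcA.
have /imsetP[P AP orbP] := trans.
have dimP : \dim P = 1%N by have := subsetP sAP P AP; rewrite inE => /eqP.
have PE : P = <[vpick P]>%VS.
  apply/eqP; rewrite eq_sym eqEdim -memvE memv_pick dimP dim_vline vpick0.
  by rewrite -dimv_eq0 dimP.
have a0 : vpick P != 0 by rewrite vpick0 -dimv_eq0 dimP.
have AE : line_orbit (SL_group 2 'F_11) (lift_repr rL) (vpick P) = A.
  by rewrite [RHS]orbP -imE [in RHS]PE orbit_line.
have o110 : #|line_orbit (SL_group 2 'F_11) (lift_repr rL) (vpick P)| = 110%N.
  by rewrite AE.
have [cube [K [f [t [om [v [tom vE sing]]]]]]] :=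
  orbit110_classified SL11_presented irr char2 char3 char11 a0 o110.
split=> //; exists K, f, t, om, v; split=> // test s st test0.
by apply: (sing test s 110%N st test0); rewrite AE.
Qed.

(** For p congruent to 2 modulo 3 the equations l^3 = 1 and l^p = l give l = 1. *)
Lemma no_arc_without_cube_root p : #|F| = p -> (p %% 3 = 2)%N ->
  ~ has_PSL211_transitive_arc F 110.
Proof.
move=> Fp p3 /transitive_arc_classified[[l l3 l1] _].
have l0 : l != 0 by apply/eqP=> l0; move/eqP: l3; rewrite l0 expr0n eq_sym oner_eq0.
have := expf_card l; rewrite Fp (divn_eq p 3) p3 exprD mulnC exprM l3 expr1n mul1r expr2.
by rewrite -{3}(mulr1 l) => /(mulfI l0) l1'; rewrite l1' eqxx in l1.
Qed.

(** The value of tau is one of the two listed residues; a dependent five-set is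
    known for each of them and, for the second candidate orbit, in every
    characteristic. *)
Lemma no_arc_bad_prime p : p \in [pchar F] ->
  Z.of_nat p \in [seq q.1.1 | q <- singular_sets] -> ~ has_PSL211_transitive_arc F 110.
Proof.
move=> charF /mapP[[[q [r1 s1]] [r2 s2]] qs /= pE] /transitive_arc_classified[_].
case=> K [f [t [om [v [[t2 om2] vE sing]]]]].
have charK : p \in [pchar K] by rewrite (fmorph_pchar f).
have zr_eq0 x : divides q x -> zr K x = 0.
  move=> /Z.eqb_eq qx; apply: (dvd_zr charK); rewrite pE.
  apply/Z.mod_divide => // q0.
  by have := pcharf_prime charF; rewrite (_ : p = 0%N) //; move: pE; rewrite q0; lia.
case: vE sing => -> sing; last first.
  by apply: sing point1_singular _ => x /keqbP <-; rewrite phi_const zr0.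
have /and4P[r12 r12' sing1 sing2] := allP singular_sets_ok _ qs.
have vanish (r : Z) x : t = zr K r -> vanishes_at q r x -> phi t om x = 0.
  case: x => x0 x1 x2 x3 tE /andP[/zr_eq0 z01 /zr_eq0 z23].
  rewrite /phi /= tE; move: z01 z23; rewrite !zrD !zrM => z01 z23.
  by rewrite z01 add0r -mulrDl z23 mul0r.
have : (t - zr K r1) * (t - zr K r2) = 0.
  have := zr_eq0 _ r12; have := zr_eq0 _ r12'; rewrite !zrE => m12 s12.
  have c3 : zr K (Zpos 3%positive) = 3%:R by [].
  transitivity (t ^+ 2 + t + 3%:R - (zr K r1 + zr K r2 + 1) * t + (zr K r1 * zr K r2 - 3%:R)).
    by ring.
  by rewrite t2 s12 -c3 m12 mul0r subrr addr0.
move/eqP; rewrite mulf_eq0 !subr_eq0 => /orP[]/eqP tE.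
  by apply: sing sing1 _ => x; apply: vanish.
by apply: sing sing2 _ => x; apply: vanish.
Qed.

End NoArc.

(** * The representation carried by the orbit *)

Definition step_check (s : bool) (i : nat) : bool :=
  let pts := orbit_points point0 in
  veqb (vmul (nth point0 pts i) (generator_mat s))
       (vmap (kmul (nth (kconst 1) omega_powers (coset_exponent s i %% 3)))
             (nth point0 pts (nth 0%N (generator_perm s) i))).

Lemma steps_ok s : all (step_check s) (iota 0 110).
Proof. by case: s; rewrite /step_check /coset_exponent transversal2E; vm_compute. Qed.

Lemma tree_head (A : Type) (step : A -> bool -> A) a : nth a (tree step a) 0 = a.
Proof.
rewrite /tree; have : nth a [:: a] 0 = a by [].
have : (0 < size [:: a])%N by [].
elim: parents [:: a] => [|q qs IHq] l //= l0 la.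
by apply: IHq; rewrite ?size_rcons // nth_rcons l0.
Qed.

Section OrbitRepresentation.
Variables (gT : finGroupType) (S : {group gT}) (u w : gT).
Hypothesis presS : presented S u w.
Variables (F : finFieldType) (t om : F).
Hypothesis tom : roots t om.

Local Notation c := (word u w c_word).
Local Notation T := (rep u w).

Definition point (i : nat) : 'rV[F]_5 := phiv t om (nth point0 (orbit_points point0) i).

Lemma decomposition_uniq k l i j : (i < 110)%N -> (j < 110)%N ->
  (c ^+ k * T i = c ^+ l * T j)%g -> i = j /\ (k = l %[mod 12])%N.
Proof.
move=> i110 j110 eq_g; have ij : i = j.
  apply: (pres_conj presS) => //.
  have conjE (n : nat) x : (c ^ (c ^+ n * x) = c ^ x)%g.
    by rewrite conjgM; congr (_ ^ x)%g; apply/conjg_fixP/commgP/commuteX.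
  by rewrite -(conjE k) eq_g conjE.
split=> //; move: eq_g; rewrite ij => /mulIg/eqP.
by rewrite eq_expg_mod_order (order_c presS) => /eqP.
Qed.

(** The vector to which a group element moves the base vector. *)
Definition orbit_vector (g : gT) : 'rV[F]_5 :=
  if [pick ki : 'I_12 * 'I_110 | g == (c ^+ ki.1 * T ki.2)%g] is Some ki
  then om ^+ ki.1 *: point ki.2 else 0.

Lemma orbit_vectorE k i : (i < 110)%N -> orbit_vector (c ^+ k * T i)%g = om ^+ k *: point i.
Proof.
move=> i110; rewrite /orbit_vector; case: pickP => [[l j] /= /eqP eq_g | none].
  have [-> kl] := decomposition_uniq i110 (ltn_ord j) eq_g.
  have om12 : om ^+ 12 = 1 by rewrite -[12%N]/(3 * 4)%N exprM (cube_omega tom) expr1n.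
  by rewrite -(expr_mod k om12) kl expr_mod.
have k12 : (k %% 12 < 12)%N by apply: ltn_pmod.
have := none (Ordinal k12, Ordinal i110); rewrite /= -{1}(order_c presS) expg_mod_order.
by rewrite eqxx.
Qed.

Lemma orbit_vector_rep i : (i < 110)%N -> orbit_vector (T i) = point i.
Proof. by move=> i110; rewrite -[T i]mul1g -(expg0 c) orbit_vectorE // scale1r. Qed.

Lemma orbit_vector_c k g : g \in S -> orbit_vector (c ^+ k * g)%g = om ^+ k *: orbit_vector g.
Proof.
case/(decomposition presS)=> l _ [i i110 ->].
by rewrite mulgA -expgD !orbit_vectorE // scalerA -exprD.
Qed.

Lemma orbit_vector_gen g s : g \in S ->
  orbit_vector (g * gen u w s)%g = orbit_vector g *m phim t om (generator_mat s).
Proof.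
case/(decomposition presS)=> k _ [i i110 ->].
have [t2 om2] := tom; have j110 : (nth 0%N (generator_perm s) i < 110)%N.
  by have := @act_lt s i; case: s; apply.
rewrite -mulgA (pres_step presS) // mulgA -expgD !orbit_vectorE // -scalemxAl.
have i_in : i \in iota 0 110 by rewrite mem_iota.
have := veqbP (allP (steps_ok s) i i_in); rewrite /point -phiv_mul // => ->.
rewrite phiv_scale // scalerA exprD; congr (_ * _ *: _).
rewrite -(expr_mod _ (cube_omega tom)); have := ltn_pmod (coset_exponent s i) (isT : (0 < 3)%N).
case: (coset_exponent s i %% 3)%N => [|[|[|]]] // _; rewrite /phi /=.
- by rewrite zr0 zr1; ring.
- by rewrite zr0 zr1; ring.
rewrite -[Z.neg 1]/(Z.opp 1) zrN zr0 zr1; apply/eqP; rewrite -subr_eq0; apply/eqP.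
by rewrite -[RHS]om2; ring.
Qed.

Hypothesis independent5 : \matrix_(i < 5) point i \in unitmx.

(** The matrix that moves the vectors of the orbit as g does, computed from five
    independent ones. *)
Definition orbit_repr (g : gT) : 'M[F]_5 :=
  invmx (\matrix_(i < 5) point i) *m \matrix_(i < 5) orbit_vector (T i * g)%g.

Local Notation R := orbit_repr.

Lemma orbit_repr_uniq g N :
  (forall h, h \in S -> orbit_vector h *m N = orbit_vector (h * g)%g) -> R g = N.
Proof.
move=> gN; have rowE i : (i < 5)%N -> orbit_vector (T i * g)%g = point i *m N.
  move=> i5; rewrite -gN ?(rep_mem presS) // orbit_vector_rep //.
  exact: leq_trans i5 _.
have -> : R g = invmx (\matrix_(i < 5) point i) *m ((\matrix_(i < 5) point i) *m N).
  by congr (_ *m _); apply/row_matrixP=> i; rewrite row_mul !rowK rowE.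
exact: mulKmx.
Qed.

(** The products of generators act on all vectors of the orbit by some matrix,
    which the five independent ones determine. *)
Lemma orbit_vectorM g h : g \in S -> h \in S -> orbit_vector h *m R g = orbit_vector (h * g)%g.
Proof.
move=> Sg; move: g Sg h; apply: (generated_ind presS) => [|g s Sg IHg|x y Sx Sy IHx IHy] h Sh.
- by rewrite (@orbit_repr_uniq _ 1%:M) ?mulmx1 ?mulg1 // => h' _; rewrite mulmx1 mulg1.
- rewrite (@orbit_repr_uniq _ (R g *m phim t om (generator_mat s))).
    by rewrite mulmxA IHg // -orbit_vector_gen ?groupM // mulgA.
  by move=> h' Sh'; rewrite mulmxA IHg // -orbit_vector_gen ?groupM // mulgA.
rewrite (@orbit_repr_uniq _ (R x *m R y)).
  by rewrite mulmxA IHx // IHy ?groupM // mulgA.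
by move=> h' Sh'; rewrite mulmxA IHx // IHy ?groupM // mulgA.
Qed.

Lemma orbit_reprM : {in S &, forall x y, R (x * y)%g = R x *m R y}.
Proof.
move=> x y Sx Sy; apply: orbit_repr_uniq => h Sh.
by rewrite mulmxA !orbit_vectorM ?groupM // mulgA.
Qed.

Lemma orbit_repr1 : R 1%g = 1%:M.
Proof. by apply: orbit_repr_uniq => h Sh; rewrite mulmx1 mulg1. Qed.

Lemma orbit_repr_gen s : R (gen u w s) = phim t om (generator_mat s).
Proof. by apply: orbit_repr_uniq => h Sh; rewrite orbit_vector_gen. Qed.

Lemma orbit_repr_c : R c = phim t om (mat_word c_word).
Proof.
have [t2 om2] := tom.
rewrite (R_word presS orbit_repr1 orbit_reprM) phim_word //.
by rewrite -[R u]/(R (gen u w false)) -[R w]/(R (gen u w true)) !orbit_repr_gen.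
Qed.

Hypotheses (char2 : 2%:R != 0 :> F) (char3 : 3%:R != 0 :> F).

Hypothesis point_inj : injective (fun i : 'I_110 => <[point i]>%VS).
Hypothesis card_neq0 : #|S|%:R != 0 :> F.

Lemma point0E : point 0 = eigenvector_c t om 1.
Proof. by rewrite /point /orbit_points tree_head. Qed.

Lemma om_neq0 : om != 0. Proof. exact: omega_neq0 tom. Qed.

Lemma orbit_vector1 : orbit_vector 1%g = point 0.
Proof. by rewrite -(orbit_vector_rep (isT : (0 < 110)%N)). Qed.

Lemma orbit_line_eq g i : g \in S -> (i < 110)%N -> <[orbit_vector g]>%VS = <[point i]>%VS ->
  exists k, g = (c ^+ k * T i)%g.
Proof.
move=> Sg i110; have [k _ [j j110 gE]] := decomposition presS Sg.
rewrite gE orbit_vectorE // line_scale ?expf_neq0 ?om_neq0 //.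
by move/(@point_inj (Ordinal j110) (Ordinal i110))/(congr1 val)=> /= <-; exists k.
Qed.

(** For g = c^k the scalar is the common k-th power of the five eigenvalues of
    c, among them 1 and a primitive sixth root of unity. *)
Lemma orbit_repr_scalar g l : g \in S -> R g = l%:M -> g \in 'Z(S)%g.
Proof.
move=> Sg Rl; have S1 : 1%g \in S := group1 S.
have Rg := R_unit orbit_repr1 orbit_reprM Sg.
have l0 : l != 0 by apply/eqP=> l0; move: Rg; rewrite Rl l0 raddf0 unitmxE det0 unitr0.
have [|k gE] := @orbit_line_eq g 0 Sg isT.
  by rewrite -(mul1g g) -orbit_vectorM // Rl mul_mx_scalar line_scale // orbit_vector1.
rewrite [T 0]/(1%g : gT) mulg1 in gE.
have Ck : phim t om (mat_word c_word) ^+ k = l%:M.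
  by rewrite -orbit_repr_c -(RX orbit_repr1 orbit_reprM) ?(word_mem presS) // -gE.
have eigenl (i : 'I_5) : eigenvalue_c om i ^+ k = l.
  have ei0 : eigenvector_c t om i != 0.
    rewrite -(row_eigenvectors t om i) unitmx_row_neq0 //.
    exact: eigenvectors_unit tom char2 char3.
  apply/eqP; rewrite -subr_eq0; have /eqP := eigenvector_cXE tom i k.
  rewrite Ck mul_mx_scalar -subr_eq0 -scalerBl scaler_eq0 (negPf ei0) orbF.
  by rewrite !subr_eq0 eq_sym.
have k6 : (6 %| k)%N.
  rewrite (prim_order_dvd (primitive_root6 tom char2 char3)); apply/eqP.
  have := eigenl 0; rewrite /eigenvalue_c /= expr0 expr1n => ->.
  exact: (eigenl ord_max).
have /dvdnP[m mE] := k6; rewrite gE mE mulnC expgM groupX // (c6 presS).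
exact: ww_center presS.
Qed.

Lemma orbit_repr_center g : g \in 'Z(S)%g -> R g = 1%:M.
Proof.
move=> Zg; have /centerP[Sg cg] := Zg.
have Sc4 : (c ^+ 4)%g \in S by rewrite groupX ?(word_mem presS).
have /cycleP[k gE] := centralizer_c4 presS Sg (cg _ Sc4).
(* A central power of c equals its inverse, as some element inverts c. *)
have k6 : (6 %| k)%N.
  have Ss := word_mem presS s_word; set s := word u w s_word in Ss *.
  have csc : (c * s * c)%g = s.
    have : word u w (c_word ++ s_word ++ c_word) = s by apply: (word_rel presS).
    by rewrite !word_cat mulgA.
  have csck n : (c ^+ n * s * c ^+ n)%g = s.
    elim: n => [|n IHn]; first by rewrite !expg0 mul1g mulg1.
    by rewrite {1}expgS expgSr -[RHS]csc -{2}IHn !mulgA.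
  have : (s * c ^+ (k + k))%g = s by rewrite expgD mulgA -gE -(cg s Ss) gE csck.
  rewrite -{2}(mulg1 s) => /mulgI/eqP; rewrite -order_dvdn (order_c presS) addnn -muln2.
  by rewrite -[12%N]/(6 * 2)%N dvdn_pmul2r.
have /dvdnP[m mE] := k6; apply: orbit_repr_uniq => h Sh.
rewrite mulmx1 -(cg h Sh) gE orbit_vector_c // mE (_ : om ^+ (m * 6) = 1) ?scale1r //.
by rewrite -[6%N]/(3 * 2)%N mulnC -mulnA exprM (cube_omega tom) expr1n.
Qed.

Lemma orbit_repr_mx_repr : mx_repr S R.
Proof. by split; [exact: orbit_repr1 | exact: orbit_reprM]. Qed.

Definition orbit_mx_repr : mx_representation F S 5 := MxRepresentation orbit_repr_mx_repr.

Lemma module_of_point (W : 'M[F]_5) : mxmodule orbit_mx_repr W -> (point 0 <= W)%MS ->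
  row_full W.
Proof.
move=> /mxmoduleP modW V0W.
have VW i : (i < 110)%N -> (point i <= W)%MS.
  move=> i110; rewrite -orbit_vector_rep // -(mul1g (T i)).
  rewrite -orbit_vectorM ?(rep_mem presS) ?group1 // orbit_vector1.
  apply: submx_trans (modW (T i) _); first exact: submxMr.
  exact: rep_mem presS _.
rewrite -sub1mx; apply: (@submx_trans _ _ _ _ _ _ (\matrix_(i < 5) point i)).
  by rewrite sub1mx row_full_unit.
by apply/row_subP=> i; rewrite rowK VW // (leq_trans (ltn_ord i)).
Qed.

(** By complete reducibility the base point, which spans an eigenspace of c,
    lies in a given submodule or in a complement. *)
Lemma orbit_repr_irr : mx_irreducible orbit_mx_repr.
Proof.
apply/mx_irrP; split=> // U modU U0.
have F'S : ([pchar F]^'.-group S)%g by rewrite /pgroup pcharf'_nat.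
have [W modW UW dxUW] := mx_Maschke_pchar orbit_mx_repr F'S modU (submx1 U).
have /sub_addsmxP[[x y] /= xyE] : (point 0 <= U + W)%MS by rewrite UW submx1.
have Sc : c \in S := word_mem presS c_word.
have vC (v : 'rV[F]_5) : v *m R c = om *: v -> exists a, v = a *: point 0.
  have [-> _|v0] := eqVneq v 0; first by exists 0; rewrite scale0r.
  rewrite orbit_repr_c => /(eigenvector_of_c tom char2 char3 v0)[i [omE [a _ ->]]].
  exists a; rewrite point0E; congr (_ *: eigenvector_c t om _).
  apply: (eigenvalue_c_inj tom char2 char3); rewrite ?inE //= -omE /eigenvalue_c /=.
  by rewrite exprNn -signr_odd mul1r -[4%N]/(3 + 1)%N exprD (cube_omega tom) mul1r expr1.
have pC : point 0 *m R c = om *: point 0.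
  rewrite -orbit_vector1 orbit_vectorM ?group1 // mul1g -(mulg1 c) -{1}(expg1 c).
  by rewrite orbit_vector_c ?group1.
have split0 : (x *m U) *m R c - om *: (x *m U) = 0 /\ (y *m W) *m R c - om *: (y *m W) = 0.
  have /mxmoduleP/(_ c Sc) cU := modU; have /mxmoduleP/(_ c Sc) cW := modW.
  set p := _ - _; set q := y *m W *m R c - _.
  have pU : (p <= U)%MS.
    rewrite addmx_sub ?eqmx_opp ?scalemx_sub ?submxMl // -mulmxA.
    exact: submx_trans (submxMl _ _) cU.
  have qW : (q <= W)%MS.
    rewrite addmx_sub ?eqmx_opp ?scalemx_sub ?submxMl // -mulmxA.
    exact: submx_trans (submxMl _ _) cW.
  have pq : p + q = 0.
    rewrite /p /q addrACA -mulmxDl -opprD -scalerDr -xyE pC subrr.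
    by [].
  have p0 : p = 0.
    apply/eqP; rewrite -submx0 -(mxdirect_addsP dxUW) sub_capmx pU.
    by rewrite (_ : p = - q) ?eqmx_opp //; apply/eqP; rewrite -addr_eq0 pq.
  by split=> //; move: pq; rewrite p0 add0r.
have [a xE] : exists a, x *m U = a *: point 0.
  by apply: vC; apply/eqP; rewrite -subr_eq0 split0.1.
have [a0 | a0] := eqVneq a 0; last first.
  by apply: module_of_point modU _; rewrite -(scalerK a0 (point 0)) -xE scalemx_sub ?submxMl.
have W1 : row_full W.
  by apply: module_of_point modW _; rewrite xyE xE a0 scale0r add0r submxMl.
case/eqP: U0; apply/eqP; rewrite -submx0 -(mxdirect_addsP dxUW) sub_capmx submx_refl.
by rewrite submx_full.
Qed.

Lemma center_sub_rker : 'Z(S)%g \subset rker orbit_mx_repr.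
Proof.
apply/subsetP=> g Zg; apply/rkerP; split; first exact: (subsetP (center_sub S)).
exact: orbit_repr_center.
Qed.

Definition quotient_repr : mx_representation F (S / 'Z(S))%G 5 :=
  quo_repr center_sub_rker (normal_norm (center_normal S)).

Lemma quotient_repr_coset g : g \in S -> quotient_repr (coset 'Z(S)%g g) = R g.
Proof. exact: quo_repr_coset. Qed.

Lemma quotient_repr_irr : mx_irreducible quotient_repr.
Proof. by apply/quo_mx_irr; apply: orbit_repr_irr. Qed.

Lemma quotient_repr_scalar x l : x \in (S / 'Z(S))%g -> quotient_repr x = l%:M -> x = 1%g.
Proof.
case/morphimP=> g Ng Sg ->; rewrite quotient_repr_coset // => /orbit_repr_scalar Zg.
exact: coset_id (Zg Sg).
Qed.

Lemma orbit_lines : [set <[point 0 *m lift_repr quotient_repr g]>%VS | g in S] =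
  [set <[point i]>%VS | i : 'I_110].
Proof.
apply/setP=> P; apply/imsetP/imsetP => [[g Sg ->] | [i _ ->]].
  rewrite /lift_repr quotient_repr_coset // -orbit_vector1 orbit_vectorM ?group1 // mul1g.
  have [k _ [i i110 ->]] := decomposition presS Sg; exists (Ordinal i110) => //.
  by rewrite orbit_vectorE // line_scale ?expf_neq0 ?om_neq0.
exists (T i); first exact: rep_mem presS _.
rewrite /lift_repr quotient_repr_coset ?(rep_mem presS) // -orbit_vector1.
by rewrite orbit_vectorM ?group1 ?(rep_mem presS) // mul1g orbit_vector_rep.
Qed.

End OrbitRepresentation.

(** * Existence of the arc *)

Section FieldOfOrderPSquare.
Variables (F : finFieldType) (p : nat).
Hypotheses (pP : prime p) (cardF : #|F| = (p ^ 2)%N) (p3 : (p %% 3 = 2)%N).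

Lemma pchar_square : p \in [pchar F].
Proof. exact: card_finPcharP cardF pP. Qed.

Lemma nat_neq0 n : (0 < n < p)%N -> n%:R != 0 :> F.
Proof.
case/andP=> n0 np; rewrite -(dvdn_pcharf pchar_square).
by apply: contraL np => /dvdn_leq; rewrite -leqNgt => ->.
Qed.

Lemma primitive_element : exists2 z : F, (p ^ 2).-1.-primitive_root z &
  forall x, x != 0 -> exists k, x = z ^+ k.
Proof.
have /cyclicP[g gE] := field_unit_group_cyclic [set: {unit F}]%G.
have og : #[g]%g = (p ^ 2).-1 by rewrite orderE -gE card_finField_unit cardF.
exists (FinRing.uval g) => [|x x0].
  have n0 : (0 < (p ^ 2).-1)%N by rewrite -og order_gt0.
  have gX n : (FinRing.uval g ^+ n == 1) = ((p ^ 2).-1 %| n)%N.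
    by rewrite -og order_dvdn -FinRing.val_unitX -[1 in LHS]FinRing.val_unit1 val_eqE.
  have gn : FinRing.uval g ^+ (p ^ 2).-1 = 1 by apply/eqP; rewrite gX.
  have [m mP _] := prim_order_exists n0 gn.
  suff <- : m = (p ^ 2).-1 by [].
  apply/eqP; rewrite eqn_dvd -gX (prim_order_dvd mP) gn eqxx.
  by rewrite (prim_expr_order mP) eqxx.
have xU : x \is a GRing.unit by rewrite unitfE.
have /cycleP[k kE] : (FinRing.unit _ xU : {unit F}) \in <[g]>%g by rewrite -gE inE.
by exists k; rewrite -FinRing.val_unitX -kE.
Qed.

Lemma omega_in_square : exists om : F, om ^+ 2 + om + 1 = 0.
Proof.
have [z zP _] := primitive_element.
have three : (3 %| (p ^ 2).-1)%N.
  by rewrite -subn1 -eqn_mod_dvd ?expn_gt0 ?prime_gt0 // -modnXm p3.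
have omP := dvdn_prim_root zP three; set om := z ^+ _ in omP.
exists om; have om1 : om != 1.
  by have := eq_prim_root_expr omP 1 0; rewrite expr0 expr1 => ->.
apply: (mulfI (_ : om - 1 != 0)); first by rewrite subr_eq0.
rewrite mulr0; transitivity (om ^+ 3 - 1); first by ring.
by rewrite (prim_expr_order omP) subrr.
Qed.

(** In a cyclic group of order (p - 1) (p + 1), the equation a^(p-1) = 1 makes
    the exponent of a divisible by p + 1, which is even. *)
Lemma sqrt_in_square (a : F) : odd p -> a != 0 -> a ^+ p = a -> exists b, b ^+ 2 = a.
Proof.
move=> oddp a0 ap; have [z zP gen_z] := primitive_element; have [k kE] := gen_z a a0.
have p0 := prime_gt0 pP.
have p21 : ((p ^ 2).-1 = p.+1 * p.-1)%N.
  by rewrite -!subn1 -[(p ^ 2 - 1)%N]/(p ^ 2 - 1 ^ 2)%N subn_sqr addn1 mulnC.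
have : ((p ^ 2).-1 %| k * p.-1)%N.
  rewrite (prim_order_dvd zP) exprM -kE; apply/eqP; apply: (mulfI a0).
  by rewrite -exprS prednK // ap mulr1.
have p1 : (0 < p.-1)%N by rewrite -subn1 subn_gt0 prime_gt1.
rewrite p21 dvdn_pmul2r // => p1k.
have /dvdnP[j jE] : (2 %| k)%N by apply: dvdn_trans p1k; rewrite dvdn2 /= oddp.
by exists (z ^+ j); rewrite kE jE exprM.
Qed.

Hypothesis p_gt11 : (11 < p)%N.

Lemma tau_in_square : exists t : F, t ^+ 2 + t + 3%:R = 0.
Proof.
have oddp : odd p by have [p2|//] := even_prime pP; move: p_gt11; rewrite p2.
have char11 : 11%:R != 0 :> F by apply: nat_neq0.
have char2 : 2%:R != 0 :> F by apply: nat_neq0; rewrite (leq_trans _ p_gt11).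
have [||b bE] := @sqrt_in_square (- 11%:R) oddp; first by rewrite oppr_eq0.
  by rewrite exprNn -signr_odd oddp expr1 mulN1r -(pFrobenius_autE pchar_square) rmorph_nat.
exists ((b - 1) / 2%:R); apply: (mulfI (_ : 4%:R != 0 :> F)).
  by rewrite (natrM _ 2 2) mulf_neq0.
transitivity (b ^+ 2 + 11%:R); last by rewrite bE addNr mulr0.
by field.
Qed.

End FieldOfOrderPSquare.

Section ProjectiveImage.
Variables (F : finFieldType) (rL : mx_representation F (PSL 2 'F_11) 5).
Hypothesis faithful : forall x l, x \in PSL 2 'F_11 -> rL x = l%:M -> x = 1%g.

Lemma projective_image_isog : projective_image rL \isog PSL 2 'F_11.
Proof.
have inj : ('injm (reprGLm rL))%g.
  rewrite ker_reprGLm; apply/subsetP=> x /rkerP[Lx x1].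
  by rewrite inE (faithful Lx x1).
rewrite isog_sym; apply: isog_trans (sub_isog (subxx _) inj) _.
apply: quotient_isog.
  by apply: subset_trans (normal_norm (center_normal _)); apply/subsetP=> g _; rewrite inE.
apply/trivgP/subsetP=> y /setIP[Zy /morphimP[x Lx _ yE]].
have [l _] := center_GL_scalar Zy; rewrite yE => xl.
rewrite inE; apply/eqP; rewrite (@faithful x l Lx) ?morph1 //.
by rewrite -xl val_reprGLm.
Qed.

Lemma projective_image_sub : projective_image rL \subset PGL 5 F.
Proof. by apply: quotientS; apply/subsetP=> g _; rewrite inE. Qed.

Lemma projective_image_dom : projective_image rL \subset act_dom (PGL_vspace_action F).
Proof. by apply: quotientS; apply: subsetT. Qed.

Lemma transitive_of_orbit v A : mx_irreducible rL ->
  [set <[v *m rep_SL rL g]>%VS | g in SL 2 'F_11] = A -> PSL211_transitive A.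
Proof.
move=> irr AE.
have orbA : orbit (PGL_vspace_action F) (projective_image rL) <[v]>%VS = A.
  by rewrite orbit_line.
exists [group of projective_image rL]; split.
- exact: projective_image_sub.
- exact: projective_image_isog.
- by exists rL.
- by rewrite -orbA acts_orbit // projective_image_dom.
by rewrite -orbA; apply: atrans_orbit.
Qed.

End ProjectiveImage.

Section ExistenceOfArc.
Variables (F : finFieldType) (p : nat).
Hypotheses (pP : prime p) (cardF : #|F| = (p ^ 2)%N) (p3 : (p %% 3 = 2)%N).
Hypotheses (p_ge : (311 <= p)%N) (p_bound : ~ Z.divide (Z.of_nat p) content_bound).

(** A vanishing value would have a content divisible by p, which is at least 311
    and does not divide [content_bound]. *)
Lemma allowed_content_neq0 (t om : F) x : roots t om ->
  allowed_content (content_norm x) -> phi t om x != 0.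
Proof.
move=> [t2 om2] allowed; apply/eqP=> x0.
have := content_norm_dvd (pchar_square pP cardF) t2 om2 p3 x0.
move: allowed; rewrite /allowed_content; case: Z.ltb_spec0 => // g0.
case: Z.ltb_spec0 => [g311 _ | _ /Z.eqb_eq g_bound] p_g.
  have := Z.divide_pos_le _ _ g0 p_g.
  have : Z.le (Zpos 311%positive) (Z.of_nat p) by lia.
  by lia.
apply: p_bound; apply: Z.divide_trans p_g _; apply/Z.mod_divide => // g_0.
by move: g0; rewrite g_0.
Qed.

Lemma five_points_unit (t om : F) (s : 5.-tuple 'I_110) : roots t om -> uniq s ->
  \matrix_(i < 5) point t om (tnth s i) \in unitmx.
Proof.
move=> tom Us; rewrite -unitmx_tr unitmxE unitfE; apply/negP=> /det0P[h h0 hM].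
have sym : symmetries (orbit_points point0).
  by have /and4P[su sw sk sr] := symmetries_ok; split; apply: symmetryP.
have lev r : (r < 10)%N -> level_check (orbit_points point0) r.
  by move=> r10; apply: (allP levels_ok); rewrite mem_iota.
apply: (independent_points sym lev allowed_content_neq0 (s := map val s)).
- by apply/allP=> _ /mapP[i _ ->]; apply: ltn_ord.
- by rewrite map_inj_uniq //; apply: val_inj.
- by rewrite size_map size_tuple.
exists t, om; split=> //; exists h^T; first by rewrite trmx_eq0.
move=> _ /mapP[i si ->]; have /tnthP[j ->] := si.
move/rowP/(_ j): hM; rewrite [LHS]mxE [RHS]mxE => hj.
apply/rowP=> k; rewrite ord1 [LHS]mxE [RHS]mxE -[RHS]hj.
by apply: eq_bigr => l _; rewrite !mxE mulrC.
Qed.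

Theorem arc_in_square : has_PSL211_transitive_arc F 110.
Proof.
have p11 : (11 < p)%N by rewrite (leq_trans _ p_ge).
have [om om2] := omega_in_square pP cardF p3.
have [t t2] := tau_in_square pP cardF p11; have tom : roots t om by [].
have char2 : 2%:R != 0 :> F by rewrite (nat_neq0 pP cardF) // (leq_trans _ p11).
have char3 : 3%:R != 0 :> F by rewrite (nat_neq0 pP cardF) // (leq_trans _ p11).
have card_neq0 : #|SL_group 2 'F_11|%:R != 0 :> F.
  rewrite (pres_card SL11_presented) -[1320%N]/(24 * 55)%N natrM.
  by rewrite mulf_neq0 // (nat_neq0 pP cardF) // (leq_trans _ p_ge).
have [//|s|arcA inj] := @arc_of_independent F 110 (fun i => point t om i).
  exact: five_points_unit.
have ind5 : \matrix_(i < 5) point t om i \in unitmx.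
  pose f (i : 'I_5) : 'I_110 := widen_ord (isT : (5 <= 110)%N) i.
  have Us : uniq [tuple f i | i < 5].
    by rewrite /= map_inj_uniq ?enum_uniq // => i j /(congr1 val) /= /val_inj.
  have := five_points_unit tom Us.
  rewrite (_ : \matrix_i _ = \matrix_(i < 5) point t om i) //.
  by apply/row_matrixP=> i; rewrite !rowK tnth_mktuple.
exists [set <[point t om i]>%VS | i : 'I_110] => //.
apply: (@transitive_of_orbit F
  (quotient_repr SL11_presented tom ind5) _ (point t om 0)).
- exact: (quotient_repr_scalar char2 char3 inj).
- exact: (quotient_repr_irr SL11_presented tom ind5 char2 char3 card_neq0).
exact: (orbit_lines SL11_presented tom ind5).
Qed.

End ExistenceOfArc.

(** * The primes congruent to 2 modulo 3 *)

(** A product of primes congruent to 0 or 1 modulo 3 is congruent to 0 or 1. *)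
Lemma prime_divisor_mod3 n : (n %% 3 = 2)%N -> exists2 q, prime q & (q %| n)%N /\ (q %% 3 = 2)%N.
Proof.
have [m] := ubnP n; elim: m n => // m IHm n /ltnSE-le_nm n3.
have n1 : (1 < n)%N by case: n n3 {le_nm} => [|[|]].
have qP := pdiv_prime n1; have qn := pdiv_dvd n; set q := pdiv n in qP qn.
have /dvdnP[k nE] := qn; have := ltn_pmod q (isT : (0 < 3)%N).
case qE : (q %% 3)%N => [|[|[|]]] // _; last by exists q.
  by move: n3; rewrite nE -modnMmr qE muln0.
have k3 : (k %% 3 = 2)%N by move: n3; rewrite nE -modnMmr qE muln1.
have lt_kn : (k < n)%N.
  rewrite nE ltn_Pmulr ?prime_gt1 //.
  by case: (k) k3.
have [q' q'P [q'k q'3]] := IHm k (leq_trans lt_kn le_nm) k3.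
by exists q' => //; split=> //; rewrite nE dvdn_mulr.
Qed.

(** Euclid's argument applied to 3 M! - 1. *)
Lemma large_prime_mod3 M : exists2 p, (M < p)%N & prime p /\ (p %% 3 = 2)%N.
Proof.
have M0 := fact_gt0 M; pose n := (3 * M`! - 1)%N.
have nE : (n + 1 = 3 * M`!)%N by rewrite subnK // muln_gt0.
have n3 : (n %% 3 = 2)%N.
  have : ((n + 1) %% 3 = 0)%N by rewrite nE modnMr.
  rewrite -modnDml.
  by have := ltn_pmod n (isT : (0 < 3)%N); case: (n %% 3)%N => [|[|[|]]].
have [q qP [qn q3]] := prime_divisor_mod3 n3; exists q => //.
rewrite ltnNge; apply/negP=> qM.
have : (q %| n + 1)%N by rewrite nE dvdn_mull // dvdn_fact // prime_gt0.
by rewrite dvdn_addr // dvdn1 => /eqP q1; rewrite q1 in qP.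
Qed.

Section ResidueClasses.
Local Open Scope Z_scope.

Definition small_primes : seq Z :=
  [:: 2; 3; 5; 7; 11; 13; 17; 19; 23; 29; 31; 37; 41; 43; 47; 53; 59; 61].

Definition bad_primes : seq Z := [seq q.1.1 | q <- singular_sets].

(** A composite number up to 3917 has a divisor in [small_primes]. *)
Definition classified (zs : seq Z) (n : Z) : bool :=
  [|| Z.ltb 3917 n, has (fun d => Z.ltb d n && Z.eqb (Z.modulo n d) 0) small_primes,
      has (Z.eqb n) bad_primes | has (Z.eqb n) zs].

Lemma residues_classified :
  let zs := map Z.of_nat sporadic_primes in
  all (fun q => all (fun r => classified zs (33 * Z.of_nat q + Z.of_nat r))
                    [:: 5; 14; 20; 23; 26]%N)
    (iota 0 119).
Proof. by vm_compute. Qed.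

Lemma sporadic_content :
  all (fun n => (311 <= n)%N &&
         let z := Z.of_nat n in all (fun q => ~~ Z.eqb (Z.modulo q z) 0) content_primes)
    sporadic_primes.
Proof. by vm_compute. Qed.

Lemma content_primes_range : all (fun q => Z.ltb 0 q && Z.leb q 3917) content_primes.
Proof. by vm_compute. Qed.

End ResidueClasses.

Lemma Zdivide_dvdn p z : Z.divide (Z.of_nat p) z <-> (p %| Z.abs_nat z)%N.
Proof.
split=> [[k ->] | /dvdnP[k kE]].
  by rewrite Zabs2Nat.inj_mul Zabs2Nat.id dvdn_mull.
apply/Z.divide_abs_r; exists (Z.of_nat k).
by rewrite -Zabs2Nat.id_abs kE; lia.
Qed.

Lemma prime_divides_content p : prime p -> Z.divide (Z.of_nat p) content_bound ->
  exists2 q, q \in content_primes & Z.divide (Z.of_nat p) q.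
Proof.
move=> pP; rewrite /content_bound; elim: content_primes => [|q l IHl] /=.
  by move/Zdivide_dvdn; rewrite dvdn1 => /eqP p1; rewrite p1 in pP.
move/Zdivide_dvdn; rewrite Zabs2Nat.inj_mul Euclid_dvdM // => /orP[]/Zdivide_dvdn pq.
  by exists q; rewrite ?mem_head.
by have [q' lq' pq'] := IHl pq; exists q'; rewrite // inE lq' orbT.
Qed.

Lemma good_prime p : prime p -> (3917 < p)%N \/ p \in sporadic_primes ->
  (311 <= p)%N /\ ~ Z.divide (Z.of_nat p) content_bound.
Proof.
move=> pP [p_big | ps].
  split; first by apply: leq_trans (ltnW p_big).
  move/(prime_divides_content pP) => [q lq pq].
  have /andP[/Z.ltb_lt q0 /Z.leb_le q3917] := allP content_primes_range q lq.
  have := Z.divide_pos_le _ _ q0 pq; lia.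
have /andP[p311 /allP pl] := allP sporadic_content p ps; split=> //.
move/(prime_divides_content pP) => [q lq /Z.mod_divide pq].
move/negP: (pl q lq); apply; apply/Z.eqb_eq; apply: pq; lia.
Qed.

Lemma fifth_power_residue p : p ^ 5 = 23 %[mod 33] ->
  (p %% 33)%N \in [:: 5; 14; 20; 23; 26]%N.
Proof.
move=> p5; pose f r := ((r * r %% 33) * (r * r %% 33) %% 33 * r %% 33)%N.
have fE : f (p %% 33)%N = 23%N.
  rewrite -[RHS]/(23 %% 33)%N -p5 /f (modnMm p p) (modnMm (p * p) (p * p)) modnMm.
  by congr (_ %% 33)%N; rewrite !expnS expn0 muln1 !mulnA.
have : (p %% 33 < 33)%N by apply: ltn_pmod.
move: (p %% 33)%N fE => r /eqP fr r33.
have ok : all (fun r => (f r == 23%N) ==> (r \in [:: 5; 14; 20; 23; 26]%N)) (iota 0 33).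
  by vm_compute.
by apply: (implyP (allP ok r _) fr); rewrite mem_iota.
Qed.

Lemma bad_prime p : prime p -> p ^ 5 = 23 %[mod 33] -> (p <= 3917)%N ->
  p \notin sporadic_primes -> Z.of_nat p \in bad_primes.
Proof.
move=> pP /fifth_power_residue pr p_le ps.
have q119 : (p %/ 33)%N \in iota 0 119.
  by rewrite mem_iota /= ltn_divLR // (leq_ltn_trans p_le).
have := allP (allP residues_classified _ q119) _ pr.
have -> : Z.add (Z.mul (Zpos 33%positive) (Z.of_nat (p %/ 33))) (Z.of_nat (p %% 33)) = Z.of_nat p.
  by have := divn_eq p 33; lia.
case/or4P.
- by move/Z.ltb_lt; lia.
- case/hasP=> d ld /andP[/Z.ltb_lt dp /Z.eqb_eq pd].
  have d2 : Z.lt 1 d.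
    by move: ld; rewrite !inE; do 17! [case/orP=> [/eqP->//|]]; move/eqP->.
  have /Zdivide_dvdn : Z.divide (Z.of_nat (Z.to_nat d)) (Z.of_nat p).
    by rewrite Z2Nat.id; [apply/Z.mod_divide => //; lia | lia].
  rewrite Zabs2Nat.id => /(prime_nt_dvdP pP _) dE; have := dE _; lia.
- by case/hasP=> n ln /Z.eqb_eq ->.
case/hasP=> _ /mapP[n ln ->] /Z.eqb_eq /Nat2Z.inj pE.
by rewrite pE ln in ps.
Qed.

Lemma pchar_prime (F : finFieldType) p : prime p -> #|F| = p -> p \in [pchar F].
Proof. by move=> pP Fp; apply: (@card_finPcharP F p 1); rewrite ?expn1. Qed.

Lemma nat_prime_neq0 (F : finFieldType) p q : p \in [pchar F] -> prime q -> p != q ->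
  q%:R != 0 :> F.
Proof. by move=> pF qP; rewrite -(dvdn_pcharf pF) dvdn_prime2 ?(pcharf_prime pF). Qed.

Lemma good_prime_arcs p (Fp Fp2 : finFieldType) : prime p -> (p %% 3 = 2)%N ->
  (3917 < p)%N \/ p \in sporadic_primes -> #|Fp| = p -> #|Fp2| = (p ^ 2)%N ->
  has_PSL211_transitive_arc Fp2 110 /\ ~ has_PSL211_transitive_arc Fp 110.
Proof.
move=> pP p3 p_good cFp cFp2; have [p311 p_bound] := good_prime pP p_good.
split; first exact: arc_in_square pP cFp2 p3 p311 p_bound.
have neq q : (q < 311)%N -> p != q.
  by move=> q311; apply: contraL q311 => /eqP <-; rewrite -leqNgt.
have pF := pchar_prime pP cFp.
by apply: (no_arc_without_cube_root _ _ _ cFp p3); apply: nat_prime_neq0 pF _ _; rewrite ?neq.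
Qed.

Local Open Scope nat_scope.

Theorem theorem1p2 :
  (forall N : nat, exists p : nat,
     [/\ N < p, prime p
       & forall Fp Fp2 : finFieldType, #|Fp| = p -> #|Fp2| = p ^ 2 ->
           has_PSL211_transitive_arc Fp2 110
           /\ ~ has_PSL211_transitive_arc Fp 110])
  /\
  (forall p : nat, prime p -> p ^ 5 = 23 %[mod 33] ->
     forall Fp Fp2 : finFieldType, #|Fp| = p -> #|Fp2| = p ^ 2 ->
       (has_PSL211_transitive_arc Fp2 110
        /\ ~ has_PSL211_transitive_arc Fp 110)
       <-> (3917 < p \/ p \in sporadic_primes)).

Proof.
split=> [N | p pP p5 Fp Fp2 cFp cFp2].
  have [p p_gt [pP p3]] := large_prime_mod3 (N + 3917); exists p; split=> //.
    exact: leq_ltn_trans (leq_addr _ _) p_gt.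
  move=> Fp Fp2; apply: good_prime_arcs => //; left.
  exact: leq_ltn_trans (leq_addl _ _) p_gt.
have pr := fifth_power_residue p5.
have p3 : (p %% 3 = 2)%N.
  have <- : (p %% 33 %% 3 = p %% 3)%N by rewrite modn_dvdm.
  by move: pr; rewrite !inE => /or4P[||| /orP[]] /eqP ->.
split=> [[arc2 _] | p_good]; last exact: good_prime_arcs p_good cFp cFp2.
have [p_gt | p_le] := ltnP 3917 p; first by left.
right; apply: contraT => ps; have pF := card_finPcharP cFp2 pP.
have neq q : (q %% 33)%N \notin [:: 5; 14; 20; 23; 26]%N -> p != q.
  by apply: contra => /eqP <-.
case: (no_arc_bad_prime _ _ _ pF (bad_prime pP p5 p_le ps) arc2);
  by apply: nat_prime_neq0 pF _ _; rewrite ?neq.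
Qed.
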